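(* Suppose $W$ is a symmetric Lipschitz continuous function on $I^2$. Then for any $T>0$ there exists a unique weak solution $\hat\rho(t,\cdot)$, $t\in[0,T]$, of the initial value problem $$\frac{\partial}{\partial t}\hat\rho(t,\theta,\omega,x)+\frac{\partial}{\partial\theta}\left\{\hat\rho(t,\theta,\omega,x)V(t,\theta,\omega,x)\right\}=0,\qquad \hat\rho(0,\theta,\omega,x)=\hat\rho^0_{\theta|\omega}(\theta,\omega,x)\,g(\omega),$$ $$V(t,\theta,\omega,x)=\omega+K\int_I\int_{\mathbb R}\int_{\mathbb S}W(x,y)\sin(\phi-\theta)\hat\rho(t,\phi,\lambda,y)\,d\phi\,d\lambda\,dy,$$ and this solution provides the density of a Borel probability measure on $G$, $$\mu_t(A)=\int_A\hat\rho(t,P)\,dP,\qquad A\in\mathcal B(G),\ t\in[0,T].$$ Furthermore, $d(\mu^n_t,\mu_t)\to0$ as $n\to\infty$ uniformly for $t\in[0,T]$, provided $d(\mu^n_0,\mu_0)\to0$ as $n\to\infty$.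
   Context: $I=[0,1]$, $\mathbb S=\mathbb R/2\pi\mathbb Z$ (identified with $[0,2\pi)$) with distance $d_{\mathbb S}(\theta,\theta')=\min\{|\theta-\theta'|,2\pi-|\theta-\theta'|\}$, $G=\mathbb S\times\mathbb R\times I$ with distance $d_G(P,P')=\sqrt{d_{\mathbb S}(\theta,\theta')^2+(\omega-\omega')^2+(x-x')^2}$ for $P=(\theta,\omega,x)$, $P'=(\theta',\omega',x')$; $\mathcal B(G)$ is the Borel $\sigma$-algebra of $G$. $K\in\mathbb R$ is a fixed coupling constant and $[n]=\{1,\dots,n\}$. For each $n$, $X_n=\{\xi_{n1},\dots,\xi_{nn}\}\subset I$ is a set of points such that $\lim_{n\to\infty}n^{-1}\sum_{i=1}^nf(\xi_{ni})=\int_If(x)\,dx$ for all $f\in C(I)$. Put $W_{nij}=W(\xi_{ni},\xi_{nj})$. The Kuramoto model (KM) is $$\dot\theta_{ni}=\omega_i+Kn^{-1}\sum_{j=1}^nW_{nij}\sin(\theta_{nj}-\theta_{ni}),\qquad \theta_{ni}(0)=\theta^0_i,\quad i\in[n].$$ The $\omega_1,\omega_2,\dots$ are independent identically distributed real random variables with continuous probability density $g$. The initial phases $\theta_i^0$ (possibly depending on $n$) are sampled independently from the conditional distributions with densities $\hat\rho^0_{\theta|\omega}(\theta,\omega_i,\xi_{ni})$, $i\in[n]$. Here $\hat\rho^0_{\theta|\omega}$ is a nonnegative continuous function on $G$, with $\int_{\mathbb S}\hat\rho^0_{\theta|\omega}(\phi,\omega,\xi)\,d\phi=1$ for all $(\omega,\xi)\in\mathbb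 R\times I$, and uniformly continuous in $\xi$: for every $\epsilon>0$ there is $\delta>0$ such that $|\xi_1-\xi_2|<\delta$ implies $|\hat\rho^0_{\theta|\omega}(\theta,\omega,\xi_1)-\hat\rho^0_{\theta|\omega}(\theta,\omega,\xi_2)|<\epsilon$ for all $(\theta,\omega)\in\mathbb S\times\mathbb R$. The convergence statement is for every realization of $(\omega_i)$, $(\theta_i^0)$ for which $d(\mu_0^n,\mu_0)\to 0$. Empirical measure: $\mu^n_t(A)=n^{-1}\sum_{i=1}^n\delta_{P_{ni}(t)}(A)$, $A\in\mathcal B(G)$, with $P_{ni}(t)=(\theta_{ni}(t),\omega_i,\xi_{ni})\in G$. Bounded Lipschitz distance between Borel probability measures on $G$: $d(\mu,\nu)=\sup_{f\in\mathcal L}\left|\int_Gf\,d\mu-\int_Gf\,d\nu\right|$, where $\mathcal L=\{f:G\to[0,1]:\ |f(P)-f(Q)|\le d_G(P,Q)\ \forall P,Q\in G\}$. Weak solution: a family of probability densities $\hat\rho(t,\cdot)$ on $G$, $t\in[0,T]$, such that $t\mapsto\int_Gf(P)\hat\rho(t,P)\,dP$ is continuous for every bounded continuous $f$ on $G$, and for every compactly supported continuous test function $w$ on $[0,T)\times G$ that is continuously differentiable in $(t,\theta)$, $$\int_0^T\int_G\hat\rho(t,P)\left(\frac{\partial w}{\partial t}(t,P)+V(t,P)\frac{\partial w}{\partial\theta}(t,P)\right)dP\,dt+\int_G\hat\rho(0,P)\,w(0,P)\,dP=0,$$ with $\hat\rho(0,\cdot)$ the prescribed initial density. *)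

(* Defs.v *)
From HB Require Import structures.
From mathcomp Require Import all_boot all_order all_algebra.
From mathcomp Require Import all_classical all_reals all_analysis.
From mathcomp Require Import finmap ring lra.

Set Implicit Arguments.
Unset Strict Implicit.
Unset Printing Implicit Defensive.

Import Order.TTheory GRing.Theory Num.Theory.
Import numFieldNormedType.Exports.

Local Open Scope classical_set_scope.
Local Open Scope ring_scope.

(* The space G = S x R x I.  A point of the circle S = R/2piZ is given by its
   representative in [0, 2pi), and I = [0, 1]. *)
Record G (R : realType) := MkG {
  coords : R * R * R ;
  coordsP : (0 <= coords.1.1 < 2 * pi) && (0 <= coords.2 <= 1) }.

HB.instance Definition _ (R : realType) := [isSub for @coords R].
HB.instance Definition _ (R : realType) := [Choice of G R by <:].

Section space.
Context {R : realType}.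
Implicit Types P Q : G R.

Definition phase P : R := (coords P).1.1.
Definition freq P : R := (coords P).1.2.
Definition site P : R := (coords P).2.

Definition wrap (th : R) : R :=
  th - 2 * pi * (Num.floor (th / (2 * pi)))%:~R.

Definition clamp (x : R) : R := Num.max 0 (Num.min x 1).

Lemma twopi_gt0 : 0 < 2 * pi :> R.
Proof. by rewrite mulr_gt0 // pi_gt0. Qed.

Lemma wrap_itv th : 0 <= wrap th < 2 * pi.
Proof.
have := twopi_gt0; rewrite /wrap; move: (2 * pi) => p p0.
have := Num.Theory.floor_itv (th / p).
rewrite ler_pdivlMr // ltr_pdivrMr // intrD mulrDl mulr1z mul1r mulrC.
by move: (p * _) => q /andP[h1 h2]; apply/andP; split; lra.
Qed.

Lemma clamp_itv x : 0 <= clamp x <= 1.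
Proof. by rewrite /clamp le_max lexx /= ge_max ler01 ge_min lexx orbT. Qed.

Lemma mkG_subproof (th om x : R) :
  (0 <= (wrap th, om, clamp x).1.1 < 2 * pi) &&
  (0 <= (wrap th, om, clamp x).2 <= 1).
Proof. by rewrite /= wrap_itv clamp_itv. Qed.

(* The point (th mod 2pi, om, x).  The truncation of x is only there to make
   mkG total: clamp x = x for x in I. *)
Definition mkG (th om x : R) : G R := MkG (mkG_subproof th om x).

Definition dS (a b : R) : R := Num.min `|a - b| (2 * pi - `|a - b|).

Definition dG P Q : R :=
  Num.sqrt (dS (phase P) (phase Q) ^+ 2
            + (freq P - freq Q) ^+ 2 + (site P - site Q) ^+ 2).

Lemma phase_itv P : 0 <= phase P < 2 * pi.
Proof. by have /andP[] := coordsP P. Qed.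

Lemma site_itv P : 0 <= site P <= 1.
Proof. by have /andP[] := coordsP P. Qed.

Lemma dSxx a : dS a a = 0.
Proof.
by rewrite /dS subrr normr0 subr0 (min_idPl _) // ltW // twopi_gt0.
Qed.

Lemma dSC a b : dS a b = dS b a.
Proof. by rewrite /dS distrC. Qed.

Lemma dS_ge0 a b : 0 <= a < 2 * pi -> 0 <= b < 2 * pi -> 0 <= dS a b.
Proof.
move=> /andP[a0 a1] /andP[b0 b1]; rewrite /dS le_min normr_ge0 subr_ge0 /=.
by rewrite ler_norml; apply/andP; split; lra.
Qed.

Lemma dS_eq0 a b : 0 <= a < 2 * pi -> 0 <= b < 2 * pi -> dS a b = 0 -> a = b.
Proof.
move=> /andP[a0 a1] /andP[b0 b1]; rewrite /dS.
have : `|a - b| < 2 * pi by rewrite ltr_norml; apply/andP; split; lra.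
rewrite minEle; case: ifP => _ h => [/normr0_eq0|]; lra.
Qed.

Lemma dS_triangle b a c : 0 <= a < 2 * pi -> 0 <= b < 2 * pi ->
  0 <= c < 2 * pi -> dS a c <= dS a b + dS b c.
Proof.
have normE (x y : R) : `|x - y| = x - y /\ y <= x \/ `|x - y| = y - x /\ x <= y.
  by have [h|/ltW h] := leP x y;
    [right; rewrite distrC|left]; rewrite ger0_norm ?subr_ge0.
move=> /andP[a0 a1] /andP[b0 b1] /andP[c0 c1]; rewrite /dS !minEle.
by case: (normE a c) (normE a b) (normE b c) =>
  [] [-> ?] [] [-> ?] [] [-> ?]; do 3?case: ifP => [|/negbT];
  rewrite -?ltNge => *; lra.
Qed.

Lemma dGxx P : dG P P = 0.
Proof. by rewrite /dG dSxx !subrr !expr0n /= !addr0 sqrtr0. Qed.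

Lemma dGC P Q : dG P Q = dG Q P.
Proof.
by rewrite /dG dSC -(sqrrN (freq P - _)) -(sqrrN (site P - _)) !opprB.
Qed.

Lemma dG_eq0 P Q : dG P Q = 0 -> P = Q.
Proof.
move=> /eqP; rewrite /dG sqrtr_eq0 => h.
have h1 := sqr_ge0 (dS (phase P) (phase Q)).
have h2 := sqr_ge0 (freq P - freq Q).
have h3 := sqr_ge0 (site P - site Q).
have e1 : dS (phase P) (phase Q) ^+ 2 = 0 by lra.
have e2 : (freq P - freq Q) ^+ 2 = 0 by lra.
have e3 : (site P - site Q) ^+ 2 = 0 by lra.
move/eqP: e1; rewrite sqrf_eq0 => /eqP /(dS_eq0 (phase_itv P) (phase_itv Q)).
move/eqP: e2; rewrite sqrf_eq0 subr_eq0 => /eqP.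
move/eqP: e3; rewrite sqrf_eq0 subr_eq0 => /eqP.
rewrite /phase /freq /site => e3 e2 e1.
apply: val_inj => /=; move: e1 e2 e3.
by case: (coords P) (coords Q) => [[? ?] ?] [[? ?] ?] /= -> -> ->.
Qed.

Lemma minkowski3 (a a1 a2 b1 b2 c1 c2 : R) : 0 <= a -> a <= a1 + a2 ->
  Num.sqrt (a ^+ 2 + (b1 + b2) ^+ 2 + (c1 + c2) ^+ 2) <=
  Num.sqrt (a1 ^+ 2 + b1 ^+ 2 + c1 ^+ 2) + Num.sqrt (a2 ^+ 2 + b2 ^+ 2 + c2 ^+ 2).
Proof.
move=> a0 aa.
set s1 := (X in _ <= Num.sqrt X + _); set s2 := (X in _ <= _ + Num.sqrt X).
have s10 : 0 <= s1 by rewrite !addr_ge0 // sqr_ge0.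
have s20 : 0 <= s2 by rewrite !addr_ge0 // sqr_ge0.
rewrite -[leRHS]ger0_norm ?addr_ge0 ?sqrtr_ge0 // -sqrtr_sqr ler_wsqrtr //.
rewrite [X in _ <= X]sqrrD !sqr_sqrtr // -sqrtrM //.
have cs : a1 * a2 + b1 * b2 + c1 * c2 <= Num.sqrt (s1 * s2).
  rewrite (le_trans (ler_norm _)) // -sqrtr_sqr ler_wsqrtr // -subr_ge0.
  have -> : s1 * s2 - (a1 * a2 + b1 * b2 + c1 * c2) ^+ 2 =
    (a1 * b2 - a2 * b1) ^+ 2 + (a1 * c2 - a2 * c1) ^+ 2
    + (b1 * c2 - b2 * c1) ^+ 2 by rewrite /s1 /s2; ring.
  by rewrite !addr_ge0 // sqr_ge0.
have aa2 : a ^+ 2 <= (a1 + a2) ^+ 2 by rewrite ler_sqr ?nnegrE // (le_trans a0).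
rewrite mulr2n; move: cs aa2; rewrite /s1 /s2; set r := Num.sqrt _ => cs aa2.
by rewrite !sqrrD !mulr2n in aa2 *; lra.
Qed.

Lemma dG_triangle Q P S : dG P S <= dG P Q + dG Q S.
Proof.
rewrite /dG -(subrKA (freq Q) (freq P)) -(subrKA (site Q) (site P)).
by apply: minkowski3; [apply: dS_ge0|apply: dS_triangle]; exact: phase_itv.
Qed.

Lemma phase_mkG th om x : phase (mkG th om x) = wrap th. Proof. by []. Qed.
Lemma freq_mkG th om x : freq (mkG th om x) = om. Proof. by []. Qed.
Lemma site_mkG th om x : site (mkG th om x) = clamp x. Proof. by []. Qed.

Lemma clamp_id x : 0 <= x <= 1 -> clamp x = x.
Proof. by move=> /andP[x0 x1]; rewrite /clamp (min_idPl x1) (max_idPr x0). Qed.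

Lemma wrap_id th : 0 <= th < 2 * pi -> wrap th = th.
Proof.
move=> /andP[h0 h1]; rewrite /wrap (@Num.Theory.floor_def _ _ 0) ?mulr0 ?subr0 //.
rewrite divr_ge0 ?(ltW twopi_gt0) //= ltr_pdivrMr ?twopi_gt0 //.
by rewrite add0r mul1r.
Qed.

Lemma mkG_coords P : mkG (phase P) (freq P) (site P) = P.
Proof.
apply: val_inj; rewrite /= wrap_id ?phase_itv // clamp_id ?site_itv //.
by rewrite /phase /freq /site; case: (coords P) => [[]].
Qed.

Lemma dS_wrap_le a b : dS (wrap a) (wrap b) <= `|a - b|.
Proof.
have /andP[a0 a1] := wrap_itv a; have /andP[b0 b1] := wrap_itv b.
have p0 := twopi_gt0.
set k := (Num.floor (a / (2 * pi)) - Num.floor (b / (2 * pi)))%R : int.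
have e : a - b = wrap a - wrap b + 2 * pi * k%:~R.
  by rewrite /wrap /k intrB; ring.
rewrite /dS ge_min; have [k0|k0] := eqVneq k 0.
  by rewrite e k0 mulr0 addr0 lexx.
apply/orP; right; rewrite lerBlDr.
have : 2 * pi <= `|2 * pi * k%:~R| :> R.
  rewrite normrM gtr0_norm // ler_peMr ?(ltW p0) // -intr_norm.
  by rewrite (ler_int _ 1) -gtz0_ge1 normr_gt0.
move=> /le_trans; apply.
have -> : 2 * pi * k%:~R = (a - b) + (wrap b - wrap a) by rewrite e; ring.
by rewrite (le_trans (ler_normD _ _)) // lerD2l distrC.
Qed.

Lemma clamp_le x y : `|clamp x - clamp y| <= `|x - y|.
Proof.
have normE (u v : R) : `|u - v| = u - v /\ v <= u \/ `|u - v| = v - u /\ u <= v.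
  by have [h|/ltW h] := leP u v;
    [right; rewrite distrC|left]; rewrite ger0_norm ?subr_ge0.
case: (normE x y) (normE (clamp x) (clamp y)) => [] [-> ?] [] [-> ?];
  rewrite /clamp !minEle !maxEle; repeat (case: ifP => [|/negbT]);
  rewrite -?ltNge => *; lra.
Qed.

End space.

HB.instance Definition _ (R : realType) := @isMetric.Build R (G R)
  dG dGxx dG_eq0 dGC dG_triangle.

HB.instance Definition _ (R : realType) := isPointed.Build (G R) (mkG 0 0 0).

HB.instance Definition _ (R : realType) :=
  @isMeasurable.Build (sigma_display (@open (G R))) (G R)
    <<s @open (G R) >> (@sigma_algebra0 _ setT (@open (G R)))
    (@sigma_algebraC _ (@open (G R)))
    (@sigma_algebra_bigcup _ setT (@open (G R))).

Lemma sigma_finite_prod d1 d2 (T1 : measurableType d1) (T2 : measurableType d2)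
    (R : realType) (m1 : {sigma_finite_measure set T1 -> \bar R})
    (m2 : {sigma_finite_measure set T2 -> \bar R}) :
  sigma_finite setT (m1 \x m2)%E.
Proof.
have /sigma_finiteP[F [TF ndF Foo]] := sigma_finiteT m1.
have /sigma_finiteP[H [TH ndH Hoo]] := sigma_finiteT m2.
exists (fun n => F n `*` H n).
  rewrite -setXTT TF TH predeqE => -[x y]; split.
    move=> [/= [n _ Fnx] [k _ Hky]]; exists (maxn n k) => //; split.
    - by move: x Fnx; exact/subsetPset/ndF/leq_maxl.
    - by move: y Hky; exact/subsetPset/ndH/leq_maxr.
  by move=> [n _ []/= ? ?]; split; exists n.
move=> k; have [? ?] := Foo k; have [? ?] := Hoo k.
split; first exact: measurableX.
by rewrite product_measure1E// lte_mul_pinfty// ge0_fin_numE.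
Qed.

Definition lebesgue2 {R : realType} :
    set (measurableTypeR R * measurableTypeR R) -> \bar R :=
  (@lebesgue_measure R \x @lebesgue_measure R)%E.

HB.instance Definition _ (R : realType) := Measure.on (@lebesgue2 R).
HB.instance Definition _ (R : realType) := @Measure_isSigmaFinite.Build _ _ _
  (@lebesgue2 R) (sigma_finite_prod lebesgue_measure lebesgue_measure).

Definition lebesgue3 {R : realType} :
    set (measurableTypeR R * measurableTypeR R * measurableTypeR R) -> \bar R :=
  (@lebesgue2 R \x @lebesgue_measure R)%E.

HB.instance Definition _ (R : realType) := Measure.on (@lebesgue3 R).
HB.instance Definition _ (R : realType) := @Measure_isSigmaFinite.Build _ _ _
  (@lebesgue3 R) (sigma_finite_prod lebesgue2 lebesgue_measure).

Section volume.
Context {R : realType}.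
Notation R3 := (measurableTypeR R * measurableTypeR R * measurableTypeR R)%type.

Definition mk3 (p : R3) : G R := mkG p.1.1 p.1.2 p.2.

Definition box : set R3 := (`[0, 2 * pi[%classic `*` setT) `*` `[0, 1]%classic.

Lemma measurable_box : measurable box.
Proof. by apply: measurableX => //; apply: measurableX. Qed.

Lemma dG_mkG_le (a b c a' b' c' : R) :
  dG (mkG a b c) (mkG a' b' c') <= `|a - a'| + `|b - b'| + `|c - c'|.
Proof.
rewrite /dG !phase_mkG !freq_mkG !site_mkG.
have h1 := dS_wrap_le a a'; have h3 := clamp_le c c'.
have h0 := dS_ge0 (wrap_itv a) (wrap_itv a').
have n1 := normr_ge0 (a - a'); have n2 := normr_ge0 (b - b').
have n3 := normr_ge0 (c - c').
rewrite -[leRHS]ger0_norm ?addr_ge0 // -sqrtr_sqr ler_wsqrtr //.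
rewrite -(real_normK (num_real (b - b'))) -(real_normK (num_real (clamp c - _))).
have n4 := normr_ge0 (clamp c - clamp c').
move: h1 h3 h0 n1 n2 n3 n4.
move: (dS _ _) `|a - a'| `|b - b'| `|c - c'| `|clamp c - _| => u v w x y *.
have : u ^+ 2 <= v ^+ 2 by rewrite ler_sqr ?nnegrE.
have : y ^+ 2 <= x ^+ 2 by rewrite ler_sqr ?nnegrE.
have vw : 0 <= v * w by exact: mulr_ge0.
have vx : 0 <= v * x by exact: mulr_ge0.
have wx : 0 <= w * x by exact: mulr_ge0.
by move=> *; nra.
Qed.

Lemma measurable_mk3 : measurable_fun setT mk3.
Proof.
apply: (@measurability _ _ _ _ _ _ (@open (G R))) => //.
move=> _ [U oU <-]; rewrite setTI.
pose Q := (rat * rat * rat * rat)%type.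
pose B (q : Q) : set R3 :=
  (`](ratr q.1.1.1 - ratr q.2), (ratr q.1.1.1 + ratr q.2)[%classic
   `*` `](ratr q.1.1.2 - ratr q.2), (ratr q.1.1.2 + ratr q.2)[%classic)
   `*` `](ratr q.1.2 - ratr q.2), (ratr q.1.2 + ratr q.2)[%classic.
have mB q : measurable (B q).
  by apply: measurableX => //; apply: measurableX.
have -> : mk3 @^-1` U =
    \bigcup_(q : Q) (if pselect (B q `<=` mk3 @^-1` U) then B q else set0).
  apply/seteqP; split => [[[a b] c] /= Up|p [q _]]; last first.
    by case: pselect => // h; exact: h.
  have : nbhs (mk3 (a, b, c)) U by rewrite openE in oU; exact: oU.
  move=> /nbhs_ballP[e /= e0 eU].
  have [r] : exists r : rat, ratr r \in `]0 : R, (e / 6)[.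
    by have [r ?] := @rat_in_itvoo R 0 (e / 6) (divr_gt0 e0 (ltr0n _ 6)); exists r.
  rewrite in_itv /= => /andP[r0 re].
  have pick (x : R) : exists q : rat, x - ratr r < ratr q < x + ratr r.
    have [|q] := @rat_in_itvoo R (x - ratr r) (x + ratr r); first by lra.
    by rewrite in_itv /=; exists q.
  have [qa /andP[qa1 qa2]] := pick a; have [qb /andP[qb1 qb2]] := pick b.
  have [qc /andP[qc1 qc2]] := pick c.
  exists (qa, qb, qc, r) => //.
  case: pselect => [h|[]].
    by rewrite /B /= !in_itv /=; do !split; apply/andP; split; lra.
  move=> [[a' b'] c'] [[]] /=; rewrite !in_itv /=.
  move=> /andP[? ?] /andP[? ?] /andP[? ?]; apply: eU.
  rewrite ballEmdist /=; apply: le_lt_trans (dG_mkG_le _ _ _ _ _ _) _.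
  have n1 : `|a - a'| < 2 * ratr r by rewrite ltr_norml; apply/andP; split; lra.
  have n2 : `|b - b'| < 2 * ratr r by rewrite ltr_norml; apply/andP; split; lra.
  have n3 : `|c - c'| < 2 * ratr r by rewrite ltr_norml; apply/andP; split; lra.
  by lra.
apply: countable_bigcupT_measurable; first exact: countableP.
by move=> q; case: pselect => /= h; [exact: mB|exact: measurable0].
Qed.

Definition vol (A : set (G R)) : \bar R := lebesgue3 (@coords R @` A : set R3).

Lemma volE : vol = pushforward (mrestr lebesgue3 measurable_box) mk3.
Proof.
apply/funext => A; rewrite /vol /pushforward /mrestr; congr (lebesgue3 _).
apply/seteqP; split => [_ [P AP <-]|[[a b] c] [] /= AP [[]] /=].
  split; first by rewrite /= /mk3 mkG_coords.
  have := phase_itv P; have := site_itv P.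
  by rewrite /box /phase /site /= !in_itv /= => -> ->.
rewrite !in_itv /= => h1 _ h2; exists (mk3 (a, b, c)) => //.
by rewrite /= wrap_id // clamp_id.
Qed.

Let vol0 : vol set0 = 0%E.
Proof. by rewrite /vol image_set0 measure0. Qed.

Let vol_ge0 A : (0 <= vol A)%E.
Proof. exact: measure_ge0. Qed.

Let vol_sigma_additive : semi_sigma_additive vol.
Proof.
rewrite volE => F mF tF mUF; rewrite /pushforward preimage_bigcup.
apply: measure_semi_sigma_additive.
- by move=> n; rewrite -[X in measurable X]setTI; exact: measurable_mk3.
- apply/trivIsetP => /= i j _ _ ij; rewrite -preimage_setI.
  by move/trivIsetP : tF => /(_ _ _ _ _ ij) ->//; rewrite preimage_set0.
- by rewrite -preimage_bigcup -[X in measurable X]setTI; exact: measurable_mk3.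
Qed.

HB.instance Definition _ := isMeasure.Build _ _ _ vol
  vol0 vol_ge0 vol_sigma_additive.

End volume.

Section kuramoto.
Context {R : realType}.
Implicit Types (K T : R) (W : R * R -> R) (g : R -> R) (xi : nat -> nat -> R).
Implicit Types (rho : R -> G R -> R).

(* Only the entries xi n i with i < n are relevant: xi n 0, ..., xi n (n - 1)
   are the n points of X_n. *)
Definition equidistributed xi : Prop :=
  (forall n i, (i < n)%N -> 0 <= xi n i <= 1) /\
  forall f : R -> R, {within `[0, 1], continuous f} ->
    n%:R^-1 * \sum_(i < n) f (xi n i) @[n --> \oo] -->
    \int[lebesgue_measure]_(x in `[0, 1]) f x.

Definition is_continuous_pdf g : Prop :=
  [/\ continuous g, forall om, 0 <= g om &
      (\int[lebesgue_measure]_om (g om)%:E = 1)%E].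

Record is_conditional_density (rho0 : G R -> R) : Prop := {
  cond_continuous : continuous rho0 ;
  cond_ge0 : forall P, 0 <= rho0 P ;
  cond_integral : forall om x : R, 0 <= x <= 1 ->
    (\int[lebesgue_measure]_(phi in `[0%R, (2 * pi)%R[)
       (rho0 (mkG phi om x))%:E = 1)%E ;
  cond_unif_continuous : forall e : R, 0 < e -> exists2 d : R, 0 < d &
    forall x1 x2 : R, 0 <= x1 <= 1 -> 0 <= x2 <= 1 -> `|x1 - x2| < d ->
    forall th om : R, `|rho0 (mkG th om x1) - rho0 (mkG th om x2)| < e }.

Section sampling.
Context d (Omega : measurableType d) (Pr : probability Omega R).

Definition mutually_independent (X : nat -> {RV Pr >-> R}) : Prop :=
  forall (J : {fset nat}) (A : nat -> set R), (forall i, measurable (A i)) ->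
  (Pr (\bigcap_(i in [set` J]) (X i @^-1` A i))
   = \prod_(i <- J) Pr (X i @^-1` A i))%E.

Definition iid_with_density (om : nat -> {RV Pr >-> R}) g : Prop :=
  mutually_independent om /\
  forall i (A : set R), measurable A ->
    (distribution Pr (om i) A = \int[lebesgue_measure]_(x in A) (g x)%:E)%E.

(* Conditionally on om_0, ..., om_(n-1), the phases th0 n 0, ..., th0 n (n-1)
   are independent, with densities rho0(., om_i, xi_ni) on [0, 2pi). *)
Definition conditionally_sampled (om : nat -> {RV Pr >-> R})
    (th0 : nat -> nat -> {RV Pr >-> R}) xi (rho0 : G R -> R) : Prop :=
  (forall n i o, 0 <= th0 n i o < 2 * pi) /\
  forall n (A B : nat -> set R),
    (forall i, measurable (A i)) -> (forall i, measurable (B i)) ->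
  (Pr (\bigcap_(i in `I_n) (om i @^-1` A i `&` th0 n i @^-1` B i)) =
   \int[Pr]_(o in \bigcap_(i in `I_n) (om i @^-1` A i))
     (\prod_(i < n) \int[lebesgue_measure]_(phi in `[0%R, 2 * pi[ `&` B i)
         rho0 (mkG phi (om i o) (xi n i)))%R%:E)%E.

End sampling.

(* The phases are represented by real-valued lifts.  Continuity at t = 0 and
   the equation for t > 0 give the one-sided equation at t = 0. *)
Definition kuramoto_solution K W n (xi om th0 : nat -> R)
    (th : nat -> R -> R) : Prop :=
  forall i, (i < n)%N ->
  [/\ th i 0 = th0 i, {within `[0, +oo[, continuous (th i)} &
      forall t : R, 0 < t -> is_derive t 1 (th i)
        (om i + K * n%:R^-1 *
           \sum_(j < n) W (xi i, xi j) * sin (th j t - th i t))].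

Definition empirical n (p : nat -> G R) : {measure set G R -> \bar R} :=
  mscale (n%:R^-1)%:nng (msum (fun i => dirac (p i)) n).

Definition BL : set (G R -> R) :=
  [set f | (forall P, 0 <= f P <= 1) /\
           (forall P Q, `|f P - f Q| <= dG P Q)].

Definition bl_dist (mu nu : {measure set G R -> \bar R}) : R :=
  sup [set `|\int[mu]_P f P - \int[nu]_P f P| | f in BL].

Definition velocity K W rho (t : R) (P : G R) : R :=
  freq P + K * \int[lebesgue_measure]_(y in `[0, 1])
    \int[lebesgue_measure]_la
      \int[lebesgue_measure]_(phi in `[0, 2 * pi[)
        (W (site P, y) * sin (phi - phase P) * rho t (mkG phi la y)).

(* w is a test function on [0, T) x G, with partial derivatives wt in t and
   wth in theta.  Since wt is continuous on [0, T) x G, it is also the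
   one-sided t-derivative at t = 0. *)
Record is_test_function T (w wt wth : R * G R -> R) : Prop := {
  test_continuous : {within `[0, T[ `*` setT, continuous w} ;
  test_dt_continuous : {within `[0, T[ `*` setT, continuous wt} ;
  test_dth_continuous : {within `[0, T[ `*` setT, continuous wth} ;
  test_dt : forall (t : R) (P : G R), 0 < t < T ->
    is_derive t 1 (fun s => w (s, P)) (wt (t, P)) ;
  test_dth : forall (t : R) (P : G R), 0 <= t < T ->
    is_derive (phase P) 1 (fun s => w (t, mkG s (freq P) (site P))) (wth (t, P)) ;
  test_compact_support : exists C : set (R * G R),
    [/\ compact C, C `<=` `[0, T[ `*` setT &
        forall (t : R) (P : G R), 0 <= t < T -> ~ C (t, P) -> w (t, P) = 0] }.

Record is_weak_solution K W g (rho0 : G R -> R) T rho : Prop := {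
  weak_measurable : forall t : R, 0 <= t <= T -> measurable_fun setT (rho t) ;
  weak_ge0 : forall (t : R) (P : G R), 0 <= t <= T -> 0 <= rho t P ;
  weak_mass : forall t : R, 0 <= t <= T -> (\int[vol]_P (rho t P)%:E = 1)%E ;
  weak_continuous : forall f : G R -> R,
    continuous f -> (exists M : R, forall P, `|f P| <= M) ->
    {within `[0, T], continuous (fun t : R => \int[vol]_P (f P * rho t P))} ;
  weak_init : forall P, rho 0 P = rho0 P * g (freq P) ;
  weak_equation : forall w wt wth, is_test_function T w wt wth ->
    \int[lebesgue_measure]_(t in `[0, T[)
      (\int[vol]_P (rho t P * (wt (t, P) + velocity K W rho t P * wth (t, P))))
    + \int[vol]_P (rho 0 P * w (0, P)) = 0 }.

End kuramoto.

(* Main.v *)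
Require Import Defs.
From HB Require Import structures.
From mathcomp Require Import all_boot all_order all_algebra.
From mathcomp Require Import all_classical all_reals all_analysis.
From mathcomp Require Import ring lra.
From mathcomp Require Import measurable_realfun.

(** The continuity equation is solved by characteristics, following Dobrushin
and Neunzert.  An oscillator is described by its initial phase, its frequency
and its site; the last two never change.  The velocity field is the frequency
plus a first harmonic in the phase,
  wave a b t th x = b t x cos th - a t x sin th,
whose amplitudes a and b are averages of cos and sin over the population (order
parameters).  Phases are lifted to the line, time is frozen outside [0, T], and
functions descend to G when they are periodic in the phase.

Existence.  Picard iteration (picard) in a class of maps that are Lipschitz in
the initial data gives a motion u in which every point of the population moves
in the mean field of the initial law m0 (mean_field_exists).  This u is the
flow of a first harmonic; it preserves the circle, is differentiable in the
phase, and has a differentiable inverse.  Hence the image of m0 under u t has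
the density obtained by dividing the initial density by the Jacobian
(transported_image).  For a test function w, the integral of w (t, u t P) over
m0 is differentiable in t, its derivative is the integrand of the weak equation,
and it vanishes before T; this is the weak equation (transport_weak_equation).

Uniqueness.  A weak solution defines a velocity field, with a flow X and inverse
Y.  The functions k (Y t) c e, with k, c, e depending on the phase, the
frequency and the site, are constant along X.  Multiplied by functions of time
they are test functions, and the weak equation shows that their integrals
against the solution do not depend on time (law_back_constant).  Such products
determine a measure (test_determines), so the solution at time t is the image of
the initial law under X t (law_image), and X is then itself a mean-field motion
(law_mean_field).  Mean-field motions with a given initial law are unique by
Gronwall (mean_field_unique), hence so are weak solutions
(weak_solution_unique).

Convergence.  The oscillator i of the finite model is compared with the
trajectory of the mean-field motion that starts at the same point.  The two
velocities differ by the deviations of all oscillators, and by the difference of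
the averages of a bounded Lipschitz kernel over the initial empirical measure
and over m0, which is at most a constant times their bounded Lipschitz distance.
Gronwall for the whole family (gronwall, particle_close) bounds the deviations
by that distance, and the distance at time t follows because u t is Lipschitz
(empirical_close). *)

Set Implicit Arguments.
Unset Strict Implicit.
Unset Printing Implicit Defensive.

Import Order.TTheory GRing.Theory Num.Theory.
Import numFieldNormedType.Exports.

Local Open Scope classical_set_scope.
Local Open Scope ring_scope.

(** * Comparison and existence for differential equations with a parameter *)

Section calculus.
Context {R : realType}.
Implicit Types (f g F : R -> R) (a b t T : R).

Lemma is_derive_continuous f t l : is_derive t 1 f l -> {for t, continuous f}.
Proof. by move=> [df _]; exact/differentiable_continuous/derivable1_diffP. Qed.

Lemma is_derive_add f g t df dg : is_derive t 1 f df -> is_derive t 1 g dg ->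
  is_derive t 1 (fun s : R => f s + g s) (df + dg).
Proof. by move=> hf hg; exact: is_deriveD. Qed.

Lemma is_derive_sub f g t df dg : is_derive t 1 f df -> is_derive t 1 g dg ->
  is_derive t 1 (fun s : R => f s - g s) (df - dg).
Proof. by move=> hf hg; exact: is_deriveB. Qed.

Lemma is_derive_mul f g t df dg : is_derive t 1 f df -> is_derive t 1 g dg ->
  is_derive t 1 (fun s : R => f s * g s) (df * g t + f t * dg).
Proof.
move=> hf hg; have := is_deriveM hf hg.
by rewrite /GRing.scale /= addrC (mulrC (g t)).
Qed.

Lemma is_derive_const (c t : R) : is_derive t 1 (fun _ : R => c) 0.
Proof. exact: is_derive_cst. Qed.

Lemma is_derive_ident t : is_derive t 1 (fun s : R => s) 1.
Proof. exact: is_derive_id. Qed.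

Lemma is_derive_scale (k : R) f t df : is_derive t 1 f df ->
  is_derive t 1 (fun s : R => k * f s) (k * df).
Proof. by move=> hf; exact: is_deriveZ. Qed.

Lemma is_derive_compose f g t df dg : is_derive (g t) 1 f df -> is_derive t 1 g dg ->
  is_derive t 1 (fun s : R => f (g s)) (df * dg).
Proof. by move=> hf hg; exact: is_derive1_comp. Qed.

Section continuity.
Variables (X : topologicalType) (f g : X -> R).
Hypotheses (cf : continuous f) (cg : continuous g).

Lemma continuous_add : continuous (fun x => f x + g x).
Proof. by move=> x; apply: cvgD; [exact: cf|exact: cg]. Qed.

Lemma continuous_sub : continuous (fun x => f x - g x).
Proof. by move=> x; apply: cvgB; [exact: cf|exact: cg]. Qed.

Lemma continuous_opp : continuous (fun x => - f x).
Proof. by move=> x; apply: cvgN; exact: cf. Qed.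

Lemma continuous_mul : continuous (fun x => f x * g x).
Proof. by move=> x; apply: cvgM; [exact: cf|exact: cg]. Qed.

Lemma continuous_after (h : R -> R) : continuous h -> continuous (fun x => h (f x)).
Proof. by move=> ch x; apply: (@continuous_comp _ _ _ f h); [exact: cf|exact: ch]. Qed.

End continuity.

Lemma continuous_const (X : topologicalType) (c : R) : continuous (fun _ : X => c).
Proof. by move=> x; exact: cvg_cst. Qed.

Lemma continuous_ident : continuous (fun t : R => t).
Proof. by move=> x; exact: cvg_id. Qed.

Lemma within_itv_continuous f a b : continuous f ->
  {within `[a, b], continuous f}.
Proof. by move=> cf; exact: continuous_subspaceT. Qed.

(** The mean value inequality with a bound of the derivative that depends on time,
as comparison with an exponential requires. *)
Lemma ler_variation f g df dg a b : a <= b ->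
  {within `[a, b], continuous f} -> {within `[a, b], continuous g} ->
  (forall t, a < t < b -> is_derive t 1 f (df t)) ->
  (forall t, a < t < b -> is_derive t 1 g (dg t)) ->
  (forall t, a < t < b -> `|df t| <= dg t) ->
  `|f b - f a| <= g b - g a.
Proof.
move=> ab cf cg hf hg hfg.
have mono (h dh : R -> R) : {within `[a, b], continuous h} ->
    (forall t, a < t < b -> is_derive t 1 h (dh t)) ->
    (forall t, a < t < b -> 0 <= dh t) -> h a <= h b.
  move=> ch hh h0; apply: (@ger0_derive1_le_cc R h a b) => //.
  - by move=> t; rewrite in_itv /= => /hh[].
  - move=> t; rewrite in_itv /= => tab; have [_ dht] := hh _ tab.
    by rewrite derive1E dht h0.
  - by rewrite in_itv /= lexx ab.
  - by rewrite in_itv /= lexx ab.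
have h1 : g a - f a <= g b - f b.
  apply: (mono (fun t => g t - f t) (fun t => dg t - df t)).
  - by move=> x; apply: continuousB; [exact: cg|exact: cf].
  - by move=> t tab; apply: is_deriveB; [exact: hg|exact: hf].
  - by move=> t /hfg; rewrite subr_ge0; apply: le_trans; exact: ler_norm.
have h2 : g a + f a <= g b + f b.
  apply: (mono (fun t => g t + f t) (fun t => dg t + df t)).
  - by move=> x; apply: continuousD; [exact: cg|exact: cf].
  - by move=> t tab; apply: is_deriveD; [exact: hg|exact: hf].
  - by move=> t /hfg; rewrite ler_norml => /andP[h _]; lra.
by rewrite ler_norml; apply/andP; split; lra.
Qed.

Lemma is_derive_unique f g df a : f a = g a ->
  (forall t, is_derive t 1 f (df t)) -> (forall t, is_derive t 1 g (df t)) ->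
  f = g.
Proof.
move=> fga hf hg; apply/funext => t.
have h (x : R) : is_derive x 1 (f - g) 0.
  by rewrite -(subrr (df x)); exact: is_deriveB.
have : (f - g) t = (f - g) a by apply: is_derive_0_is_cst.
by rewrite !fctE fga subrr => /eqP; rewrite subr_eq0 => /eqP.
Qed.

(** Integrals from -N to t, for large N, differ by constants and glue to a
primitive on the whole line. *)
Lemma exists_primitive f : continuous f ->
  exists F, F 0 = 0 /\ forall t, is_derive t 1 F (f t).
Proof.
move=> cf.
have fi a b : lebesgue_measure.-integrable `[a, b] (EFin \o f).
  apply: continuous_compact_integrable; first exact: segment_compact.
  exact: continuous_subspaceT.
pose I N t := \int[lebesgue_measure]_(s in `[- N, t]) f s.
pose H N t := I N t - I N 0.
have HE N M t : 0 <= M -> M <= N -> - M <= t -> H N t = H M t.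
  move=> M0 MN Mt; rewrite /H /I.
  have c (s : R) : - M <= s ->
      \int[lebesgue_measure]_(s in `[- N, s]) f s =
      \int[lebesgue_measure]_(s in `[- N, - M]) f s +
      \int[lebesgue_measure]_(s in `[- M, s]) f s.
    move=> Ms.
    have := @Rintegral_itvB R f (BLeft (- N)) (BRight s) (- M) (fi _ _).
    rewrite !bnd_simp lerN2 MN => /(_ isT Ms) /eqP.
    rewrite subr_eq => /eqP ->; rewrite addrC; congr (_ + _).
    by apply: Rintegral_itv_obnd_cbnd; apply: integrableS (fi (- M) s) => //;
      by move=> x /=; rewrite !in_itv /= => /andP[/ltW -> ->].
  by rewrite (c t) // (c 0) ?oppr_le0 //; ring.
exists (fun t => H (`|t| + 1) t); split; first by rewrite /H subrr.
move=> t; pose N := `|t| + 3.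
(* N = |t| + 3 leaves room for the points at distance less than 1 from t. *)
have near_eq : \forall s \near t, H N s = H (`|s| + 1) s.
  near=> s; apply: HE; rewrite ?addr_ge0 //.
    rewrite /N; have : `|s| <= `|t| + `|s - t|.
      by rewrite -{1}(subrK t s) addrC ler_normD.
    have : `|s - t| < 1 by rewrite distrC; near: s; exact: cvgr_dist_lt.
    by lra.
  by rewrite lerNl (le_trans (ler_norm _)) // normrN lerDl.
have dH : is_derive t 1 (H N) (f t).
  have [|||d dE] := @continuous_FTC1_closed R f (- N) t (t + 1) _ (fi _ _).
  - by rewrite ltrDl.
  - by rewrite /N; have := ler_norm (- t); rewrite normrN; lra.
  - exact: cf.
  have -> : H N = I N - cst (I N 0) by [].
  rewrite -(subr0 (f t)); apply: is_deriveB; rewrite -dE derive1E.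
  exact/derivableP.
apply: near_eq_is_derive near_eq _ => //.
Unshelve. all: by end_near. Qed.

Lemma exists_half_lt (c e : R) : 0 < e -> exists n, c * 2^-1 ^+ n <= e.
Proof.
move=> e0; have [c0|c0] := leP c 0.
  by exists 0%N; rewrite expr0 mulr1 (le_trans c0) // ltW.
have := @cvg_expr R 2^-1; rewrite ger0_norm // => /(_ _).
have /[swap] /[apply] : (2^-1 : R) < 1 by lra.
move=> /cvgr0Pnorm_le /(_ (e / c)) []; first by rewrite divr_gt0.
move=> n _ /(_ n (leqnn n)) /=; rewrite ger0_norm ?exprn_ge0 // => h.
by exists n; rewrite mulrC -ler_pdivlMr.
Qed.

Lemma ler_half_limit (a b c : R) : (forall n, a <= b + c * 2^-1 ^+ n) -> a <= b.
Proof.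
move=> h; apply/ler_addgt0Pr => e e0; have [n hn] := exists_half_lt c e0.
by rewrite (le_trans (h n)) // lerD2l.
Qed.

Lemma half_cauchy (a : nat -> R) (K : R) :
  (forall n, `|a n.+1 - a n| <= K * 2^-1 ^+ n) ->
  exists l, forall n, `|a n - l| <= 2 * K * 2^-1 ^+ n.
Proof.
move=> ha.
have up n m : `|a (n + m)%N - a n| <= 2 * K * (2^-1 ^+ n - 2^-1 ^+ (n + m)).
  elim: m => [|m IH]; first by rewrite addn0 !subrr normr0 mulr0.
  have := ha (n + m)%N; rewrite addnS exprS.
  have := ler_normD (a (n + m).+1 - a (n + m)%N) (a (n + m)%N - a n).
  by rewrite addrA subrK; lra.
have K0 : 0 <= K by have := ha 0%N; rewrite expr0 mulr1; apply: le_trans.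
have half0 n : 0 <= 2^-1 ^+ n :> R by rewrite exprn_ge0.
have up1 n m : `|a (n + m)%N - a n| <= 2 * K * 2^-1 ^+ n.
  by have := mulr_ge0 K0 (half0 (n + m)%N); have := up n m; lra.
pose w n := a n - 2 * K * 2^-1 ^+ n.
have wle n m : w m <= a n + 2 * K * 2^-1 ^+ n.
  rewrite /w; have := mulr_ge0 K0 (half0 n); have := mulr_ge0 K0 (half0 m).
  have [nm|/ltnW nm] := leqP n m.
    have := up1 n (m - n)%N; rewrite subnKC // ler_norml => /andP[]; lra.
  have := up1 m (n - m)%N; rewrite subnKC // ler_norml => /andP[]; lra.
have sw : has_sup (range w).
  split; first by exists (w 0%N), 0%N.
  by exists (a 0%N + 2 * K * 2^-1 ^+ 0) => _ [m _ <-]; exact: wle.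
exists (sup (range w)) => n; rewrite ler_norml; apply/andP; split.
  have : sup (range w) <= a n + 2 * K * 2^-1 ^+ n.
    by apply: ge_sup => [|_ [m _ <-]]; [exists (w 0%N), 0%N|exact: wle].
  lra.
have : w n <= sup (range w) by apply: ub_le_sup; [case: sw|exists n].
by rewrite /w; lra.
Qed.

Lemma is_derive_expRM (l t : R) :
  is_derive t 1 (fun s : R => expR (l * s)) (l * expR (l * t)).
Proof.
have := is_derive_compose (is_derive_expR (l * t)) (is_derive_scale l (is_derive_ident t)).
by rewrite mulr1 mulrC.
Qed.

Lemma is_derive_affine (c0 c1 t : R) : is_derive t 1 (fun s : R => c0 + c1 * s) c1.
Proof.
have := is_derive_add (is_derive_const c0 t) (is_derive_scale c1 (is_derive_ident t)).
by rewrite mulr1 add0r.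
Qed.

(** The function e^{(2L+1)t} is a supersolution that beats the Lipschitz
constant L by a factor 2, so that any exponential bound on the family can be
halved, up to the source terms, until only these remain. *)
Lemma gronwall_half (X : Type) (y dy : X -> R -> R) (T L e A D : R) :
  0 <= L -> 0 <= e -> 0 <= D ->
  (forall x, {within `[0, T], continuous (y x)}) ->
  (forall x t, 0 < t < T -> is_derive t 1 (y x) (dy x t)) ->
  (forall x, `|y x 0| <= A) ->
  (forall x t, 0 <= t <= T -> `|y x t| <= D * expR ((2 * L + 1) * t)) ->
  (forall t (E : R), 0 < t < T -> (forall x, `|y x t| <= E) ->
     forall x, `|dy x t| <= L * E + e) ->
  forall x t, 0 <= t <= T ->
    `|y x t| <= (A + e * T + D / 2) * expR ((2 * L + 1) * t).
Proof.
move=> L0 e0 D0 cy hy yA yD hdy x t /andP[t0 tT].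
set lam := 2 * L + 1; have lam0 : 0 <= lam by rewrite /lam; lra.
have sub s : 0 < s < t -> 0 < s < T.
  by move=> /andP[-> /lt_le_trans]; apply.
have := @ler_variation (y x) (fun s => D / 2 * expR (lam * s) + e * s) (dy x)
  (fun s => D / 2 * (lam * expR (lam * s)) + e) 0 t t0.
have dg (s : R) : is_derive s 1 (fun s : R => D / 2 * expR (lam * s) + e * s)
   (D / 2 * (lam * expR (lam * s)) + e).
  have := is_derive_add (is_derive_scale (D / 2) (is_derive_expRM lam s))
    (is_derive_scale e (is_derive_ident s)).
  by rewrite mulr1.
move=> /(_ _ _ _ _ _) h0.
have {}h0 : `|y x t - y x 0| <= D / 2 * expR (lam * t) + e * t -
    (D / 2 * expR (lam * 0) + e * 0).
- apply: h0.
- apply: continuous_subspaceW (cy x) => s /=; rewrite !in_itv /=.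
  by move=> /andP[-> /le_trans]; apply.
- apply: within_itv_continuous => s; exact: is_derive_continuous (dg s).
- by move=> s /sub; exact: hy.
- move=> s st; have := hdy s (D * expR (lam * s)) (sub _ st) _ x.
  move=> /(_ _) h; apply: le_trans (h _) _.
    move=> z; apply: yD; have /andP[/ltW -> /ltW s1] := st.
    exact: le_trans s1 tT.
  rewrite lerD2r.
  have := mulr_ge0 D0 (expR_ge0 (lam * s)); rewrite /lam; nra.
move: h0; rewrite !mulr0 expR0 mulr1 addr0 => h.
have e1 : 1 <= expR (lam * t) by rewrite -expR0 ler_expR mulr_ge0.
have h2 := yA x; have A0 := le_trans (normr_ge0 _) h2.
have h3 := ler_normD (y x t - y x 0) (y x 0); rewrite subrK in h3.
have eT : e * t <= e * T by rewrite ler_wpM2l.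
have eT0 : 0 <= e * T by rewrite mulr_ge0 // (le_trans t0).
have : A + e * T <= (A + e * T) * expR (lam * t).
  by rewrite ler_peMr // addr_ge0.
by rewrite mulrDl; lra.
Qed.

(** The derivative of one member is bounded through the supremum of the whole
family, because the velocity of an oscillator depends on all the others.  The
a priori bound B makes this supremum finite, and iterated halving removes B from
the estimate. *)
Lemma gronwall (X : Type) (y dy : X -> R -> R) (T L e A B : R) :
  0 <= L -> 0 <= e ->
  (forall x, {within `[0, T], continuous (y x)}) ->
  (forall x t, 0 < t < T -> is_derive t 1 (y x) (dy x t)) ->
  (forall x, `|y x 0| <= A) ->
  (forall x t, 0 <= t <= T -> `|y x t| <= B) ->
  (forall t (E : R), 0 < t < T -> (forall x, `|y x t| <= E) ->
     forall x, `|dy x t| <= L * E + e) ->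
  forall x t, 0 <= t <= T ->
    `|y x t| <= 2 * (A + e * T) * expR ((2 * L + 1) * T).
Proof.
move=> L0 e0 cy hy yA yB hdy x t tT; set lam := 2 * L + 1.
have T0 : 0 <= T by case/andP: tT => /le_trans; apply.
have A0 : 0 <= A by apply: le_trans (yA x).
have B0 : 0 <= B by apply: le_trans (yB x t tT).
have lam0 : 0 <= lam by rewrite /lam; lra.
have AT0 : 0 <= A + e * T by rewrite addr_ge0 ?mulr_ge0.
have step n : forall x t, 0 <= t <= T ->
    `|y x t| <= (2 * (A + e * T) + B * 2^-1 ^+ n) * expR (lam * t).
  elim: n => [|n IH] z s sT.
    rewrite expr0 mulr1 (le_trans (yB z s sT)) //.
    have : 1 <= expR (lam * s).
      by rewrite -expR0 ler_expR mulr_ge0 //; case/andP: sT.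
    by move=> h; rewrite -[leLHS]mulr1 ler_pM // ler_wpDl // mulr_ge0.
  have {}IH := gronwall_half L0 e0 _ cy hy yA IH hdy.
  apply: le_trans (IH _ z s sT) _.
    by rewrite addr_ge0 // mulr_ge0 ?exprn_ge0.
  by rewrite ler_pM2r ?expR_gt0 // exprS; lra.
apply: (@ler_half_limit _ _ (B * expR (lam * T))) => n.
apply: le_trans (step n x t tT) _.
have -> : B * expR (lam * T) * 2^-1 ^+ n = B * 2^-1 ^+ n * expR (lam * T).
  by ring.
rewrite -mulrDl ler_wpM2l ?ler_expR ?ler_wpM2l //; last by case/andP: tT.
by rewrite addr_ge0 ?mulr_ge0 ?exprn_ge0.
Qed.

(** Freezing the time outside [0, T] turns an equation on [0, T] into one on the
line, where solutions are total functions without endpoints. *)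
Definition cut T t : R := Num.max 0 (Num.min t T).

Lemma cut_itv T t : 0 <= T -> 0 <= cut T t <= T.
Proof. by move=> T0; rewrite /cut le_max lexx /= ge_max T0 ge_min lexx orbT. Qed.

Lemma cut_id T t : 0 <= t <= T -> cut T t = t.
Proof. by move=> /andP[t0 tT]; rewrite /cut (min_idPl tT) (max_idPr t0). Qed.

Lemma cut_dist T s t : `|cut T s - cut T t| <= `|s - t|.
Proof.
have normE (u v : R) : `|u - v| = u - v /\ v <= u \/ `|u - v| = v - u /\ u <= v.
  by have [h|/ltW h] := leP u v;
    [right; rewrite distrC|left]; rewrite ger0_norm ?subr_ge0.
case: (normE s t) (normE (cut T s) (cut T t)) => [] [-> ?] [] [-> ?];
  rewrite /cut !minEle !maxEle; repeat (case: ifP => [|/negbT]);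
  rewrite -?ltNge => *; lra.
Qed.

Lemma lipschitz_continuous f (k : R) :
  (forall s t, `|f s - f t| <= k * `|s - t|) -> continuous f.
Proof.
move=> hf t; apply/cvgrPdist_le => e e0; near=> s.
have k0 : 0 <= `|k| by [].
apply: le_trans (hf _ _) _; apply: (@le_trans _ _ ((`|k| + 1) * `|t - s|)).
  rewrite ler_wpM2r // (le_trans (ler_norm _)) //; lra.
rewrite mulrC -ler_pdivlMr; last by lra.
near: s; apply: cvgr_dist_le; first exact: cvg_id.
by rewrite divr_gt0 //; lra.
Unshelve. all: by end_near. Qed.

Lemma continuous_cut T : continuous (cut T).
Proof.
by apply: (@lipschitz_continuous _ 1) => s t; rewrite mul1r cut_dist.
Qed.

(** The field N acts on functions of a parameter x, so that one statement
covers both an ordinary equation for each x and equations that couple all the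
parameters through an integral.  The predicate adm collects the regularity that
makes N meaningful; it has to survive one integration and uniform limits. *)
Lemma picard (X : Type) (T L C : R) (u0 c : X -> R)
    (N : R -> (X -> R) -> X -> R) (adm : (R -> X -> R) -> Prop) :
  0 <= T -> 0 <= L -> 0 <= C ->
  adm (fun t x => u0 x + c x * t) ->
  (forall u (v : R -> X -> R), adm u -> (forall x, v 0 x = u0 x) ->
     (forall t x, is_derive t 1 (v ^~ x) (N (cut T t) (u (cut T t)) x)) ->
     adm v) ->
  (forall (w : nat -> R -> X -> R) u, (forall n, adm (w n)) ->
     (forall e : R, 0 < e -> exists n, forall t x, 0 <= t <= T ->
        `|w n t x - u t x| <= e) -> adm u) ->
  (forall u, adm u -> forall x, continuous (fun t => N (cut T t) (u (cut T t)) x)) ->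
  (forall u t x, adm u -> 0 <= t <= T -> `|N t (u t) x - c x| <= C) ->
  (forall u v t (D : R), adm u -> adm v -> 0 <= t <= T ->
     (forall x, `|u t x - v t x| <= D) ->
     forall x, `|N t (u t) x - N t (v t) x| <= L * D) ->
  exists u, [/\ adm u, forall x, u 0 x = u0 x &
    forall t x, is_derive t 1 (u ^~ x) (N (cut T t) (u (cut T t)) x)].
Proof.
move=> T0 L0 C0 adm0 admI admL cN bN lN.
pose next (u v : {u | adm u}) := (forall x, sval v 0 x = u0 x) /\
  forall t x, is_derive t 1 (sval v ^~ x) (N (cut T t) (sval u (cut T t)) x).
have /choice[F HF] : forall u, exists v, next u v.
  move=> [u au].
  have /choice[P HP] : forall x, exists P : R -> R, P 0 = 0 /\
      forall t, is_derive t 1 P (N (cut T t) (u (cut T t)) x).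
    by move=> x; exact/exists_primitive/cN.
  pose v t x := u0 x + P x t.
  have v0 x : v 0 x = u0 x by rewrite /v (HP x).1 addr0.
  have dv t x : is_derive t 1 (v ^~ x) (N (cut T t) (u (cut T t)) x).
    by have := is_derive_add (is_derive_const (u0 x) t) ((HP x).2 t); rewrite add0r.
  by exists (exist _ v (admI u v au v0 dv)).
pose w n := sval (iter n F (exist _ _ adm0)).
have wadm n : adm (w n) by exact: svalP.
have w0 n x : w n 0 x = u0 x.
  by case: n => [|n]; [rewrite /w /= mulr0 addr0|exact: (HF _).1].
have dw n t x : is_derive t 1 (w n.+1 ^~ x) (N (cut T t) (w n (cut T t)) x).
  exact: (HF _).2.
have var (u v : R -> X -> R) (du dv : X -> R -> R) (g dg : R -> R) t x :
    (forall s : R, is_derive s 1 (u ^~ x) (du x s)) ->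
    (forall s : R, is_derive s 1 (v ^~ x) (dv x s)) ->
    (forall s : R, is_derive s 1 g (dg s)) -> u 0 x = v 0 x -> 0 <= t <= T ->
    (forall s, 0 <= s <= T -> `|du x s - dv x s| <= dg s) ->
    `|u t x - v t x| <= g t - g 0.
  move=> hu hv hg uv0 /andP[t0 tT] h.
  have := @ler_variation (u^~ x - v^~ x) g (fun s => du x s - dv x s) dg 0 t t0.
  rewrite !fctE uv0 subrr subr0; apply.
  - apply: within_itv_continuous => s.
    by have := is_deriveB (hu s) (hv s); exact: is_derive_continuous.
  - by apply: within_itv_continuous => s; exact: is_derive_continuous.
  - by move=> s /andP[/ltW s0 /ltW st]; apply: h; rewrite s0 (le_trans st).
set lam := 2 * L + 1; have lam0 : 0 <= lam by rewrite /lam; lra.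
have CT0 : 0 <= C * T by rewrite mulr_ge0.
have e1 t : 0 <= t <= T -> 1 <= expR (lam * t).
  by move=> /andP[t0 _]; rewrite -expR0 ler_expR mulr_ge0.
(* In the norm weighted by e^{- lam t} each iteration halves the increments. *)
have incr n : forall t x, 0 <= t <= T ->
    `|w n.+1 t x - w n t x| <= C * T * 2^-1 ^+ n * expR (lam * t).
  elim: n => [|n IH] t x tT.
    have := @var (w 1%N) (w 0%N) (fun x t => N (cut T t) (w 0%N (cut T t)) x)
      (fun x _ => c x) (fun s => 0 + C * s) (fun=> C) t x.
    rewrite mulr0 addr0 subr0 add0r => h.
    apply: le_trans (h _ _ _ _ tT _) _ => //.
    + by move=> s; exact: is_derive_affine.
    + by move=> s; exact: is_derive_affine.
    + by rewrite !w0.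
    + by move=> s sT; apply: bN; [exact: wadm|exact: cut_itv].
    + rewrite expr0 mulr1 (@le_trans _ _ (C * T)) //.
        by rewrite ler_wpM2l //; case/andP: tT.
      by rewrite ler_peMr // e1.
  set K := C * T * 2^-1 ^+ n in IH.
  have K0 : 0 <= K by rewrite mulr_ge0 ?exprn_ge0.
  apply: le_trans (@var _ _ (fun x t => N (cut T t) (w n.+1 (cut T t)) x)
    (fun x t => N (cut T t) (w n (cut T t)) x)
    (fun s => K / 2 * expR (lam * s))
    (fun s => K / 2 * (lam * expR (lam * s))) t x _ _ _ _ tT _) _ => //.
  + by move=> s; apply: is_derive_scale; exact: is_derive_expRM.
  + by rewrite !w0.
  + move=> s sT; rewrite cut_id //.
    apply: le_trans (lN _ _ s (K * expR (lam * s)) _ _ sT _ x) _ => //.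
      by move=> z; exact: IH.
    have := mulr_ge0 K0 (expR_ge0 (lam * s)); rewrite /lam; nra.
  + rewrite mulr0 expR0 mulr1 exprS /K; set E := expR _.
    by have := K0; rewrite /K; lra.
set K := C * T * expR (lam * T).
have K0 : 0 <= K by rewrite mulr_ge0 ?expR_ge0.
have lim_ex t x : exists l, 0 <= t <= T ->
    forall n, `|w n t x - l| <= 2 * K * 2^-1 ^+ n.
  have [tT|/negP nT] := boolP (0 <= t <= T); last by exists 0.
  have [|l hl] := @half_cauchy (fun n => w n t x) K; last by exists l.
  move=> n; apply: le_trans (incr n t x tT) _; rewrite /K.
  rewrite -!mulrA ler_wpM2l // ler_wpM2l // mulrC ler_wpM2r ?exprn_ge0 //.
  by rewrite ler_expR ler_wpM2l //; case/andP: tT.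
have [u hu] : exists u : R -> X -> R, forall t x, 0 <= t <= T ->
    forall n, `|w n t x - u t x| <= 2 * K * 2^-1 ^+ n.
  have /choice[u hu] : forall p : R * X, exists l, 0 <= p.1 <= T ->
    forall n, `|w n p.1 p.2 - l| <= 2 * K * 2^-1 ^+ n by move=> [t x].
  by exists (fun t x => u (t, x)) => t x; exact: (hu (t, x)).
have uadm : adm u.
  apply: (admL w) => // e e0; have [n hn] := exists_half_lt (2 * K) e0.
  by exists n => t x tT; exact: le_trans (hu t x tT n) hn.
have [v0 dv] := HF (exist _ u uadm); have vadm := svalP (F (exist _ u uadm)).
move: (F (exist _ u uadm)) v0 dv vadm => [v /= _] v0 dv vadm.
have vu t x : 0 <= t <= T -> v t x = u t x.
  move=> tT; apply/eqP; rewrite -subr_eq0 -normr_le0.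
  apply: (@ler_half_limit _ _ ((L * T + 1) * (2 * K))) => n; rewrite add0r.
  have h1 : `|v t x - w n.+1 t x| <= L * (2 * K * 2^-1 ^+ n) * T.
    apply: le_trans (@var _ _ (fun x t => N (cut T t) (u (cut T t)) x)
      (fun x t => N (cut T t) (w n (cut T t)) x)
      (fun s => 0 + L * (2 * K * 2^-1 ^+ n) * s)
      (fun s => L * (2 * K * 2^-1 ^+ n)) t x _ _ _ _ tT _) _ => //.
    + by move=> s; exact: is_derive_affine.
    + by rewrite v0 w0.
    + move=> s sT; rewrite cut_id // distrC; apply: lN => // z; exact: hu.
    + rewrite mulr0 addr0 subr0 add0r ler_wpM2l //; last by case/andP: tT.
      by rewrite !mulr_ge0 ?exprn_ge0.
  have h2 := hu t x tT n.+1.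
  have := ler_normD (v t x - w n.+1 t x) (w n.+1 t x - u t x).
  rewrite addrA subrK => /le_trans; apply.
  have : 2 * K * 2^-1 ^+ n.+1 <= 2 * K * 2^-1 ^+ n.
    by rewrite ler_wpM2l ?mulr_ge0 // exprS ler_piMl ?exprn_ge0 //; lra.
  by lra.
exists v; split=> // t x.
rewrite (_ : v (cut T t) = u (cut T t)); first exact: dv.
by apply/funext => z; apply: vu; exact: cut_itv.
Qed.

End calculus.

(** * The flow of a first harmonic and its inverse *)

Section calculus2.
Context {R : realType}.
Implicit Types (f g : R -> R) (a b t : R).

(** Without a quotient the case h = 0 needs no separate treatment. *)
Lemma is_deriveP f t l : is_derive t 1 f l <->
  forall e : R, 0 < e -> exists2 d : R, 0 < d & forall h, `|h| < d ->
    `|f (t + h) - f t - l * h| <= e * `|h|.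
Proof.
have lim : (f (h *: 1 + t) - f t) / h @[h --> 0^'] --> l <->
  forall e : R, 0 < e -> exists2 d : R, 0 < d & forall h, `|h| < d ->
    `|f (t + h) - f t - l * h| <= e * `|h|.
  split=> [/cvgrPdist_le H e e0|H].
    have := H _ e0; rewrite /dnbhs /within /= => /nbhs_ballP[d /= d0 hd].
    exists d => // h hh; have [->|h0] := eqVneq h 0.
      by rewrite addr0 subrr mulr0 subr0 normr0 mulr0.
    have := hd h; rewrite /ball /= sub0r normrN => /(_ hh h0).
    rewrite /GRing.scale /= mulr1 (addrC h t) distrC.
    rewrite -(ler_pM2r (_ : 0 < `|h|)) ?normr_gt0 // -normrM.
    by rewrite mulrBl divfK.
  apply/cvgrPdist_le => e e0; have [d d0 hd] := H _ e0.
  rewrite /dnbhs /within /=; apply/nbhs_ballP; exists d => //= h.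
  rewrite /ball /= sub0r normrN => hh h0.
  rewrite /GRing.scale /= mulr1 (addrC h t) distrC.
  by rewrite -(ler_pM2r (_ : 0 < `|h|)) ?normr_gt0 // -normrM mulrBl divfK //; exact: hd.
split=> [[df dl]|H].
  apply/lim; move: df; rewrite -dl; rewrite /derivable /derive /=.
  have -> : (fun h => (f (h *: 1 + t) - f t) / h) =
            (fun h => h^-1 *: (f (h *: 1 + t) - f t)).
    by apply/funext => h; rewrite mulrC.
  by [].
have := lim.2 H.
have -> : (fun h => (f (h *: 1 + t) - f t) / h) =
          (fun h => h^-1 *: (f (h *: 1 + t) - f t)).
  by apply/funext => h; rewrite mulrC.
move=> c; constructor.
  by apply/cvg_ex; exists l.
exact: cvg_lim c.
Qed.

Lemma quadratic_derive f t l (C : R) :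
  (forall h, `|f (t + h) - f t - l * h| <= C * h ^+ 2) -> is_derive t 1 f l.
Proof.
move=> H; apply/is_deriveP => e e0; exists (e / (`|C| + 1)).
  by rewrite divr_gt0 // ltr_pwDr.
move=> h; rewrite ltr_pdivlMr ?ltr_pwDr // => /ltW hd.
apply: le_trans (H h) _; rewrite -real_normK ?num_real // expr2 mulrA.
rewrite ler_wpM2r //; apply: le_trans hd; rewrite mulrC ler_wpM2l //.
by rewrite (le_trans (ler_norm _)) // lerDl.
Qed.

Lemma derive_lipschitz f df (k : R) : (forall t : R, is_derive t 1 f (df t)) ->
  (forall t, `|df t| <= k) -> forall a b, `|f a - f b| <= k * `|a - b|.
Proof.
move=> hf hk.
have cf : continuous f by move=> t; exact: is_derive_continuous (hf t).
have main a b : a <= b -> `|f b - f a| <= k * (b - a).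
  move=> ab; have [] := @MVT_segment R f df a b ab _ _.
  - exact: within_itv_continuous.
  by move=> c _ ->; rewrite normrM (ger0_norm (_ : 0 <= b - a)) ?subr_ge0 // ler_wpM2r // subr_ge0.
move=> a b; have [ab|/ltW ba] := leP a b.
  by rewrite distrC (distrC a) (ger0_norm (_ : 0 <= b - a)) ?subr_ge0 // main.
by rewrite (ger0_norm (_ : 0 <= a - b)) ?subr_ge0 // main.
Qed.

Lemma sin_lip a b : `|sin a - sin b| <= `|a - b|.
Proof.
rewrite -[leRHS]mul1r; apply: (@derive_lipschitz sin cos).
by move=> t; rewrite ler_norml cos_geN1 cos_le1.
Qed.

Lemma cos_lip a b : `|cos a - cos b| <= `|a - b|.
Proof.
rewrite -[leRHS]mul1r; apply: (@derive_lipschitz cos (fun t => - sin t)).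
by move=> t; rewrite normrN ler_norml sin_geN1 sin_le1.
Qed.

Lemma expR_lip (B a b : R) : `|a| <= B -> `|b| <= B ->
  `|expR a - expR b| <= expR B * `|a - b|.
Proof.
move=> aB bB; wlog ab : a b aB bB / a <= b => [hw|].
  have [ab|/ltW ba] := leP a b; first exact: hw.
  by rewrite distrC (distrC a); exact: hw.
have [] := @MVT_segment R expR expR a b ab _ _.
- by apply: within_itv_continuous => t; exact: continuous_expR.
move=> c; rewrite in_itv /= => /andP[_ cb] e.
rewrite distrC e (distrC a) normrM ger0_norm ?expR_ge0 // ler_wpM2r // ler_expR.
by apply: le_trans cb _; apply: le_trans (ler_norm _) bB.
Qed.

End calculus2.

Section wave.
Context {R : realType}.
Notation R3 := (R * R * R)%type.
Implicit Types (a b : R -> R -> R) (t th x : R) (p q : R3).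

Definition dist1 p q : R :=
  `|p.1.1 - q.1.1| + `|p.1.2 - q.1.2| + `|p.2 - q.2|.

(** The amplitudes of a velocity field that is a first harmonic in the phase; they
depend on time and site. *)
Definition amplitude (M L : R) a := [/\ forall t x, `|a t x| <= M,
  forall t x y, `|a t x - a t y| <= L * `|x - y| &
  forall x, continuous (a ^~ x)].

(** The average of sin (phi - th) over a population of phases phi, when a and b are
the averages of cos phi and sin phi. *)
Definition wave a b t th x : R := b t x * cos th - a t x * sin th.

Definition wave' a b t th x : R := - a t x * cos th - b t x * sin th.

Lemma amplitudeN M L a : amplitude M L a -> amplitude M L (fun t x => - a t x).
Proof.
move=> [h1 h2 h3]; split=> [t x|t x y|x t].
- by rewrite normrN.
- by rewrite -opprD normrN.
- by apply: continuousN; exact: h3.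
Qed.

Lemma wave'E a b : wave' a b = wave b (fun t x => - a t x).
Proof. by []. Qed.

Lemma derive_wave a b t th x :
  is_derive th 1 (fun s : R => wave a b t s x) (wave' a b t th x).
Proof.
have := is_derive_sub (is_derive_scale (b t x) (is_derive_cos th : is_derive th 1 (@cos R) _))
  (is_derive_scale (a t x) (is_derive_sin th : is_derive th 1 (@sin R) _)).
by rewrite mulrN -opprD addrC opprD -mulNr.
Qed.

Lemma wave_periodic a b t th x : wave a b t (th + 2 * pi) x = wave a b t th x.
Proof.
by rewrite /wave (_ : 2 * pi = pi *+ 2) ?mulr_natl // sinD cosD cos2pi sin2pi !mulr1 !mulr0
  subr0 addr0.
Qed.

Variables (M L : R) (a b : R -> R -> R).
Hypotheses (ha : amplitude M L a) (hb : amplitude M L b).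

Lemma amplitude_ge0 : 0 <= M.
Proof. by case: ha => /(_ 0 0) h _ _; exact: le_trans h. Qed.

Lemma lipschitz_ge0 : 0 <= L.
Proof.
by case: ha => _ /(_ 0 1 0); rewrite subr0 normr1 mulr1 => h _; exact: le_trans h.
Qed.

Lemma wave_bound t th x : `|wave a b t th x| <= 2 * M.
Proof.
have M0 := amplitude_ge0; have [h1 _ _] := ha; have [h2 _ _] := hb.
apply: le_trans (ler_normB _ _) _; rewrite !normrM mulrDl mul1r.
apply: lerD; rewrite -[leRHS]mulr1 ler_pM //.
  by rewrite ler_norml cos_geN1 cos_le1.
by rewrite ler_norml sin_geN1 sin_le1.
Qed.

Lemma wave_lip t th th' x x' :
  `|wave a b t th x - wave a b t th' x'| <=
  2 * M * `|th - th'| + 2 * L * `|x - x'|.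
Proof.
have M0 := amplitude_ge0; have L0 := lipschitz_ge0.
have [h1 l1 _] := ha; have [h2 l2 _] := hb.
have e : wave a b t th x - wave a b t th' x' =
  b t x * (cos th - cos th') + (b t x - b t x') * cos th'
  - (a t x * (sin th - sin th') + (a t x - a t x') * sin th').
  by rewrite /wave; ring.
rewrite e; apply: le_trans (ler_normB _ _) _.
have c1 : `|cos th'| <= 1 by rewrite ler_norml cos_geN1 cos_le1.
have s1 : `|sin th'| <= 1 by rewrite ler_norml sin_geN1 sin_le1.
have x0 : 0 <= L * `|x - x'| by rewrite mulr_ge0.
have k1 : `|b t x * (cos th - cos th')| <= M * `|th - th'|.
  by rewrite normrM ler_pM // cos_lip.
have k2 : `|a t x * (sin th - sin th')| <= M * `|th - th'|.
  by rewrite normrM ler_pM // sin_lip.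
have k3 : `|(b t x - b t x') * cos th'| <= L * `|x - x'|.
  by rewrite normrM -[leRHS]mulr1 ler_pM.
have k4 : `|(a t x - a t x') * sin th'| <= L * `|x - x'|.
  by rewrite normrM -[leRHS]mulr1 ler_pM.
have := ler_normD (b t x * (cos th - cos th')) ((b t x - b t x') * cos th').
have := ler_normD (a t x * (sin th - sin th')) ((a t x - a t x') * sin th').
lra.
Qed.

Lemma wave_continuous (X : topologicalType) (f g h : X -> R) :
  continuous f -> continuous g -> continuous h ->
  continuous (fun z => wave a b (f z) (g z) (h z)).
Proof.
move=> cf cg ch.
have amp (c : R -> R -> R) : amplitude M L c -> continuous (fun z => c (f z) (h z)).
  have L0 := lipschitz_ge0.
  move=> [_ lc cc] z; apply/cvgrPdist_le => e e0; near=> y.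
  have -> : c (f z) (h z) - c (f y) (h y) =
    (c (f z) (h z) - c (f y) (h z)) + (c (f y) (h z) - c (f y) (h y)) by ring.
  rewrite (splitr e); apply: le_trans (ler_normD _ _) _; apply: lerD.
    near: y; have : continuous (fun y => c (f y) (h z)).
      by move=> y; apply: (@continuous_comp _ _ _ f (c ^~ (h z))); [exact: cf|exact: cc].
    by move=> /(_ z)/cvgrPdist_le; apply; rewrite divr_gt0.
  apply: le_trans (lc _ _ _) _.
  apply: (@le_trans _ _ ((L + 1) * `|h z - h y|)).
    by rewrite ler_wpM2r // lerDl.
  rewrite mulrC -ler_pdivlMr; last by rewrite ltr_wpDl.
  near: y; move: (ch z) => /cvgrPdist_le; apply.
  by rewrite divr_gt0 ?divr_gt0 // ltr_wpDl.
rewrite /wave; apply: continuous_sub; apply: continuous_mul.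
- exact: amp hb.
- exact/(continuous_after cg)/continuous_cos.
- exact: amp ha.
- exact/(continuous_after cg)/continuous_sin.
Unshelve. all: by end_near. Qed.

End wave.

Section wave2.
Context {R : realType}.
Variables (M L : R) (a b : R -> R -> R).
Hypotheses (ha : amplitude M L a) (hb : amplitude M L b).
Implicit Types t th x : R.

Lemma wave'_bound t th x : `|wave' a b t th x| <= 2 * M.
Proof. rewrite wave'E; exact: wave_bound hb (amplitudeN ha) _ _ _. Qed.

Lemma wave'_lip t th th' x x' :
  `|wave' a b t th x - wave' a b t th' x'| <=
  2 * M * `|th - th'| + 2 * L * `|x - x'|.
Proof. rewrite wave'E; exact: wave_lip hb (amplitudeN ha) _ _ _ _ _. Qed.

Lemma wave_taylor t th th' x :
  `|wave a b t th x - wave a b t th' x - wave' a b t th' x * (th - th')| <=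
  2 * M * (th - th') ^+ 2.
Proof.
have M0 := amplitude_ge0 ha.
have key u v : u <= v -> exists2 c, u <= c <= v &
   wave a b t v x - wave a b t u x = wave' a b t c x * (v - u).
  move=> uv;
  have cw : {within `[u, v], continuous (fun s => wave a b t s x)}.
    by apply: within_itv_continuous => s; exact: is_derive_continuous (derive_wave _ _ _ _ _).
  have [c] := @MVT_segment R _ _ u v uv (fun s _ => derive_wave a b t s x) cw.
  by rewrite in_itv /=; exists c.
have [c cth ->] : exists2 c, `|c - th'| <= `|th - th'| &
   wave a b t th x - wave a b t th' x = wave' a b t c x * (th - th').
  have [uv|/ltW uv] := leP th' th.
    have [c /andP[c1 c2] e] := key _ _ uv; exists c => //.
    by rewrite !ger0_norm ?subr_ge0 // lerD2r.
  have [c /andP[c1 c2] e] := key _ _ uv; exists c.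
    by rewrite distrC (distrC th) !ger0_norm ?subr_ge0 // lerD2l lerN2.
  by rewrite -opprB e -mulrN opprB.
rewrite -mulrBl normrM -real_normK ?num_real // expr2 mulrA ler_wpM2r //.
apply: le_trans (wave'_lip _ _ _ _ _) _; rewrite subrr normr0 mulr0 addr0.
by rewrite ler_wpM2l // mulr_ge0.
Qed.

End wave2.

Section flow.
Context {R : realType}.
Notation R3 := (R * R * R)%type.
Implicit Types (p q : R3).

(** Trajectories are real lifts of phases.  A point p lists the initial phase, the
frequency and the site, of which only the phase moves. *)
Definition is_flow (T : R) (a b : R -> R -> R) (X : R -> R3 -> R) : Prop :=
  forall p, X 0 p = p.1.1 /\ forall t : R, is_derive t 1 (X ^~ p)
    (p.1.2 + wave a b (cut T t) (X (cut T t) p) p.2).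

Lemma dist1_ge0 p q : 0 <= dist1 p q.
Proof. by rewrite /dist1 !addr_ge0. Qed.

Lemma flow_exists (T M L : R) (a b : R -> R -> R) : 0 <= T ->
  amplitude M L a -> amplitude M L b -> exists X, is_flow T a b X.
Proof.
move=> T0 ha hb.
have M0 := amplitude_ge0 ha.
have M20 : 0 <= 2 * M by rewrite mulr_ge0.
have [|||||||||u [_ u0 du]] := @picard R R3 T (2 * M) (2 * M) (fun p => p.1.1) (fun p => p.1.2)
  (fun t u p => p.1.2 + wave a b t (u p) p.2)
  (fun u => forall p, continuous (fun t => u (cut T t) p)) => //.
- move=> p; apply: continuous_add; first exact: continuous_const.
  by apply: continuous_mul; [exact: continuous_const|exact: continuous_cut].
- move=> u v _ _ dv p; apply: (continuous_after (h := v ^~ p) (@continuous_cut _ T)) => s.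
  exact: is_derive_continuous (dv _ _).
- move=> w u hw hu p t; apply/cvgrPdist_le => e e0.
  have [n hn] := hu (e / 3) (divr_gt0 e0 (ltr0n _ 3)).
  near=> s.
  have h1 := hn (cut T s) p (cut_itv s T0).
  have h2 := hn (cut T t) p (cut_itv t T0).
  have h3 : `|w n (cut T t) p - w n (cut T s) p| <= e / 3.
    near: s; have /cvgrPdist_le := hw n p t.
    by apply; rewrite divr_gt0.
  by move: h1 h2 h3; rewrite !ler_norml; lra.
- move=> u hu p; apply: continuous_add; first exact: continuous_const.
  apply: (wave_continuous ha hb (f := cut T) (h := fun=> p.2)).
  + exact: continuous_cut.
  + exact: hu.
  + by move=> ?; exact: cvg_cst.
- move=> u t p _ _; rewrite addrC addKr.
  exact: wave_bound ha hb _ _ _.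
- move=> u v t D _ _ _ hD p; rewrite opprD addrACA subrr add0r.
  apply: le_trans (wave_lip ha hb _ _ _ _ _) _.
  by rewrite subrr normr0 mulr0 addr0 ler_wpM2l.
by exists u.
Unshelve. all: by end_near. Qed.

Variables (T M L : R) (a b : R -> R -> R) (X : R -> R3 -> R).
Hypotheses (T0 : 0 <= T) (ha : amplitude M L a) (hb : amplitude M L b).
Hypothesis (hX : is_flow T a b X).

Let M0 : 0 <= M. Proof. exact: amplitude_ge0 ha. Qed.
Let L0 : 0 <= L. Proof. exact: lipschitz_ge0 ha. Qed.

Lemma flow0 p : X 0 p = p.1.1. Proof. exact: (hX p).1. Qed.

Lemma flow_derive p (t : R) : 0 <= t <= T ->
  is_derive t 1 (X ^~ p) (p.1.2 + wave a b t (X t p) p.2).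
Proof. by move=> tT; have := (hX p).2 t; rewrite cut_id. Qed.

Lemma flow_continuous p : continuous (X ^~ p).
Proof. by move=> t; exact: is_derive_continuous ((hX p).2 t). Qed.

Lemma flow_dist_t p s t :
  `|X t p - X s p| <= (`|p.1.2| + 2 * M) * `|t - s|.
Proof.
apply: (derive_lipschitz ((hX p).2)) => r.
by rewrite (le_trans (ler_normD _ _)) // lerD2l (wave_bound ha hb).
Qed.

(** Frequencies are unbounded, so trajectories are compared with uniform rotation,
from which they deviate by a bounded amount. *)
Lemma flow_drift p t : 0 <= t <= T ->
  `|X t p - p.1.1 - p.1.2 * t| <= 2 * M * T.
Proof.
move=> /andP[t0 tT].
have d (s : R) : is_derive s 1 (fun s : R => X s p - (p.1.1 + p.1.2 * s))
    (wave a b (cut T s) (X (cut T s) p) p.2).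
  have := is_derive_sub ((hX p).2 s) (is_derive_affine p.1.1 p.1.2 s).
  by rewrite addrC addKr.
have := derive_lipschitz d (fun s => wave_bound ha hb _ _ _) t 0.
rewrite flow0 mulr0 addr0 subrr !subr0 opprD addrA => /le_trans; apply.
by rewrite ger0_norm // ler_wpM2l // mulr_ge0.
Qed.

Definition flow_lip : R := 2 * (1 + (1 + 2 * L) * T) * expR ((4 * M + 1) * T).

Lemma flow_lip_ge0 : 0 <= flow_lip.
Proof.
by rewrite /flow_lip !mulr_ge0 ?expR_ge0 // addr_ge0 // mulr_ge0 // addr_ge0 // mulr_ge0.
Qed.

Lemma flow_dist p q t : 0 <= t <= T -> `|X t p - X t q| <= flow_lip * dist1 p q.
Proof.
move=> tT.
pose e := `|p.1.2 - q.1.2| + 2 * L * `|p.2 - q.2|.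
have e0 : 0 <= e by rewrite addr_ge0 // !mulr_ge0.
have h := @gronwall R unit (fun _ s => X s p - X s q)
  (fun _ s => p.1.2 + wave a b s (X s p) p.2 - (q.1.2 + wave a b s (X s q) q.2))
  T (2 * M) e `|p.1.1 - q.1.1|
  (`|p.1.1 - q.1.1| + `|p.1.2 - q.1.2| * T + 4 * M * T) _ e0 _ _ _ _ _ tt t tT.
apply: le_trans (h _ _ _ _ _ _) _.
- by rewrite mulr_ge0.
- move=> _; apply: within_itv_continuous.
  by apply: continuous_sub; exact: flow_continuous.
- move=> _ s /andP[/ltW s0 /ltW sT].
  by apply: is_derive_sub; apply: flow_derive; rewrite s0.
- by move=> _; rewrite !flow0.
- move=> _ s /andP[s0 sT].
  have sT' : 0 <= s <= T by rewrite s0.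
  have h4 := flow_drift p sT'; have h5 := flow_drift q sT'.
  have -> : X s p - X s q = (X s p - p.1.1 - p.1.2 * s)
    - (X s q - q.1.1 - q.1.2 * s) + (p.1.1 - q.1.1) + (p.1.2 - q.1.2) * s by ring.
  have h3 : `|(p.1.2 - q.1.2) * s| <= `|p.1.2 - q.1.2| * T.
    by rewrite normrM (ger0_norm s0) ler_wpM2l.
  apply: le_trans (ler_normD _ _) _; rewrite [leRHS](_ : _ =
   (4 * M * T + `|p.1.1 - q.1.1|) + `|p.1.2 - q.1.2| * T); last by ring.
  apply: lerD => //; apply: le_trans (ler_normD _ _) _; apply: lerD => //.
  by apply: le_trans (ler_normB _ _) _; clear h; lra.
- move=> s E _ /(_ tt) hE _; rewrite /e opprD addrACA.
  apply: le_trans (ler_normD _ _) _.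
  have := wave_lip ha hb s (X s p) (X s q) p.2 q.2.
  have : 2 * M * `|X s p - X s q| <= 2 * M * E by rewrite ler_wpM2l // mulr_ge0.
  by clear h; lra.
rewrite /flow_lip (_ : 2 * (2 * M) = 4 * M); last by ring.
rewrite [leRHS]mulrAC ler_wpM2r ?expR_ge0 // -mulrA ler_wpM2l // /e /dist1.
have n1 := normr_ge0 (p.1.1 - q.1.1); have n2 := normr_ge0 (p.1.2 - q.1.2).
have n3 := normr_ge0 (p.2 - q.2).
move: `|_| n1 `|_| n2 `|_| n3 => u u0 v v0 w w0.
have TL : 0 <= T * L by rewrite mulr_ge0.
have := mulr_ge0 T0 u0; have := mulr_ge0 T0 v0; have := mulr_ge0 T0 w0.
have := mulr_ge0 TL u0; have := mulr_ge0 TL v0; have := mulr_ge0 TL w0.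
by clear h; lra.
Qed.

(** The reversed motion solves an equation of the same kind, so distinct
trajectories cannot approach each other too fast; the regularity of the inverse
flow rests on this bound. *)
Lemma flow_dist_back (om x th th' : R) t : 0 <= t <= T ->
  `|th - th'| <= flow_lip * `|X t (th, om, x) - X t (th', om, x)|.
Proof.
move=> /andP[t0 tT]; set p := (th, om, x); set q := (th', om, x).
have d r (s : R) : 0 < s < t -> is_derive s 1 (fun s : R => X (t - s) r)
    (- (r.1.2 + wave a b (t - s) (X (t - s) r) r.2)).
  move=> /andP[s0 st].
  have := @is_derive_compose R (X ^~ r) (fun s => t - s) s _ _ (@flow_derive r (t - s) _)
    (is_derive_sub (is_derive_const t s) (is_derive_ident s)).
  rewrite sub0r mulrN1; apply.
  by rewrite subr_ge0 (ltW st) /= lerBlDr (le_trans tT) // lerDl ltW.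
have h := @gronwall R unit (fun _ s => X (t - s) p - X (t - s) q)
  (fun _ s => - (p.1.2 + wave a b (t - s) (X (t - s) p) p.2)
       - - (q.1.2 + wave a b (t - s) (X (t - s) q) q.2))
  t (2 * M) 0 `|X t p - X t q|
  (flow_lip * dist1 p q) _ (lexx _) _ _ _ _ _ tt t _.
have {}h : `|X (t - t) p - X (t - t) q| <= 2 * (`|X t p - X t q| + 0 * t) * expR ((2 * (2 * M) + 1) * t).
  apply: h.
  - by rewrite mulr_ge0.
  - move=> _; apply: within_itv_continuous.
    have ct : continuous (fun s => t - s).
      by apply: continuous_sub; [exact: continuous_const|exact: continuous_ident].
    apply: continuous_sub.
      by apply: (continuous_after (h := X ^~ p) ct); exact: flow_continuous.
    by apply: (continuous_after (h := X ^~ q) ct); exact: flow_continuous.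
  - by move=> _ s st; apply: is_derive_sub; exact: d.
  - by move=> _; rewrite !subr0.
  - move=> _ s /andP[s0 st]; apply: flow_dist.
    by rewrite subr_ge0 st /= lerBlDr (le_trans tT) // lerDl.
  - move=> s E _ /(_ tt) hE _; rewrite addr0.
    have -> : - (p.1.2 + wave a b (t - s) (X (t - s) p) p.2) -
      - (q.1.2 + wave a b (t - s) (X (t - s) q) q.2) =
      - (wave a b (t - s) (X (t - s) p) x - wave a b (t - s) (X (t - s) q) x).
      by rewrite /=; ring.
    rewrite normrN; have := wave_lip ha hb (t - s) (X (t - s) p) (X (t - s) q) x x.
    rewrite subrr normr0 mulr0 addr0 => h1.
    by rewrite (le_trans h1) // ler_wpM2l // mulr_ge0.
  - by rewrite t0 lexx.
move: h; rewrite subrr !flow0 mul0r addr0 /= => /le_trans; apply.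
rewrite [leRHS]mulrC [leLHS]mulrAC [leLHS]mulrC ler_wpM2l // /flow_lip.
rewrite (_ : 2 * (2 * M) = 4 * M); last by ring.
rewrite ler_pM ?expR_ge0 //.
  by rewrite -{1}(mulr1 2) ler_wpM2l // lerDl mulr_ge0 // addr_ge0 // mulr_ge0.
by rewrite ler_expR ler_wpM2l // addr_ge0 // mulr_ge0.
Qed.

(** The velocity is periodic in the phase, so both sides solve the same equation. *)
Lemma flow_periodic (th om x : R) t : 0 <= t <= T ->
  X t (th + 2 * pi, om, x) = X t (th, om, x) + 2 * pi.
Proof.
move=> tT; set p := (th + 2 * pi, om, x); set q := (th, om, x).
apply/eqP; rewrite -subr_eq0 -normr_le0.
have h := @gronwall R unit (fun _ s => X s p - (X s q + 2 * pi))
  (fun _ s => p.1.2 + wave a b s (X s p) p.2 - (q.1.2 + wave a b s (X s q) q.2 + 0))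
  T (2 * M) 0 0
  (flow_lip * dist1 p q + 2 * pi) _ (lexx _) _ _ _ _ _ tt t tT.
have {}h : `|X t p - (X t q + 2 * pi)| <= 2 * (0 + 0 * T) * expR ((2 * (2 * M) + 1) * T).
  apply: h.
  - by rewrite mulr_ge0.
  - move=> _; apply: within_itv_continuous.
    apply: continuous_sub; first exact: flow_continuous.
    by apply: continuous_add; [exact: flow_continuous|exact: continuous_const].
  - move=> _ s /andP[/ltW s0 /ltW sT].
    apply: is_derive_sub; first by apply: flow_derive; rewrite s0.
    apply: is_derive_add.
    by apply: flow_derive; rewrite s0.
  - by move=> _; rewrite !flow0 /= subrr normr0.
  - move=> _ s sT; rewrite opprD addrA (le_trans (ler_normB _ _)) //.
    rewrite (ger0_norm (ltW twopi_gt0)) lerD2r.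
    exact: flow_dist.
  - move=> s E _ /(_ tt) hE _; rewrite !addr0 opprD addrACA subrr add0r.
    rewrite -(wave_periodic a b s (X s q)).
    apply: le_trans (wave_lip ha hb _ _ _ _ _) _.
    by rewrite subrr normr0 mulr0 addr0 ler_wpM2l // mulr_ge0.
by move: h; rewrite mul0r addr0 mulr0 mul0r.
Qed.

(** The logarithm of the stretching factor of the flow in the phase variable:
its derivative in time is the phase derivative of the velocity along the
trajectory. *)
Definition is_log_stretch (j : R -> R3 -> R) : Prop :=
  forall p, j 0 p = 0 /\ forall t : R, is_derive t 1 (j ^~ p)
    (wave' a b (cut T t) (X (cut T t) p) p.2).

Lemma log_stretch_exists : exists j, is_log_stretch j.
Proof.
have /choice[j hj] : forall p, exists j : R -> R, j 0 = 0 /\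
    forall t : R, is_derive t 1 j (wave' a b (cut T t) (X (cut T t) p) p.2).
  move=> p; apply: exists_primitive => t.
  apply: (wave_continuous hb (amplitudeN ha) (f := cut T) (h := fun=> p.2)
    (g := fun t => X (cut T t) p)).
  + exact: continuous_cut.
  + move=> s; apply: (@continuous_comp _ _ _ (cut T) (X ^~ p)).
      exact: continuous_cut.
    exact: flow_continuous.
  + by move=> ?; exact: cvg_cst.
by exists (fun t p => j p t).
Qed.

Variable j : R -> R3 -> R.
Hypothesis hj : is_log_stretch j.

Lemma stretch_dist_t p s t : `|j t p - j s p| <= 2 * M * `|t - s|.
Proof.
by apply: (derive_lipschitz ((hj p).2)) => r; exact: wave'_bound ha hb _ _ _.
Qed.

Lemma stretch_bound p t : 0 <= t <= T -> `|j t p| <= 2 * M * T.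
Proof.
move=> /andP[t0 tT]; have := stretch_dist_t p 0 t.
rewrite (hj p).1 !subr0 => /le_trans; apply.
by rewrite ger0_norm // ler_wpM2l // mulr_ge0.
Qed.

Definition stretch_lip : R := T * (2 * M * flow_lip + 2 * L).

Lemma stretch_dist p q t : 0 <= t <= T ->
  `|j t p - j t q| <= stretch_lip * dist1 p q.
Proof.
move=> /andP[t0 tT]; pose k := (2 * M * flow_lip + 2 * L) * dist1 p q.
have k0 : 0 <= k.
  have k1 : 0 <= 2 * M * flow_lip by rewrite mulr_ge0 ?flow_lip_ge0 // mulr_ge0.
  by rewrite mulr_ge0 ?dist1_ge0 // addr_ge0 // mulr_ge0.
have d (s : R) := is_derive_sub ((hj p).2 s) ((hj q).2 s).
have := derive_lipschitz d (k := k) _ t 0.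
rewrite (hj p).1 (hj q).1 !subr0 => h; apply: le_trans (h _) _; last first.
  rewrite ger0_norm // /stretch_lip -mulrA -/k mulrC ler_wpM2r //.
move=> s; apply: le_trans (wave'_lip ha hb _ _ _ _ _) _.
have h1 := flow_dist p q (cut_itv s T0).
have h2 : `|p.2 - q.2| <= dist1 p q by rewrite /dist1 lerDr addr_ge0.
have h3 : 2 * M * `|X (cut T s) p - X (cut T s) q| <= 2 * M * (flow_lip * dist1 p q).
  by rewrite ler_wpM2l // mulr_ge0.
have h4 : 2 * L * `|p.2 - q.2| <= 2 * L * dist1 p q.
  by rewrite ler_wpM2l // mulr_ge0.
by rewrite /k; lra.
Qed.

Lemma stretch_periodic (th om x : R) t :
  j t (th + 2 * pi, om, x) = j t (th, om, x).
Proof.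
have e : j ^~ (th + 2 * pi, om, x) = j ^~ (th, om, x).
  apply: (is_derive_unique (a := 0) (df := fun t => wave' a b (cut T t) (X (cut T t) (th, om, x)) x)).
  - by rewrite !(hj _).1.
  - move=> s; have := (hj (th + 2 * pi, om, x)).2 s.
    by rewrite /= flow_periodic ?cut_itv // wave'E wave_periodic.
  - by move=> s; exact: (hj (th, om, x)).2 s.
by have := congr1 (fun f => f t) e.
Qed.

Definition flow_quad : R := 2 * (2 * M * flow_lip ^+ 2 * T) * expR ((4 * M + 1) * T).

(** By Taylor expansion of the velocity, the difference of two trajectories solves
the linearised equation up to a source that is quadratic in the distance of the
initial phases. *)
Lemma flow_taylor (th om x h : R) t : 0 <= t <= T ->
  `|X t (th + h, om, x) - X t (th, om, x) - expR (j t (th, om, x)) * h| <=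
  flow_quad * h ^+ 2.
Proof.
move=> tT; set q := (th, om, x); rewrite /flow_quad.
set p := (th + h, om, x).
have dpq : dist1 p q = `|h|.
  by rewrite /dist1 /= (addrC th) addrK !subrr normr0 !addr0.
pose e := 2 * M * (flow_lip * `|h|) ^+ 2.
have e0 : 0 <= e by rewrite mulr_ge0 ?sqr_ge0 // mulr_ge0.
have dJ (s : R) : 0 <= s <= T ->
    is_derive s 1 (fun s : R => expR (j s q)) (expR (j s q) * wave' a b s (X s q) x).
  move=> sT; have := (hj q).2 s; rewrite cut_id // => dj.
  exact: (is_derive_compose (is_derive_expR _) dj).
have g := @gronwall R unit (fun _ s => X s p - X s q - h * expR (j s q))
  (fun _ s => p.1.2 + wave a b s (X s p) p.2 - (q.1.2 + wave a b s (X s q) q.2)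
     - h * (expR (j s q) * wave' a b s (X s q) x))
  T (2 * M) e 0
  (flow_lip * `|h| + `|h| * expR (2 * M * T)) _ e0 _ _ _ _ _ tt t tT.
rewrite mulrC; apply: le_trans (g _ _ _ _ _ _) _.
- by rewrite mulr_ge0.
- move=> _; apply: within_itv_continuous.
  apply: continuous_sub; first by apply: continuous_sub; exact: flow_continuous.
  apply: continuous_mul; first exact: continuous_const.
  apply: (@continuous_after _ _ (j ^~ q)); last exact: continuous_expR.
  by move=> s; exact: is_derive_continuous ((hj q).2 s).
- move=> _ s /andP[/ltW s0 /ltW sT].
  apply: is_derive_sub; last by apply: is_derive_scale; apply: dJ; rewrite s0.
  by apply: is_derive_sub; apply: flow_derive; rewrite s0.
- by move=> _; rewrite !flow0 /= (hj q).1 expR0 mulr1 (addrC th) addrK subrr normr0.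
- move=> _ s sT; apply: le_trans (ler_normB _ _) _; apply: lerD.
    by rewrite -dpq flow_dist.
  rewrite normrM ler_wpM2l // ger0_norm ?expR_ge0 // ler_expR.
  by apply: le_trans (ler_norm _) _; exact: stretch_bound.
- move=> s E /andP[/ltW s0 /ltW sT] /(_ tt) hE _.
  set w' := wave' a b s (X s q) x.
  have -> : p.1.2 + wave a b s (X s p) p.2 - (q.1.2 + wave a b s (X s q) q.2)
     - h * (expR (j s q) * w') =
    (wave a b s (X s p) x - wave a b s (X s q) x - w' * (X s p - X s q))
    + w' * (X s p - X s q - h * expR (j s q)) by rewrite /=; ring.
  rewrite addrC; apply: le_trans (ler_normD _ _) _; apply: lerD.
    by rewrite normrM ler_pM //; exact: wave'_bound ha hb _ _ _.
  apply: le_trans (wave_taylor ha hb _ _ _ _) _.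
  rewrite /e ler_wpM2l ?mulr_ge0 // -real_normK ?num_real //.
  have := @flow_dist p q s; rewrite dpq s0 sT => /(_ isT) hh.
  by rewrite ler_sqr // nnegrE mulr_ge0 ?flow_lip_ge0.
rewrite add0r /e exprMn real_normK ?num_real //.
rewrite (_ : 2 * (2 * M) = 4 * M); last by ring.
by rewrite le_eqVlt; apply/orP; left; apply/eqP; ring.
Qed.

Lemma flow_derive_phase (th om x : R) t : 0 <= t <= T ->
  is_derive th 1 (fun s : R => X t (s, om, x)) (expR (j t (th, om, x))).
Proof. by move=> tT; apply: quadratic_derive => h; exact: flow_taylor. Qed.

Lemma flow_inj (om x th th' : R) t : 0 <= t <= T ->
  X t (th, om, x) = X t (th', om, x) -> th = th'.
Proof.
move=> tT e; have := flow_dist_back om x th th' tT.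
by rewrite e subrr normr0 mulr0 normr_le0 subr_eq0 => /eqP.
Qed.

Lemma flow_continuous_phase (om x : R) t : 0 <= t <= T ->
  continuous (fun th : R => X t (th, om, x)).
Proof.
move=> tT; apply: (@lipschitz_continuous _ _ flow_lip) => r s.
apply: le_trans (flow_dist _ _ tT) _.
by rewrite /dist1 /= !subrr normr0 !addr0.
Qed.

(** Y t p is the initial phase from which the flow reaches the phase of p at time
t; frequency and site are kept. *)
Definition is_backflow (Y : R -> R3 -> R) : Prop :=
  forall t p, X (cut T t) (Y t p, p.1.2, p.2) = p.1.1.

(** The drift bound confines the preimage to a bounded interval, where the
intermediate value theorem finds it. *)
Lemma backflow_exists : exists Y, is_backflow Y.
Proof.
have /choice[Y hY] : forall z : R * R3, exists y,
    X (cut T z.1) (y, z.2.1.2, z.2.2) = z.2.1.1.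
  move=> [t [[th om] x]] /=; have tT := cut_itv t T0.
  set s := cut T t in tT *.
  pose D := `|om * s| + 2 * M * T.
  have MT : 0 <= 2 * M * T by rewrite !mulr_ge0.
  have [|||c _ hc] := @IVT R (fun y => X s (y, om, x)) (th - D) (th + D) th.
  - by rewrite lerD2l ge0_cp // /D addr_ge0.
  - exact/within_itv_continuous/flow_continuous_phase.
  - have h1 := flow_drift (th - D, om, x) tT.
    have h2 := flow_drift (th + D, om, x) tT.
    have h3 := ler_norm (om * s); have h4 := ler_norm (- (om * s)).
    rewrite normrN in h4; rewrite /= in h1 h2.
    have u1 : X s (th - D, om, x) <= th.
      by move: h1; rewrite ler_norml /D => /andP[_]; lra.
    have u2 : th <= X s (th + D, om, x).
      by move: h2; rewrite ler_norml /D => /andP[]; lra.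
    by rewrite ge_min u1 /= le_max u2 orbT.
  by exists c.
by exists (fun t p => Y (t, p)) => t p; exact: (hY (t, p)).
Qed.

Variable Y : R -> R3 -> R.
Hypothesis hY : is_backflow Y.

Lemma backflowK p t : Y t (X (cut T t) p, p.1.2, p.2) = p.1.1.
Proof.
apply: (@flow_inj p.1.2 p.2 _ _ (cut T t)); first exact: cut_itv.
have -> : (p.1.1, p.1.2, p.2) = p by case: p => [[]].
exact: (hY t (X (cut T t) p, p.1.2, p.2)).
Qed.

Lemma backflow0 p : Y 0 p = p.1.1.
Proof. by have := hY 0 p; rewrite cut_id ?lexx // flow0. Qed.

Lemma backflow_dist p q t :
  `|Y t p - Y t q| <= flow_lip * (1 + flow_lip) * dist1 p q.
Proof.
have tT := cut_itv t T0; have l0 := flow_lip_ge0.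
apply: le_trans (flow_dist_back p.1.2 p.2 _ _ tT) _.
rewrite -mulrA ler_wpM2l // hY.
have -> : p.1.1 - X (cut T t) (Y t q, p.1.2, p.2) =
  (p.1.1 - q.1.1) - (X (cut T t) (Y t q, p.1.2, p.2) - q.1.1) by ring.
rewrite -{2}(hY t q) mulrDl mul1r.
apply: le_trans (ler_normB _ _) _; apply: lerD.
  by rewrite /dist1 -addrA lerDl addr_ge0.
apply: le_trans (flow_dist _ _ tT) _; rewrite ler_wpM2l //.
by rewrite /dist1 /= subrr normr0 add0r -addrA lerDr.
Qed.

Lemma backflow_dist_t p s t :
  `|Y t p - Y s p| <= flow_lip * (`|p.1.2| + 2 * M) * `|t - s|.
Proof.
have tT := cut_itv t T0; have l0 := flow_lip_ge0.
apply: le_trans (flow_dist_back p.1.2 p.2 _ _ tT) _.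
rewrite -mulrA ler_wpM2l // hY -{1}(hY s p) distrC.
apply: le_trans (flow_dist_t _ _ _) _.
by rewrite ler_wpM2l ?cut_dist // addr_ge0 // mulr_ge0.
Qed.

Lemma backflow_periodic (th om x : R) t :
  Y t (th + 2 * pi, om, x) = Y t (th, om, x) + 2 * pi.
Proof.
have tT := cut_itv t T0; apply: (flow_inj (om := om) (x := x) tT).
rewrite (flow_periodic _ _ _ tT).
by rewrite (hY t (th + 2 * pi, om, x)) (hY t (th, om, x)).
Qed.

Lemma backflow_derive_phase (th om x : R) t :
  is_derive th 1 (fun s : R => Y t (s, om, x))
    (expR (- j (cut T t) (Y t (th, om, x), om, x))).
Proof.
have tT := cut_itv t T0.
have := @is_derive_inverse R (fun s => X (cut T t) (s, om, x))
  (fun s => Y t (s, om, x)) _ (Y t (th, om, x)) _ _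
  (flow_derive_phase _ _ _ tT).
rewrite (hY t (th, om, x)) expRN; apply.
- by near=> s; exact: (backflowK (s, om, x)).
- by near=> s; exact: flow_continuous_phase.
- by rewrite gt_eqF // expR_gt0.
Unshelve. all: by end_near. Qed.

(** Differentiate the identity that the flow at time s, started at the
backward image Y s p, returns to the phase of p. *)
Lemma backflow_derive_t (th om x t : R) : 0 < t < T ->
  is_derive t 1 (Y ^~ (th, om, x))
   (- (om + wave a b t th x) * expR (- j t (Y t (th, om, x), om, x))).
Proof.
move=> /andP[t0 tT]; set p := (th, om, x).
have tT' : 0 <= t <= T by rewrite !ltW.
set V := om + wave a b t th x; set y := (Y t p, om, x).
set A := expR (j t y).
have A0 : 0 < A by exact: expR_gt0.
have yth : X t y = th by have := hY t p; rewrite cut_id.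
have dX := flow_derive y tT'; rewrite yth /= -/V in dX.
have AV : expR (- j t y) = A^-1 by rewrite expRN.
set E0 := expR (2 * M * T); have E00 : 0 < E0 by exact: expR_gt0.
have AE : A^-1 <= E0.
  rewrite -AV ler_expR; have := stretch_bound y tT'.
  by apply: le_trans; rewrite -normrN ler_norm.
set Lb := flow_lip * (`|om| + 2 * M).
have Lb0 : 0 <= Lb by rewrite mulr_ge0 ?flow_lip_ge0 // addr_ge0 // mulr_ge0.
have quad0 : 0 <= flow_quad.
  have M20 : 0 <= 2 * M by rewrite mulr_ge0.
  exact: mulr_ge0 (mulr_ge0 (ler0n _ 2) (mulr_ge0 (mulr_ge0 M20 (sqr_ge0 flow_lip)) T0)) (expR_ge0 _).
set C := E0 * (2 * M) * Lb + flow_quad * Lb ^+ 2.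
have C0 : 0 <= C.
  have M20 : 0 <= 2 * M by rewrite mulr_ge0.
  exact: addr_ge0 (mulr_ge0 (mulr_ge0 (ltW E00) M20) Lb0) (mulr_ge0 quad0 (sqr_ge0 Lb)).
apply/is_deriveP => e e0; rewrite AV.
have [d1 d10 hd1] := (is_deriveP _ _ _).1 dX (e / (2 * E0)) (divr_gt0 e0 (mulr_gt0 (ltr0n _ 2) E00)).
pose d2 := e / (2 * E0 * (C + 1)).
have d20 : 0 < d2 by rewrite divr_gt0 // mulr_gt0 ?mulr_gt0 // ltr_wpDl.
exists (Num.min (Num.min t (T - t)) (Num.min d1 d2)).
  by rewrite !lt_min t0 subr_gt0 tT d10 d20.
move=> h; rewrite !lt_min => /andP[/andP[ht hT] /andP[h1 h2]].
have sT : 0 <= t + h <= T.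
  move: ht hT; rewrite !ltr_norml => /andP[? ?] /andP[? ?].
  by apply/andP; split; lra.
have tht : t + h - t = h by rewrite (addrC t) addrK.
set dl := Y (t + h) p - Y t p.
have dlb : `|dl| <= Lb * `|h|.
  by have := backflow_dist_t p t (t + h); rewrite tht.
have Xth : X (t + h) (Y t p + dl, om, x) = th.
  by rewrite /dl (addrC (Y t p)) subrK; have := hY (t + h) p; rewrite cut_id.
have := flow_taylor (Y t p) om x dl sT; rewrite Xth -/y => B1.
have := hd1 h h1; rewrite yth => B2.
have B3 : `|(A - expR (j (t + h) y)) * dl| <= E0 * (2 * M) * Lb * `|h| ^+ 2.
  have -> : E0 * (2 * M) * Lb * `|h| ^+ 2 = (E0 * (2 * M * `|h|)) * (Lb * `|h|).
    by ring.
  rewrite normrM.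
  rewrite ler_pM //; have := expR_lip (stretch_bound y tT') (stretch_bound y sT).
  move=> /le_trans; apply; rewrite ler_wpM2l ?(ltW E00) // distrC.
  by have := stretch_dist_t y t (t + h); rewrite tht.
have B4 : flow_quad * dl ^+ 2 <= flow_quad * Lb ^+ 2 * `|h| ^+ 2.
  rewrite -mulrA ler_wpM2l // -exprMn -(real_normK (num_real dl)).
  by rewrite ler_sqr ?nnegrE ?(mulr_ge0 Lb0).
have B5 : `|A * dl + V * h| <= e / (2 * E0) * `|h| + C * `|h| ^+ 2.
  have -> : A * dl + V * h = (A - expR (j (t + h) y)) * dl
    - (th - X (t + h) y - expR (j (t + h) y) * dl)
    - (X (t + h) y - th - V * h) by ring.
  apply: le_trans (ler_normB _ _) _; rewrite addrC lerD //.
  have -> : C * `|h| ^+ 2 = E0 * (2 * M) * Lb * `|h| ^+ 2 + flow_quad * Lb ^+ 2 * `|h| ^+ 2.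
    by rewrite -mulrDl.
  apply: le_trans (ler_normB _ _) _; rewrite lerD //.
  exact: le_trans B1 B4.
have B6 : C * `|h| ^+ 2 <= e / (2 * E0) * `|h|.
  rewrite expr2 mulrA ler_wpM2r //.
  apply: (@le_trans _ _ ((C + 1) * d2)).
    by rewrite ler_pM // ?lerDl // ltW.
  rewrite /d2 le_eqVlt; apply/orP; left; apply/eqP; field.
  by rewrite !gt_eqF //= ltr_wpDl.
have -> : dl - - V / A * h = A^-1 * (A * dl + V * h).
  by field; rewrite gt_eqF.
rewrite normrM (gtr0_norm (_ : 0 < A^-1)) ?invr_gt0 //.
apply: (@le_trans _ _ (E0 * (e / (2 * E0) * `|h| + e / (2 * E0) * `|h|))).
  rewrite ler_pM ?invr_ge0 ?(ltW A0) //; apply: le_trans B5 _.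
  by rewrite lerD2l.
by rewrite le_eqVlt; apply/orP; left; apply/eqP; field; rewrite gt_eqF.
Qed.

End flow.

(** * The space G and its Borel measures *)

Section geometry.
Context {R : realType}.
Notation R3 := (R * R * R)%type.
Implicit Types (P Q : G R) (p q : R3).

Lemma cos_periodic2pi (th : R) : cos (th + 2 * pi) = cos th.
Proof. by rewrite (mulr_natl pi 2) cosD cos2pi sin2pi mulr1 mulr0 subr0. Qed.

Lemma sin_periodic2pi (th : R) : sin (th + 2 * pi) = sin th.
Proof. by rewrite (mulr_natl pi 2) sinD cos2pi sin2pi mulr1 mulr0 addr0. Qed.

Lemma wrap_periodic (th : R) : Defs.wrap (th + 2 * pi) = Defs.wrap th.
Proof.
have p0 := @twopi_gt0 R; rewrite /Defs.wrap.
have -> : (th + 2 * pi) / (2 * pi) = th / (2 * pi) + 1.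
  by rewrite [LHS]mulrDl divff // gt_eqF.
rewrite Num.Theory.floorDrz ?int_num1 // Num.Theory.floor1.
by rewrite intrD; ring.
Qed.

Lemma mkG_periodic (th om x : R) : mkG (th + 2 * pi) om x = mkG th om x.
Proof. by apply: val_inj; rewrite /= wrap_periodic. Qed.

Lemma coordsE P : coords P = (phase P, freq P, site P).
Proof. by rewrite /phase /freq /site; case: (coords P) => [[]]. Qed.

Lemma mkG_coordsE P : mkG (coords P).1.1 (coords P).1.2 (coords P).2 = P.
Proof. exact: mkG_coords. Qed.

Definition phase_periodic (U : Type) (f : R3 -> U) : Prop :=
  forall th om x, f (th + 2 * pi, om, x) = f (th, om, x).

Lemma dG_bounds P Q : [/\ dS (phase P) (phase Q) <= dG P Q,
  `|freq P - freq Q| <= dG P Q & `|site P - site Q| <= dG P Q].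
Proof.
have s0 := dS_ge0 (phase_itv P) (phase_itv Q); rewrite /dG.
have h2 := sqr_ge0 (freq P - freq Q); have h3 := sqr_ge0 (site P - site Q).
have h1 := sqr_ge0 (dS (phase P) (phase Q)).
split; [rewrite -{1}(ger0_norm s0)| |]; rewrite -sqrtr_sqr ler_wsqrtr //; lra.
Qed.

(** A point near P on the circle has a representative near that of P, which
need not be its representative in the fundamental domain. *)
Lemma lift_near P Q : exists p, dist1 p (coords Q) <= 3 * dG P Q /\
  forall (U : Type) (f : R3 -> U), phase_periodic f -> f p = f (coords P).
Proof.
have [h1 h2 h3] := dG_bounds P Q.
suff [th [hth hf]] : exists th, `|th - phase Q| = dS (phase P) (phase Q) /\
    forall (U : Type) (f : R3 -> U), phase_periodic f ->
      f (th, freq P, site P) = f (coords P).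
  exists (th, freq P, site P); split => //.
  rewrite /dist1 /= -/(phase Q) -/(freq Q) -/(site Q) hth; lra.
have p0 := @twopi_gt0 R; have /andP[P0 P1] := phase_itv P.
have /andP[Q0 Q1] := phase_itv Q; rewrite /dS.
have [_|lt2] := leP `|phase P - phase Q| (2 * pi - `|phase P - phase Q|).
  by exists (phase P); split => // U f _; rewrite coordsE.
have [PQ|/ltW PQ] := leP (phase P) (phase Q).
  exists (phase P + 2 * pi); split.
    rewrite (distrC (phase P)) (ger0_norm (_ : 0 <= phase Q - phase P)) ?subr_ge0 //.
    by rewrite ger0_norm; lra.
  by move=> U f pf; rewrite pf coordsE.
exists (phase P - 2 * pi); split.
  rewrite (ger0_norm (_ : 0 <= phase P - phase Q)) ?subr_ge0 //.
  by rewrite -normrN ger0_norm; lra.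
by move=> U f pf; rewrite -pf subrK coordsE.
Qed.

Lemma dG_mkG_dist1 p q :
  dG (mkG p.1.1 p.1.2 p.2) (mkG q.1.1 q.1.2 q.2) <= dist1 p q.
Proof. exact: dG_mkG_le. Qed.

(** The coordinates jump on the circle, but a periodic function may be evaluated at
the nearby lift of lift_near instead. *)
Lemma lipschitz_descent (f : R3 -> R) (k : R) : 0 <= k -> phase_periodic f ->
  (forall p q, `|f p - f q| <= k * dist1 p q) ->
  forall P Q, `|f (coords P) - f (coords Q)| <= 3 * k * dG P Q.
Proof.
move=> k0 pf hf P Q; have [p [hp hpf]] := lift_near P Q.
rewrite -(hpf _ _ pf); apply: le_trans (hf _ _) _.
by rewrite (mulrC 3) -mulrA ler_wpM2l.
Qed.

Lemma lipG_continuous (f : G R -> R) (k : R) :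
  (forall P Q, `|f P - f Q| <= k * dG P Q) -> continuous f.
Proof.
move=> hf P; apply/(@cvgrPdist_le _ _ _ (nbhs (P : G R))) => e e0; apply/nbhs_ballP.
have k0 : 0 < `|k| + 1 by rewrite ltr_wpDl.
exists (e / (`|k| + 1)) => /=; first by rewrite divr_gt0.
move=> Q; rewrite ballEmdist /= => h; apply: le_trans (hf _ _) _.
have d0 : 0 <= dG P Q by rewrite sqrtr_ge0.
have hd : dG P Q < e / (`|k| + 1) by exact: h.
apply: (@le_trans _ _ ((`|k| + 1) * dG P Q)).
  by rewrite ler_wpM2r // (le_trans (ler_norm _)) // lerDl.
by rewrite mulrC -ler_pdivlMr // ltW.
Qed.

Lemma freq_continuous : continuous (@freq R).
Proof.
by apply: (@lipG_continuous _ 1) => P Q; rewrite mul1r; case: (dG_bounds P Q).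
Qed.

Lemma site_continuous : continuous (@site R).
Proof.
by apply: (@lipG_continuous _ 1) => P Q; rewrite mul1r; case: (dG_bounds P Q).
Qed.

Lemma continuous_measurableG (f : G R -> R) : continuous f ->
  measurable_fun setT f.
Proof.
move=> /continuousP cf; apply: (measurability _ (measurable_realfun.RGenOInfty.measurableE R)) => //.
by move=> _ [_ [a ->] <-]; rewrite setTI; apply: sub_sigma_algebra; exact: cf.
Qed.

(** The phase is discontinuous on the circle, but its superlevel sets are open
conditions on a continuous function: the difference of cosines is a product of
two sines, one of which changes sign at c. *)
Lemma measurable_phase_gt (c : R) : 0 <= c < 2 * pi ->
  [set P : G R | c < phase P] =
  [set P | 0 < cos (c / 2) - cos (phase P - c / 2)].
Proof.
move=> /andP[c0 c1]; apply/seteqP; split => P /=;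
  have /andP[P0 P1] := phase_itv P; have p0 := @pi_gt0 R.
  move=> h; have -> : cos (c / 2) - cos (phase P - c / 2) =
      2 * (sin (phase P / 2) * sin ((phase P - c) / 2)).
    have -> : c / 2 = phase P / 2 - (phase P - c) / 2 by lra.
    have -> : phase P - (phase P / 2 - (phase P - c) / 2) = phase P / 2 + (phase P - c) / 2 by lra.
    by rewrite cosB cosD; ring.
  by rewrite mulr_gt0 // mulr_gt0 // sin_gt0_pi //; apply/andP; split; lra.
apply: contraTT; rewrite -!leNgt => h.
have -> : cos (c / 2) - cos (phase P - c / 2) =
      - (2 * (sin (phase P / 2) * sin ((c - phase P) / 2))).
    have -> : c / 2 = phase P / 2 + (c - phase P) / 2 by lra.
    have -> : phase P - (phase P / 2 + (c - phase P) / 2) = phase P / 2 - (c - phase P) / 2 by lra.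
    by rewrite cosB cosD; ring.
by rewrite oppr_le0 mulr_ge0 // mulr_ge0 // sin_ge0_pi //; apply/andP; split; lra.
Qed.

Lemma trig_continuous (c : R) : continuous (fun P : G R => cos (phase P - c)).
Proof.
apply: (@lipG_continuous _ 3) => P Q.
pose f (p : R3) := cos (p.1.1 - c).
have := @lipschitz_descent f 1 ler01 _ _ P Q.
rewrite mulr1; apply.
  move=> th om x; rewrite /f /= -addrA (addrC (2 * pi)) addrA.
  by rewrite cos_periodic2pi.
move=> p q; rewrite mul1r; apply: le_trans (cos_lip _ _) _.
by rewrite opprB addrA subrK /dist1 -addrA lerDl addr_ge0.
Qed.

Lemma measurable_phase : measurable_fun setT (@phase R).
Proof.
apply: (measurability _ (measurable_realfun.RGenOInfty.measurableE R)) => //.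
move=> _ [_ [c ->] <-]; rewrite setTI.
have -> : phase @^-1` `]c, +oo[ = [set P : G R | c < phase P].
  by apply/seteqP; split => P /=; rewrite in_itv /= andbT.
have [c0|c0] := ltP c 0.
  rewrite (_ : mkset _ = setT); first exact: measurableT.
  apply/seteqP; split => // P _ /=; apply: lt_le_trans c0 _.
  by case/andP: (phase_itv P).
have [c1|c1] := ltP c (2 * pi); last first.
  rewrite (_ : mkset _ = set0); first exact: measurable0.
  apply/seteqP; split => // P /= /(le_lt_trans c1).
  by have /andP[_ /ltW] := phase_itv P; rewrite leNgt => /negP.
rewrite measurable_phase_gt ?c0 //; apply: sub_sigma_algebra.
have /continuousP cf : continuous (fun P : G R => cos (c / 2) - cos (phase P - c / 2)).
  by apply: continuous_sub; [exact: continuous_const|exact: trig_continuous].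
by have := cf _ (@open_gt R 0).
Qed.

End geometry.

Section test_class.
Context {R : realType}.
Notation R3 := (R * R * R)%type.

(** Products of such functions of the phase, the frequency and the site are
regular enough to be transported into admissible test functions, and rich
enough to determine a finite measure. *)
Definition phase_test (k : R -> R) := exists k' : R -> R,
  [/\ continuous k', forall t : R, is_derive t 1 k (k' t),
     forall t, k (t + 2 * pi) = k t & forall t, 0 <= k t <= 1].

Definition freq_test (c : R -> R) := [/\ continuous c, forall t, 0 <= c t <= 1 &
  exists N : R, forall t, N <= `|t| -> c t = 0].

Definition site_test (e : R -> R) := continuous e /\ forall t, 0 <= e t <= 1.

Lemma phase_test_continuous k : phase_test k -> continuous k.
Proof. by move=> [k' [_ h _ _]] t; exact: is_derive_continuous (h t). Qed.

Lemma phase_test1 : phase_test (fun=> 1).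
Proof.
exists (fun=> 0); split => //; first exact: continuous_const.
  by move=> t; exact: is_derive_const.
by move=> t; rewrite ler01 lexx.
Qed.

Lemma itv01M (x y : R) : 0 <= x <= 1 -> 0 <= y <= 1 -> 0 <= x * y <= 1.
Proof.
by move=> /andP[x0 x1] /andP[y0 y1]; rewrite mulr_ge0 //= -(mulr1 1) ler_pM.
Qed.

Lemma itv01C (x : R) : 0 <= x <= 1 -> 0 <= 1 - x <= 1.
Proof. by move=> /andP[x0 x1]; apply/andP; split; lra. Qed.

Lemma itv01X (x : R) n : 0 <= x <= 1 -> 0 <= x ^+ n <= 1.
Proof.
move=> h; elim: n => [|n IH]; first by rewrite expr0 ler01 lexx.
by rewrite exprS itv01M.
Qed.

Lemma phase_testM k l : phase_test k -> phase_test l ->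
  phase_test (fun t => k t * l t).
Proof.
move=> hk hl; have ck := phase_test_continuous hk; have cl := phase_test_continuous hl.
move: hk hl => [k' [ck' dk pk bk]] [l' [cl' dl pl bl]].
exists (fun t => k' t * l t + k t * l' t); split.
- by apply: continuous_add; apply: continuous_mul.
- by move=> t; exact: is_derive_mul.
- by move=> t; rewrite pk pl.
- by move=> t; exact: itv01M.
Qed.

Lemma phase_testC k : phase_test k -> phase_test (fun t => 1 - k t).
Proof.
move=> [k' [ck' dk pk bk]]; exists (fun t => 0 - k' t); split.
- by apply: continuous_sub => //; exact: continuous_const.
- by move=> t; apply: is_derive_sub.
- by move=> t; rewrite pk.
- by move=> t; exact: itv01C.
Qed.

Lemma phase_testX k n : phase_test k -> phase_test (fun t => 1 - (1 - k t) ^+ n).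
Proof.
move=> hk; apply: (@phase_testC (fun t => (1 - k t) ^+ n)).
elim: n => [|n IH].
  by have -> : (fun t => (1 - k t) ^+ 0) = fun=> 1 by []; exact: phase_test1.
have -> : (fun t => (1 - k t) ^+ n.+1) = (fun t => (1 - k t) * (1 - k t) ^+ n).
  by apply/funext => t; rewrite exprS.
exact: phase_testM (phase_testC hk) IH.
Qed.

Lemma continuous_pow (f : R -> R) n : continuous f -> continuous (fun t => f t ^+ n).
Proof.
move=> cf; elim: n => [|n IH].
  by have -> : (fun t => f t ^+ 0) = (fun=> 1) by []; exact: continuous_const.
have -> : (fun t => f t ^+ n.+1) = (fun t => f t * f t ^+ n).
  by apply/funext => t; rewrite exprS.
exact: continuous_mul.
Qed.

Lemma freq_testM k l : freq_test k -> freq_test l ->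
  freq_test (fun t => k t * l t).
Proof.
move=> [ck bk [N hN]] [cl bl _]; split.
- exact: continuous_mul.
- by move=> t; exact: itv01M.
- by exists N => t /hN ->; rewrite mul0r.
Qed.

Lemma site_testM k l : site_test k -> site_test l ->
  site_test (fun t => k t * l t).
Proof.
by move=> [ck bk] [cl bl]; split; [exact: continuous_mul|move=> t; exact: itv01M].
Qed.

Lemma site_testX k n : site_test k -> site_test (fun t => 1 - (1 - k t) ^+ n).
Proof.
move=> [ck bk]; split.
  apply: continuous_sub; first exact: continuous_const.
  by apply: continuous_pow; apply: continuous_sub => //; exact: continuous_const.
by move=> t; apply/itv01C/itv01X/itv01C.
Qed.

Lemma freq_testX k n : freq_test k -> freq_test (fun t => 1 - (1 - k t) ^+ n).
Proof.
move=> [ck bk [N hN]]; have [h1 h2] := site_testX n (conj ck bk).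
split => //; exists N => t /hN ->.
by rewrite subr0 expr1n subrr.
Qed.

Definition test_fun (k c e : R -> R) (P : G R) : R :=
  k (phase P) * c (freq P) * e (site P).

Definition test_set (A : set (G R)) := exists k c e,
  [/\ phase_test k, freq_test c, site_test e &
      A = [set P | 0 < test_fun k c e P]].

Lemma test_fun_itv k c e P : phase_test k -> freq_test c -> site_test e ->
  0 <= test_fun k c e P <= 1.
Proof.
by move=> [k' [_ _ _ bk]] [_ bc _] [_ be]; rewrite /test_fun; do 2 ?[apply: itv01M].
Qed.

Lemma measurable_test k c e : phase_test k -> freq_test c -> site_test e ->
  measurable_fun setT (test_fun k c e).
Proof.
move=> hk [cc _ _] [ce _]; rewrite /test_fun.
apply: measurable_funM; first apply: measurable_funM.
- apply: (measurableT_comp (f := k)); last exact: measurable_phase.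
  by apply: continuous_measurable_fun; exact: phase_test_continuous.
- apply: (measurableT_comp (f := c)); first exact: continuous_measurable_fun.
  by apply: continuous_measurableG; exact: freq_continuous.
- apply: (measurableT_comp (f := e)); first exact: continuous_measurable_fun.
  by apply: continuous_measurableG; exact: site_continuous.
Qed.

Lemma test_setI : setI_closed test_set.
Proof.
move=> _ _ [k [c [e [hk hc he ->]]]] [k1 [c1 [e1 [hk1 hc1 he1 ->]]]].
exists (fun t => k t * k1 t), (fun t => c t * c1 t), (fun t => e t * e1 t).
split; [exact: phase_testM|exact: freq_testM|exact: site_testM|].
apply/seteqP; split => P /=.
  move=> [h1 h2]; rewrite /test_fun (_ : _ * _ = test_fun k c e P * test_fun k1 c1 e1 P).
    exact: mulr_gt0.
  by rewrite /test_fun; ring.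
have /andP[h1 _] := test_fun_itv P hk hc he.
have /andP[h2 _] := test_fun_itv P hk1 hc1 he1.
have -> : test_fun (fun t => k t * k1 t) (fun t => c t * c1 t) (fun t => e t * e1 t) P =
  test_fun k c e P * test_fun k1 c1 e1 P by rewrite /test_fun; ring.
move=> h; rewrite !lt_neqAle h1 h2 !andbT.
by split; apply/eqP => e0; move: h; rewrite -e0 ?mul0r ?mulr0 ltxx.
Qed.

Definition hat (N : R) (t : R) : R := Num.max 0 (1 - `|t| / N).

Lemma hat_test (N : R) : 0 < N -> freq_test (hat N).
Proof.
move=> N0; split.
- move=> t; apply: (@continuous_max _ R (fun=> 0) (fun t : R => 1 - `|t| / N)).
    exact: cvg_cst.
  apply: cvgB; first exact: cvg_cst.
  by apply: cvgM; [exact: norm_continuous|exact: cvg_cst].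
- by move=> t; rewrite /hat le_max lexx /= ge_max ler01 /= gerBl divr_ge0 // ltW.
- exists N => t h; rewrite /hat; apply/max_idPl.
  by rewrite subr_le0 ler_pdivlMr // mul1r.
Qed.

Lemma hat_gt0 (N t : R) : 0 < N -> `|t| < N -> 0 < hat N t.
Proof. by move=> N0 h; rewrite /hat lt_max subr_gt0 ltr_pdivrMr // mul1r h orbT. Qed.

Lemma site_test1 : site_test (fun=> 1).
Proof. by split; [exact: continuous_const|move=> t; rewrite ler01 lexx]. Qed.

End test_class.

Section determining.
Context {R : realType}.
Notation R3 := (R * R * R)%type.

Lemma positive_part_sqr (u : R) :
  is_derive u 1 (fun t : R => Num.max 0 t ^+ 2) (2 * Num.max 0 u).
Proof.
apply: (@quadratic_derive _ _ _ _ 1) => h; rewrite mul1r.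
have h0 := sqr_ge0 h; rewrite ler_norml !maxEle.
do 2 (case: ifPn => [|]; rewrite -?ltNge => ?); apply/andP; split; nra.
Qed.

(** For c in [0, 2 pi), positive exactly at the phases in [0, 2 pi) that exceed c,
by measurable_phase_gt; the square makes the positive part continuously
differentiable. *)
Definition bump (c t : R) : R :=
  (Num.max 0 (cos (c / 2) - cos (t - c / 2)) / 2) ^+ 2.

Lemma bump_test (c : R) : phase_test (bump c).
Proof.
pose u (t : R) := cos (c / 2) - cos (t - c / 2).
have du (t : R) : is_derive t 1 u (sin (t - c / 2)).
  have := is_derive_sub (is_derive_const (cos (c / 2)) t)
    (@is_derive_compose R (@cos R) (fun t => t - c / 2) t _ _ (is_derive_cos (t - c / 2))
      (is_derive_sub (is_derive_ident t) (is_derive_const (c / 2) t))).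
  by rewrite sub0r subr0 mulr1 opprK.
have cu : continuous u by move=> t; exact: is_derive_continuous (du t).
have e t : bump c t = 4^-1 * (Num.max 0 (u t) ^+ 2).
  by rewrite /bump /u; field.
have -> : bump c = fun t => 4^-1 * (Num.max 0 (u t) ^+ 2) by apply/funext.
exists (fun t => 4^-1 * ((2 * Num.max 0 (u t)) * sin (t - c / 2))); split.
- apply: continuous_mul; first exact: continuous_const.
  apply: continuous_mul.
    apply: continuous_mul; first exact: continuous_const.
    by move=> t; apply: (@continuous_max _ R (fun=> 0) u); [exact: cvg_cst|exact: cu].
  apply: (@continuous_after _ _ (fun t => t - c / 2) _ (@sin R)); last exact: continuous_sin.
  by apply: continuous_sub; [exact: continuous_ident|exact: continuous_const].
- move=> t; apply: is_derive_scale.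
  exact: (is_derive_compose (positive_part_sqr (u t)) (du t)).
- by move=> t; rewrite /u addrAC cos_periodic2pi.
- move=> t; rewrite mulr_ge0 ?sqr_ge0 //=.
  have h1 : Num.max 0 (u t) <= 2.
    rewrite ge_max; apply/andP; split => //; rewrite /u.
    by have := cos_le1 (c / 2); have := cos_geN1 (t - c / 2); lra.
  have h0 : 0 <= Num.max 0 (u t) by rewrite le_max lexx.
  move: (Num.max 0 (u t)) h0 h1 => v h0 h1; nra.
Qed.

Lemma bump_gt0 (c t : R) : (0 < bump c t) = (0 < cos (c / 2) - cos (t - c / 2)).
Proof.
rewrite /bump; set u := _ - _; apply/idP/idP => [|u0].
  apply: contraTT; rewrite -!leNgt => u0.
  by rewrite (max_idPl u0) mul0r expr0n.
by rewrite exprn_gt0 // divr_gt0 // lt_max u0 orbT.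
Qed.

Lemma ramp_test (c : R) : site_test (fun t => cut 1 (t - c)).
Proof.
split; last by move=> t; exact: cut_itv.
apply: (@continuous_after _ _ (fun t => t - c) _ (cut 1)); last exact: continuous_cut.
by apply: continuous_sub; [exact: continuous_ident|exact: continuous_const].
Qed.

Lemma ramp_gt0 (c t : R) : (0 < cut 1 (t - c)) = (c < t).
Proof. by rewrite /cut lt_max ltxx /= lt_min subr_gt0 ltr01 andbT. Qed.

(** The compact support in the frequency is removed by an increasing sequence of
cutoffs. *)
Lemma test_sigma (k c e : R -> R) : phase_test k -> site_test c -> site_test e ->
  <<s test_set >> [set P : G R | 0 < test_fun k c e P].
Proof.
move=> hk [cc bc] he.
have -> : [set P : G R | 0 < test_fun k c e P] =
    \bigcup_n [set P : G R | 0 < test_fun k (fun t => c t * hat n.+1%:R t) e P].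
  apply/seteqP; split => P /=.
    move=> h; have [n hn] : exists n : nat, `|freq P| < n.+1%:R.
      exists (Num.Def.truncn `|freq P|); exact: Num.Theory.truncnS_gt.
    exists n => //=; rewrite /test_fun (_ : _ * _ = test_fun k c e P * hat n.+1%:R (freq P)).
      by rewrite mulr_gt0 // hat_gt0.
    by rewrite /test_fun; ring.
  move=> [n _] /=; rewrite /test_fun (_ : _ * _ = test_fun k c e P * hat n.+1%:R (freq P)); last first.
    by rewrite /test_fun; ring.
  have /andP[h0 _] : 0 <= hat n.+1%:R (freq P) <= 1.
    by have [_ + _] := @hat_test R n.+1%:R (ltr0Sn _ _); apply.
  move=> h; rewrite ltNge; apply/negP => t0.
  by have := mulr_le0_ge0 t0 h0; rewrite leNgt h.
apply: sigma_algebra_bigcup => n; apply: sub_sigma_algebra.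
exists k, (fun t => c t * hat n.+1%:R t), e; split => //.
have [ch bh [N hN]] := @hat_test R n.+1%:R (ltr0Sn _ _); split.
- exact: continuous_mul.
- by move=> t; exact: itv01M.
- by exists N => t /hN ->; rewrite mulr0.
Qed.

(** The three coordinates are measurable for the generated sigma-algebra, and G is
the image of its coordinates under a measurable map. *)
Lemma measurable_test_set : @measurable _ (G R) = <<s test_set >>.
Proof.
apply/seteqP; split => A; last first.
  apply: smallest_sub; first exact: sigma_algebra_measurable.
  move=> _ [k [c [e [hk hc he ->]]]].
  have := measurable_test hk hc he => /(_ measurableT _ (measurable_itv `]0, +oo[)).
  by rewrite setTI; congr measurable; apply/seteqP; split => P /=; rewrite in_itv /= andbT.
apply: smallest_sub; first exact: smallest_sigma_algebra.
move=> U oU.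
pose S := g_sigma_algebraType (@test_set R).
have ray (f : G R -> R) : (forall c, <<s test_set >> [set P | c < f P]) ->
    measurable_fun setT (f : S -> R).
  move=> hf; apply: (measurability _ (measurable_realfun.RGenOInfty.measurableE R)) => //.
  move=> _ [_ [c ->] <-]; rewrite setTI.
  have -> : f @^-1` `]c, +oo[ = [set P : G R | c < f P].
    by apply/seteqP; split => P /=; rewrite in_itv /= andbT.
  exact: hf.
have mph : measurable_fun setT (@phase R : S -> R).
  apply: ray => c; have [c0|c0] := ltP c 0.
    rewrite (_ : mkset _ = setT); first exact: (@measurableT _ S).
    apply/seteqP; split => // P _ /=; apply: lt_le_trans c0 _.
    by case/andP: (phase_itv P).
  have [c1|c1] := ltP c (2 * pi); last first.
    rewrite (_ : mkset _ = set0); first exact: (@measurable0 _ S).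
    apply/seteqP; split => // P /= /(le_lt_trans c1).
    by have /andP[_ /ltW] := phase_itv P; rewrite leNgt => /negP.
  rewrite measurable_phase_gt ?c0 //.
  have := test_sigma (bump_test c) site_test1 site_test1.
  congr (<<s _ >> _); apply/seteqP; split => P /=;
   by rewrite /test_fun !mulr1 bump_gt0.
have mom : measurable_fun setT (@freq R : S -> R).
  apply: ray => c; have := test_sigma phase_test1 (ramp_test c) site_test1.
  congr (<<s _ >> _); apply/seteqP; split => P /=;
   by rewrite /test_fun mulr1 mul1r ramp_gt0.
have mx : measurable_fun setT (@site R : S -> R).
  apply: ray => c; have := test_sigma phase_test1 site_test1 (ramp_test c).
  congr (<<s _ >> _); apply/seteqP; split => P /=;
   by rewrite /test_fun mulr1 mul1r ramp_gt0.
have mc : measurable_fun setT (fun P : S => (phase P, freq P, site P) : R3).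
  by apply: measurable_fun_pair => //; apply: measurable_fun_pair.
have mU : measurable (mk3 @^-1` U : set R3).
  by rewrite -[X in measurable X]setTI; apply: measurable_mk3 => //; exact: sub_sigma_algebra.
have := mc measurableT _ mU; rewrite setTI.
congr (<<s _ >> _); apply/seteqP; split => P /=; by rewrite /mk3 /= mkG_coords.
Qed.

Lemma indicator_limit (x : R) : 0 < x <= 1 -> 1 - (1 - x) ^+ n @[n --> \oo] --> (1 : R).
Proof.
move=> /andP[x0 x1].
have h : `|1 - x| < 1 by rewrite ger0_norm ?subr_ge0 //; lra.
by have := cvgB (@cvg_cst _ (1 : R) _ \oo _) (cvg_expr h); rewrite subr0; apply.
Qed.

Lemma indicator_monotone (x : R) (n m : nat) : 0 <= x <= 1 -> (n <= m)%N ->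
  1 - (1 - x) ^+ n <= 1 - (1 - x) ^+ m.
Proof.
by move=> /itv01C/andP[h0 h1] nm; rewrite lerD2l lerN2 ler_wiXn2l.
Qed.

(** The powers 1 - (1 - k)^n of a test function k increase to the indicator of
the set where k is positive, and remain test functions. *)
Lemma test_determines (m1 m2 : {measure set (G R) -> \bar R}) :
  (m1 setT < +oo)%E ->
  (forall k c e, phase_test k -> freq_test c -> site_test e ->
    \int[m1]_P (test_fun k c e P)%:E = \int[m2]_P (test_fun k c e P)%:E)%E ->
  forall A, measurable A -> m1 A = m2 A.
Proof.
move=> m1fin hm.
apply: (@measure_unique _ R (G R) (@test_set R)
  (fun n => [set P | 0 < test_fun (fun=> 1) (hat n.+1%:R) (fun=> 1) P])).
- exact: measurable_test_set.
- exact: test_setI.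
- move=> n; exists (fun=> 1), (hat n.+1%:R), (fun=> 1); split => //.
  + exact: phase_test1.
  + exact: hat_test.
  + exact: site_test1.
- apply/seteqP; split => // P _.
  exists (Num.Def.truncn `|freq P|) => //=.
  rewrite /test_fun mulr1 mul1r hat_gt0 //; exact: Num.Theory.truncnS_gt.
- move=> _ [k [c [e [hk hc he ->]]]].
  pose pw (f : R -> R) (n : nat) t := 1 - (1 - f t) ^+ n.
  pose g n P : \bar R := (test_fun (pw k n) (pw c n) (pw e n) P)%:E.
  set A := [set P | _].
  have mA : measurable A.
    rewrite measurable_test_set; apply: sub_sigma_algebra.
    by exists k, c, e.
  have lim (m : {measure set (G R) -> \bar R}) :
      (m A = limn (fun n => \int[m]_P g n P))%E.
    have := @monotone_convergence _ (G R) R m setT measurableT g.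
    have mg n : measurable_fun setT (g n).
      apply/measurable_EFinP; apply: measurable_test.
      + exact: phase_testX.
      + exact: freq_testX.
      + exact: site_testX.
    have g0 n P : setT P -> (0 <= g n P)%E.
      move=> _; rewrite lee_fin.
      by have /andP[] := test_fun_itv P (phase_testX n hk) (freq_testX n hc) (site_testX n he).
    move=> /(_ mg g0) <-; last first.
      move=> P _ n l nl; rewrite lee_fin /test_fun /pw.
      have [k' [_ _ _ bk]] := hk; have [_ bc _] := hc; have [_ be] := he.
      have b0 (x : R) i : 0 <= x <= 1 -> 0 <= 1 - (1 - x) ^+ i.
        by move=> /itv01C/(itv01X i)/itv01C/andP[].
      apply: ler_pM; rewrite ?mulr_ge0 ?b0 ?indicator_monotone //.
      by apply: ler_pM; rewrite ?b0 ?indicator_monotone.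
    transitivity (\int[m]_P (\1_A P)%:E)%E; first by rewrite integral_indic // setIT.
    apply: eq_integral => P _; apply/esym/cvg_lim => //.
    have [PA|PA] := boolP (P \in A).
      rewrite indicE PA.
      apply: cvg_EFin; first by near=> n.
      have [k' [_ _ _ bk]] := hk; have [_ bc _] := hc; have [_ be] := he.
      have /andP[k0 k1] := bk (phase P); have /andP[c0 c1] := bc (freq P).
      have /andP[e0 e1] := be (site P).
      move: PA; rewrite inE /A /= /test_fun => PA.
      have nz (x : R) : 0 <= x -> x != 0 -> 0 < x by rewrite lt_neqAle eq_sym => -> ->.
      have : k (phase P) * c (freq P) * e (site P) != 0 by rewrite gt_eqF.
      rewrite !mulf_eq0 !negb_or => /andP[/andP[kn cn] en].
      have l1 : pw k n (phase P) @[n --> \oo] --> (1 : R).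
        by apply: indicator_limit; rewrite nz.
      have l2 : pw c n (freq P) @[n --> \oo] --> (1 : R).
        by apply: indicator_limit; rewrite nz.
      have l3 : pw e n (site P) @[n --> \oo] --> (1 : R).
        by apply: indicator_limit; rewrite nz.
      have h := cvgM (cvgM l1 l2) l3; rewrite !mulr1 in h.
      exact: h.
    rewrite indicE (negbTE PA).
    have -> : (fun n => g n P) = (fun=> 0%E); last exact: cvg_cst.
    apply/funext => n; rewrite /g /test_fun /pw; congr EFin.
    have : ~~ (0 < test_fun k c e P) by apply: contra PA; rewrite inE.
    have /andP[h0 _] := test_fun_itv P hk hc he.
    rewrite lt_neqAle h0 andbT negbK eq_sym /test_fun !mulf_eq0.
    by move=> /orP[/orP[|]|] /eqP ->; rewrite subr0 expr1n subrr ?mul0r ?mulr0 ?mul0r.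
  rewrite !lim; congr (limn _); apply/funext => n; apply: hm.
  + exact: phase_testX.
  + exact: freq_testX.
  + exact: site_testX.
- move=> n; apply: le_lt_trans m1fin; apply: le_measure; rewrite ?inE //.
  rewrite measurable_test_set; apply: sub_sigma_algebra.
  exists (fun=> 1), (hat n.+1%:R), (fun=> 1); split => //.
  + exact: phase_test1.
  + exact: hat_test.
  + exact: site_test1.
Unshelve. all: by end_near. Qed.

End determining.

(** * Integrals over G and measures with a density *)

Section integrals.
Context {R : realType}.
Notation mu := (@lebesgue_measure R).
Notation TR := (measurableTypeR R).
Notation R3 := (TR * TR * TR)%type.

Lemma ge0_integral_mrestr d (T : measurableType d) (m : {measure set T -> \bar R})
    (D : set T) (mD : measurable D) (f : T -> \bar R) :
  measurable_fun setT f -> (forall x, 0 <= f x)%E ->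
  (\int[mrestr m mD]_x f x = \int[m]_(x in D) f x)%E.
Proof.
move=> mf f0.
have -> : (\int[m]_(x in D) f x = \int[mrestr m mD]_(x in D) f x)%E.
  by apply: eq_measure_integral => A mA AD; rewrite /= /mrestr setIidl.
rewrite -(setvU D) ge0_integral_setU //=.
- rewrite (@null_set_integral _ _ _ (mrestr m mD)) ?add0e //.
  + exact: measurableC.
  + exact: measurable_funTS.
  + by rewrite /= /mrestr setICl measure0.
- exact: measurableC.
- by rewrite setvU.
- by rewrite disj_set2E setICl.
Qed.

Lemma ge0_integral_vol_box (f : G R -> \bar R) :
  measurable_fun setT f -> (forall P, 0 <= f P)%E ->
  (\int[vol]_P f P = \int[lebesgue3]_(p in box) f (mk3 p))%E.
Proof.
move=> mf f0; rewrite -(ge0_integral_mrestr lebesgue3 measurable_box) //; last first.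
  exact: measurableT_comp mf (@measurable_mk3 R).
have := ge0_integral_pushforward (@measurable_mk3 R) (mrestr lebesgue3 measurable_box)
  measurableT mf (fun P _ => f0 P).
rewrite preimage_setT /= => <-.
apply: eq_measure_integral => [|m3 A mA _]; first exact: measurable_mk3.
by transitivity (vol A); [by []|rewrite volE].
Qed.

Lemma integral_vol (f : G R -> \bar R) :
  measurable_fun setT f -> (forall P, 0 <= f P)%E ->
  (\int[vol]_P f P = \int[mu]_(y in `[0%R, 1%R]) \int[mu]_la
     \int[mu]_(phi in `[0%R, (2 * pi)%R[) f (mkG phi la y))%E.
Proof.
move=> mf f0.
have mf3 : measurable_fun setT (fun p : R3 => f (mk3 p)).
  exact: measurableT_comp mf (@measurable_mk3 R).
rewrite ge0_integral_vol_box // integral_mkcond.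
have mr : measurable_fun setT ((fun p : R3 => f (mk3 p)) \_ box).
  apply/(measurable_restrictT _ (@measurable_box R)).
  exact: measurable_funTS.
rewrite /lebesgue3 fubini_tonelli2 //; last first.
  by move=> p; rewrite patchE; case: ifP.
rewrite [RHS]integral_mkcond; apply: eq_integral => y _.
rewrite /fubini_G /lebesgue2 fubini_tonelli2 //; last 2 first.
- exact: measurableT_comp mr (pair2_measurable y).
- by move=> p; rewrite patchE; case: ifP.
rewrite patchE; have [y01|y01] := boolP (y \in `[0, 1]%classic); last first.
  rewrite (eq_integral (cst 0%E)) ?integral0 // => la _.
  rewrite /fubini_G (eq_integral (cst 0%E)) ?integral0 // => phi _.
  rewrite patchE; case: ifP => //; rewrite inE => -[_ /= h].
  by case/negP: y01; rewrite inE.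
apply: eq_integral => la _; rewrite /fubini_G [RHS]integral_mkcond.
apply: eq_integral => phi _; rewrite !patchE /mk3 /=.
congr (if _ then _ else _).
apply/idP/idP; rewrite !inE /=.
  by move=> [[]].
by move=> h; split => //; move: y01; rewrite inE.
Qed.

Lemma measurable_Rint d1 d2 (T1 : measurableType d1) (T2 : measurableType d2)
    (m1 : {sigma_finite_measure set T1 -> \bar R}) (f : T1 * T2 -> R) :
  measurable_fun setT f -> measurable_fun setT (fun y => \int[m1]_x f (x, y)).
Proof.
move=> mf.
have mF : measurable_fun setT (EFin \o f) by exact/measurable_EFinP.
have -> : (fun y => \int[m1]_x f (x, y)) =
    fine \o (fun y => fubini_G m1 (EFin \o f)^\+ y - fubini_G m1 (EFin \o f)^\- y)%E.
  apply/funext => y; rewrite /Rintegral integralE /fubini_G /=.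
  by congr (fine (_ - _)); apply: eq_integral => x _; rewrite ?funeposE ?funenegE.
apply: measurableT_comp; first exact: fine_measurable.
apply: emeasurable_funB; apply: measurable_fun_fubini_tonelli_G => //.
- exact: measurable_funepos.
- exact: measurable_funeneg.
Qed.

Lemma Rint_prod d1 d2 (T1 : measurableType d1) (T2 : measurableType d2)
    (m1 : {sigma_finite_measure set T1 -> \bar R})
    (m2 : {sigma_finite_measure set T2 -> \bar R}) (f : T1 * T2 -> R) :
  (m1 \x m2)%E.-integrable setT (EFin \o f) ->
  \int[(m1 \x m2)%E]_z f z = \int[m2]_y \int[m1]_x f (x, y).
Proof.
move=> fi; rewrite /Rintegral -integral21_prod_meas1 //.
have mf : measurable_fun setT f by apply/measurable_EFinP; exact: measurable_int fi.
congr fine; apply: ae_eq_integral => //.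
- exact: (measurable_fubini_G fi).
- by apply/measurable_EFinP; exact: (measurable_Rint m1 mf).
- have := ae_integrable2 fi; apply: filterS => y hy _.
  by rewrite /fubini_G fineK //; exact: integrable_fin_num.
Qed.

Lemma measurable_Rint_slices (F : R3 -> R) : measurable_fun setT F ->
  measurable_fun setT (fun y => \int[mu]_la \int[mu]_phi F (phi, la, y)).
Proof.
move=> mF.
pose F' (z : TR * (TR * TR)) := F (z.1, z.2.1, z.2.2).
have mF' : measurable_fun setT F'.
  apply: measurableT_comp mF _.
  apply: measurable_fun_pair; last exact: measurableT_comp.
  by apply: measurable_fun_pair => //; exact: measurableT_comp.
exact: (measurable_Rint (@lebesgue_measure R) (measurable_Rint (@lebesgue_measure R) mF')).
Qed.

(** The iterated real-valued integral that defines the velocity is the integral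
over the space G: slices on which an inner integral diverges are negligible. *)
Lemma Rint_vol (f : G R -> R) : vol.-integrable setT (EFin \o f) ->
  \int[mu]_(y in `[0, 1]) \int[mu]_la \int[mu]_(phi in `[0, 2 * pi[)
     f (mkG phi la y) = \int[vol]_P f P.
Proof.
move=> /integrableP[mf fi].
have mfr : measurable_fun setT f by exact/measurable_EFinP.
pose F := (fun p : R3 => f (mk3 p)) \_ box.
have mF : measurable_fun setT F.
  apply/(measurable_restrictT _ (@measurable_box R)); apply: measurable_funTS.
  exact: measurableT_comp mfr (@measurable_mk3 R).
have Fvol (h : R -> \bar R) : measurable_fun setT h -> h 0 = 0%E ->
    (forall x, 0 <= h x)%E ->
    (\int[vol]_P h (f P) = \int[lebesgue3]_p h (F p))%E.
  move=> mh h0 hpos.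
  have mhf : measurable_fun setT (h \o f) by exact: measurableT_comp mh mfr.
  rewrite (ge0_integral_vol_box mhf); last by move=> P; exact: hpos.
  rewrite integral_mkcond; apply: eq_integral => p _.
  by rewrite /F !patchE; case: ifP.
have Fi : lebesgue3.-integrable setT (EFin \o F).
  apply/integrableP; split; first exact/measurable_EFinP.
  rewrite -(Fvol (fun x => `|x%:E|)%E) //; last by rewrite /= normr0.
  by apply: measurableT_comp => //; exact/measurable_EFinP.
have -> : \int[vol]_P f P = \int[lebesgue3]_p F p.
  rewrite /Rintegral integralE [in RHS]integralE; congr (fine (_ - _)).
    rewrite (eq_integral (fun P => maxe (f P)%:E 0%E)) => [|P _]; last by rewrite funeposE.
    rewrite [RHS](eq_integral (fun p => maxe (F p)%:E 0%E)) => [|p _]; last by rewrite funeposE.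
    apply: (Fvol (fun x => maxe x%:E 0%E)).
    + by apply: measurable_maxe => //; exact/measurable_EFinP.
    + by rewrite maxxx.
    + by move=> x; rewrite le_max lexx orbT.
  rewrite (eq_integral (fun P => maxe (- f P)%R%:E 0%E)) => [|P _]; last by rewrite funenegE.
  rewrite [RHS](eq_integral (fun p => maxe (- F p)%R%:E 0%E)) => [|p _]; last by rewrite funenegE.
  apply: (Fvol (fun x => maxe (- x)%R%:E 0%E)).
  + by apply: measurable_maxe => //; apply/measurable_EFinP; apply: continuous_measurable_fun; apply: continuous_opp; exact: continuous_ident.
  + by rewrite oppr0 maxxx.
  + by move=> x; rewrite le_max lexx orbT.
have -> : \int[lebesgue3]_p F p = \int[mu]_y \int[lebesgue2]_p F (p, y).
  exact: Rint_prod.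
rewrite Rintegral_mkcond; apply: (congr1 fine).
apply: ae_eq_integral => //.
- apply/measurable_EFinP.
  have := measurable_Rint_slices mF; congr (measurable_fun _ _).
  apply/funext => y; rewrite patchE.
  have [y01|y01] := boolP (y \in `[0, 1]%classic); last first.
    rewrite (eq_Rintegral _ (g := cst 0)) ?Rintegral_cst ?mul0r // => la _.
    rewrite (eq_Rintegral _ (g := cst 0)) ?Rintegral_cst ?mul0r // => phi _.
    rewrite /F patchE; case: ifP => //; rewrite inE => -[_ /= h].
    by case/negP: y01; rewrite inE.
  apply: eq_Rintegral => la _; rewrite [in RHS]Rintegral_mkcond.
  apply: eq_Rintegral => phi _; rewrite /F !patchE /mk3 /=.
  congr (if _ then _ else _).
  apply/idP/idP; rewrite !inE /=; first by move=> [[]].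
  by move=> h; split => //; move: y01; rewrite inE.
- apply/measurable_EFinP; exact: (measurable_Rint lebesgue2 mF).
- have := ae_integrable2 Fi; apply: filterS => y hy _.
  rewrite patchE; congr EFin; rewrite [RHS](Rint_prod (m1 := @lebesgue_measure R) (m2 := @lebesgue_measure R)) //.
  have [y01|y01] := boolP (y \in `[0, 1]%classic); last first.
    rewrite [RHS](eq_Rintegral _ (g := cst 0)) ?Rintegral_cst ?mul0r // => la _.
    rewrite (eq_Rintegral _ (g := cst 0)) ?Rintegral_cst ?mul0r // => phi _.
    rewrite /F patchE; case: ifP => //; rewrite inE => -[_ /= h].
    by case/negP: y01; rewrite inE.
  apply: eq_Rintegral => la _; rewrite [in LHS]Rintegral_mkcond.
  apply: eq_Rintegral => phi _; rewrite /F !patchE /mk3 /=.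
  congr (if _ then _ else _).
  apply/idP/idP; rewrite !inE /=; last by move=> [[]].
  by move=> h; split => //; move: y01; rewrite inE.
Qed.

End integrals.

Section density.
Context {R : realType}.

Section density_measure.
Variable r : G R -> R.
Hypotheses (mr : measurable_fun setT r) (r0 : forall P, 0 <= r P).

Let m (A : set (G R)) : \bar R := (\int[vol]_(P in A) (r P)%:E)%E.

Let m0 : m set0 = 0%E. Proof. by rewrite /m integral_set0. Qed.

Let mge0 A : (0 <= m A)%E.
Proof. by apply: integral_ge0 => P _; rewrite lee_fin. Qed.

Let madd : semi_sigma_additive m.
Proof.
move=> F mF tF mUF; rewrite /m ge0_integral_bigcup //.
- by apply: is_cvg_ereal_nneg_natsum_cond => n _ _; exact: mge0.
- by apply/measurable_EFinP; exact: measurable_funTS.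
- by move=> P _; rewrite lee_fin.
Qed.

Lemma density_measure : exists m' : {measure set (G R) -> \bar R},
  forall A, measurable A -> (m' A = \int[vol]_(P in A) (r P)%:E)%E.
Proof.
pose m' : {measure set (G R) -> \bar R} :=
  HB.pack m (isMeasure.Build _ _ _ m m0 mge0 madd).
by exists m'.
Qed.

Lemma density_probability : (\int[vol]_P (r P)%:E = 1)%E ->
  exists m' : probability (G R) R,
    forall A, measurable A -> (m' A = \int[vol]_(P in A) (r P)%:E)%E.
Proof.
move=> r1; pose m' : {measure set (G R) -> \bar R} :=
  HB.pack m (isMeasure.Build _ _ _ m m0 mge0 madd).
pose m'' : probability (G R) R := HB.pack m (isMeasure.Build _ _ _ m m0 mge0 madd)
  (Measure_isProbability.Build _ _ _ m' r1).
by exists m''.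
Qed.

End density_measure.

Import HBNNSimple.

Section change_density.
Variables (m : {measure set (G R) -> \bar R}) (r : G R -> R).
Hypotheses (mr : measurable_fun setT r) (r0 : forall P, 0 <= r P).
Hypothesis hm : forall A, measurable A -> (m A = \int[vol]_(P in A) (r P)%:E)%E.

Local Open Scope ereal_scope.

Lemma nnsfun_integral_density (h : {nnsfun G R >-> R}) :
  \int[m]_P (h P)%:E = \int[vol]_P ((h P)%:E * (r P)%:E).
Proof.
have mer : measurable_fun setT (fun P => (r P)%:E) by exact/measurable_EFinP.
have er0 P : 0 <= (r P)%:E by rewrite lee_fin.
have mh1 y : measurable (h @^-1` [set y]) by exact: measurable_sfunP.
have mi y : measurable_fun setT (fun P => (\1_(h @^-1` [set y]) P)%:E : \bar R).
  by apply/measurable_EFinP; exact: measurable_indic.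
have -> : \int[m]_P (h P)%:E = \sum_(y \in range h) (y%:E * m (h @^-1` [set y])).
  by rewrite integral_nnsfun // sintegralE patch_setT.
transitivity (\int[vol]_P (\sum_(y \in range h)
    (y%:E * ((\1_(h @^-1` [set y]) P)%:E * (r P)%:E)))); last first.
  apply: eq_integral => P _; rewrite [in RHS]fimfunE -fsumEFin //.
  rewrite ge0_mule_fsuml => [|y]; last exact: nnfun_muleindic_ge0.
  by apply: eq_fsbigr => y _; rewrite EFinM muleA.
have mir y : measurable_fun setT (fun P => (\1_(h @^-1` [set y]) P)%:E * (r P)%:E).
  by apply: emeasurable_funM.
rewrite ge0_integral_fsum //; last 2 first.
- by move=> y; apply: emeasurable_funM.
- move=> y P _; rewrite muleA mule_ge0 //; exact: nnfun_muleindic_ge0.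
apply: eq_fsbigr => y; rewrite inE => -[P _ <-].
rewrite ge0_integralZl ?lee_fin //; last by move=> Q _; rewrite mule_ge0 // lee_fin.
congr (_ * _); rewrite hm // [in LHS]integral_mkcond; apply: eq_integral => Q _.
by rewrite patchE indicE; case: ifP => _; rewrite ?mul1e ?mul0e.
Qed.

Lemma ge0_integral_density (f : G R -> \bar R) :
  measurable_fun setT f -> (forall P, 0 <= f P) ->
  \int[m]_P f P = \int[vol]_P (f P * (r P)%:E).
Proof.
move=> mf f0; pose h := nnsfun_approx measurableT mf.
have lim (m' : {measure set (G R) -> \bar R}) (s : G R -> R) :
    measurable_fun setT s -> (forall P, (0 <= s P)%R) ->
    \int[m']_P (f P * (s P)%:E) =
    limn (fun n => \int[m']_P ((h n P)%:E * (s P)%:E)).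
  move=> ms s0; rewrite -monotone_convergence //.
  - apply: eq_integral => P _; apply/esym/cvg_lim => //; apply: cvgeZr => //.
    by apply: (cvg_nnsfun_approx measurableT mf) => // Q _; exact: f0.
  - move=> n; apply: emeasurable_funM; apply/measurable_EFinP => //.
  - by move=> n P _; rewrite mule_ge0 ?lee_fin.
  - move=> P _ a b ab; rewrite lee_wpmul2r ?lee_fin //.
    by have /lefP := nd_nnsfun_approx measurableT mf ab; apply.
transitivity (\int[m]_P (f P * (1%R)%:E)).
  by apply: eq_integral => P _; rewrite mule1.
rewrite lim // lim //; congr (limn _); apply/funext => n.
rewrite -nnsfun_integral_density; apply: eq_integral => P _; by rewrite mule1.
Qed.

Lemma Rint_density (f : G R -> R) (B : R) : measurable_fun setT f ->
  (forall P, `|f P| <= B)%R -> m setT = 1 ->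
  [/\ m.-integrable setT (EFin \o f), vol.-integrable setT (fun P => (f P * r P)%:E) &
  (\int[m]_P f P = \int[vol]_P (f P * r P))%R].
Proof.
move=> mf fB m1.
have mef : measurable_fun setT (EFin \o f) by exact/measurable_EFinP.
have fi : m.-integrable setT (EFin \o f).
  apply/integrableP; split => //.
  apply: (@le_lt_trans _ _ (\int[m]_P B%:E)); last first.
    by rewrite integral_cst // m1 mule1 ltry.
  apply: ge0_le_integral => //.
  - exact: measurableT_comp.
  - by move=> P _; rewrite lee_fin (le_trans _ (fB P)).
have fri : vol.-integrable setT (fun P => (f P * r P)%:E).
  apply/integrableP; split; first exact/measurable_EFinP/measurable_funM.
  have /integrableP[_] := fi; rewrite ge0_integral_density //; last exact: measurableT_comp.
  apply: le_lt_trans; rewrite le_eqVlt; apply/orP; left; apply/eqP.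
  by apply: eq_integral => P _; rewrite /= -EFinM normrM (ger0_norm (r0 P)).
split => //; rewrite /Rintegral [in LHS]integralE [in RHS]integralE.
congr (fine (_ - _)).
  rewrite ge0_integral_density //; last exact: measurable_funepos.
  apply: eq_integral => P _; rewrite !funeposE /= -EFin_max -EFinM -EFin_max.
  by rewrite maxr_pMl // mul0r.
rewrite ge0_integral_density //; last exact: measurable_funeneg.
apply: eq_integral => P _; rewrite !funenegE /=.
rewrite -!EFin_max -EFinM.
by rewrite maxr_pMl // mul0r mulNr.
Qed.

End change_density.

End density.

(** * Transport of a density along the flow *)

Section periodic.
Context {R : realType}.
Notation R3 := (R * R * R)%type.
Implicit Types (P Q : G R) (p q : R3).

Lemma phase_periodicN (U : Type) (f : R3 -> U) : phase_periodic f ->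
  forall (n : nat) th om x, f (th - 2 * pi * n%:R, om, x) = f (th, om, x).
Proof.
move=> pf; elim=> [|n IH] th om x; first by rewrite mulr0 subr0.
rewrite -(pf (th - _)) -[RHS](IH th); congr (f (_, _, _)).
by rewrite -natr1; ring.
Qed.

Lemma phase_periodicP (U : Type) (f : R3 -> U) : phase_periodic f ->
  forall (n : nat) th om x, f (th + 2 * pi * n%:R, om, x) = f (th, om, x).
Proof.
move=> pf n th om x.
by rewrite -(phase_periodicN pf n (th + _)) addrK.
Qed.

Lemma phase_periodic_wrap (U : Type) (f : R3 -> U) : phase_periodic f ->
  forall th om x, f (Defs.wrap th, om, x) = f (th, om, x).
Proof.
move=> pf th om x; rewrite /Defs.wrap.
case: (Num.Def.floor _) => n; first exact: phase_periodicN.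
rewrite NegzE mulrNz mulrN opprK; exact: phase_periodicP.
Qed.

Definition shift_periodic (y : R3 -> R) : Prop :=
  forall th om x, y (th + 2 * pi, om, x) = y (th, om, x) + 2 * pi.

(** The map of G that moves only the phase.  It respects the circle when the lift y
commutes with the shift by a period. *)
Definition onG (y : R3 -> R) (P : G R) : G R :=
  mkG (y (coords P)) (freq P) (site P).

Lemma freq_onG y P : freq (onG y P) = freq P. Proof. by []. Qed.

Lemma site_onG y P : site (onG y P) = site P.
Proof. by rewrite site_mkG clamp_id // site_itv. Qed.

Lemma phase_periodic_mkG (U : Type) (f : R3 -> U) : phase_periodic f ->
  forall th om x, f (coords (mkG th om x)) = f (th, om, clamp x).
Proof. by move=> pf th om x; rewrite coordsE; exact: (phase_periodic_wrap pf). Qed.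

Lemma shift_phase_periodic (y : R3 -> R) : shift_periodic y ->
  phase_periodic (fun p => mkG (y p) p.1.2 p.2).
Proof. by move=> py th om x; rewrite /= py mkG_periodic. Qed.

Lemma onG_mkG y th om x : shift_periodic y ->
  onG y (mkG th om x) = mkG (y (th, om, clamp x)) om (clamp x).
Proof.
move=> /shift_phase_periodic py.
have := phase_periodic_mkG py th om x.
by rewrite /= /onG {1}coordsE.
Qed.

Lemma onG_comp (y z : R3 -> R) P : shift_periodic y ->
  onG y (onG z P) = mkG (y (z (coords P), freq P, site P)) (freq P) (site P).
Proof. by move=> py; rewrite {2}/onG onG_mkG // !clamp_id // site_itv. Qed.

Lemma onG_lipschitz (y : R3 -> R) (k : R) : 0 <= k -> shift_periodic y ->
  (forall p q, `|y p - y q| <= k * dist1 p q) ->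
  forall P Q, dG (onG y P) (onG y Q) <= 3 * (k + 1) * dG P Q.
Proof.
move=> k0 py hy P Q; have [p [hp hpf]] := lift_near P Q.
have e : onG y P = mkG (y p) p.1.2 p.2.
  by rewrite (hpf _ _ (shift_phase_periodic py)) /onG.
rewrite e {1}/onG.
apply: le_trans (dG_mkG_le _ _ _ _ _ _) _.
have h1 := hy p (coords Q).
have h2 : `|p.1.2 - freq Q| + `|p.2 - site Q| <= dist1 p (coords Q).
  by rewrite /dist1 coordsE /= -addrA lerDr.
have k1 : 0 <= k + 1 by rewrite addr_ge0.
have h3 : (k + 1) * dist1 p (coords Q) <= (k + 1) * (3 * dG P Q) by rewrite ler_wpM2l.
by rewrite -addrA; lra.
Qed.

Lemma lipGG_continuous (f : G R -> G R) (k : R) :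
  (forall P Q, dG (f P) (f Q) <= k * dG P Q) -> continuous f.
Proof.
move=> hf P A /nbhs_ballP[e /= e0 eA]; apply/nbhs_ballP.
have k0 : 0 < `|k| + 1 by rewrite ltr_wpDl.
exists (e / (`|k| + 1)) => /=; first by rewrite divr_gt0.
move=> Q; rewrite ballEmdist /= => h; apply: eA; rewrite ballEmdist /=.
have d0 : 0 <= dG P Q by rewrite sqrtr_ge0.
have hd : dG P Q < e / (`|k| + 1) by exact: h.
apply: le_lt_trans (hf _ _) _; apply: (@le_lt_trans _ _ ((`|k| + 1) * dG P Q)).
  by rewrite ler_wpM2r // (le_trans (ler_norm _)) // lerDl.
by rewrite mulrC -ltr_pdivlMr.
Qed.

Lemma mkG_continuous_phase om x : continuous (fun th : R => mkG th om x : G R).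
Proof.
move=> th A /nbhs_ballP[e /= e0 eA]; apply/nbhs_ballP; exists e => //= th'.
rewrite /ball /= => h; apply: eA; rewrite ballEmdist /=.
apply: le_lt_trans (dG_mkG_le _ _ _ _ _ _) _.
by rewrite !subrr normr0 !addr0.
Qed.

End periodic.

Section circle_integral.
Context {R : realType}.
Notation mu := (@lebesgue_measure R).

Lemma FTC2 (f F : R -> R) (u v : R) : u < v -> continuous f ->
  (forall t : R, is_derive t 1 F (f t)) ->
  (\int[mu]_(x in `[u, v]) (f x)%:E = (F v - F u)%:E)%E.
Proof.
move=> uv cf hF.
have cF : continuous F by move=> t; exact: is_derive_continuous (hF t).
rewrite (@continuous_FTC2 R f F u v uv) //.
- exact: continuous_subspaceT.
- split.
  + by move=> x _; have [] := hF x.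
  + by apply: cvg_at_right_filter; exact: cF.
  + by apply: cvg_at_left_filter; exact: cF.
- by move=> x _; rewrite derive1E; have [_ ->] := hF x.
Qed.

Lemma integral_co (f : R -> R) (u v : R) : continuous f ->
  (\int[mu]_(x in `[u, v[) (f x)%:E = \int[mu]_(x in `[u, v]) (f x)%:E)%E.
Proof.
move=> cf; apply: integral_itv_bndo_bndc; apply/measurable_EFinP.
by apply: measurable_funTS; exact: continuous_measurable_fun.
Qed.

(** Both sides are the increment of a primitive of H over one period. *)
Lemma circle_substitution (H F dF : R -> R) :
  continuous H -> (forall t, H (t + 2 * pi) = H t) ->
  (forall t : R, is_derive t 1 F (dF t)) -> continuous dF ->
  (forall t, F (t + 2 * pi) = F t + 2 * pi) ->
  (\int[mu]_(x in `[0%R, (2 * pi)%R[) (H x)%:E =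
   \int[mu]_(x in `[0%R, (2 * pi)%R[) (H (F x) * dF x)%:E)%E.
Proof.
move=> cH pH hF cdF pF; have p0 := @twopi_gt0 R.
have [P [P0 hP]] := exists_primitive cH.
have cF : continuous F by move=> t; exact: is_derive_continuous (hF t).
rewrite integral_co // integral_co; last first.
  by apply: continuous_mul => //; exact: (continuous_after cF).
rewrite (FTC2 p0 cH hP).
have cHF : continuous (fun t => H (F t) * dF t).
  by apply: continuous_mul => //; exact: (continuous_after cF).
rewrite (FTC2 p0 cHF (fun t => is_derive_compose (hP (F t)) (hF t))).
have per t : P (t + 2 * pi) - P t = P (0 + 2 * pi) - P 0.
  have d (s : R) : is_derive s 1 (fun s : R => P (s + 2 * pi) - P s) 0.
    have h : is_derive s 1 (fun s : R => s + 2 * pi) 1.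
      by have := is_derive_add (is_derive_ident s) (is_derive_const (2 * pi) s); rewrite addr0.
    have := is_derive_sub (@is_derive_compose R P (fun s => s + 2 * pi) s _ _ (hP (s + 2 * pi)) h) (hP s).
    by rewrite pH mulr1 subrr.
  exact: (is_derive_0_is_cst (f := fun s => P (s + 2 * pi) - P s)).
have := pF 0; rewrite add0r => ->; rewrite per add0r //.
Qed.

End circle_integral.

Section transport.
Context {R : realType}.
Notation R3 := (R * R * R)%type.
Variables (T M L : R) (a b : R -> R -> R) (X j Y : R -> R3 -> R).
Hypotheses (T0 : 0 <= T) (ha : amplitude M L a) (hb : amplitude M L b).
Hypotheses (hX : is_flow T a b X) (hj : is_log_stretch T a b X j).
Hypothesis (hY : is_backflow T X Y).

Let l0 : 0 <= flow_lip T M L. Proof. exact: flow_lip_ge0 T0 ha. Qed.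
Let y0 : 0 <= flow_lip T M L * (1 + flow_lip T M L).
Proof. by rewrite mulr_ge0 // addr_ge0. Qed.

Lemma flow_shift t : 0 <= t <= T -> shift_periodic (X t).
Proof. by move=> tT th om x; exact: (flow_periodic T0 ha hb hX th om x tT). Qed.

Lemma backflow_shift t : shift_periodic (Y t).
Proof. by move=> th om x; exact: (backflow_periodic T0 ha hb hX hY). Qed.

Lemma flowGK t P : 0 <= t <= T -> onG (X t) (onG (Y t) P) = P.
Proof.
move=> tT; rewrite onG_comp; last exact: flow_shift.
have := hY t (coords P); rewrite cut_id // => ->.
exact: mkG_coords.
Qed.

Lemma flowG_lipschitz t P Q : 0 <= t <= T ->
  dG (onG (X t) P) (onG (X t) Q) <= 3 * (flow_lip T M L + 1) * dG P Q.
Proof.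
move=> tT; apply: onG_lipschitz => //; first exact: flow_shift.
by move=> p q; exact: (flow_dist T0 ha hb hX).
Qed.

Lemma flowG_continuous t : 0 <= t <= T -> continuous (onG (X t)).
Proof. by move=> tT; apply: lipGG_continuous => P Q; exact: flowG_lipschitz. Qed.

Lemma backflowG_continuous t : continuous (onG (Y t)).
Proof.
apply: (@lipGG_continuous R _ (3 * (flow_lip T M L * (1 + flow_lip T M L) + 1))).
apply: onG_lipschitz => //; first exact: backflow_shift.
by move=> p q; exact: (backflow_dist T0 ha hb hX hY).
Qed.

Lemma continuous_measurableGG (f : G R -> G R) : continuous f ->
  measurable_fun setT f.
Proof.
move=> /continuousP cf; apply: (@measurability _ _ _ _ _ _ (@open (G R))) => //.
by move=> _ [U oU <-]; rewrite setTI; apply: sub_sigma_algebra; exact: cf.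
Qed.

(** The logarithm of the Jacobian of the flow at the point that it sends to
the given one. *)
Definition back_stretch (t : R) (p : R3) : R := j (cut T t) (Y t p, p.1.2, p.2).

Lemma back_stretch_periodic t : phase_periodic (back_stretch t).
Proof.
move=> th om x; rewrite /back_stretch /= (backflow_shift t th om x).
exact: (stretch_periodic T0 ha hb hX hj).
Qed.

Lemma back_stretch_dist t p q : `|back_stretch t p - back_stretch t q| <=
  stretch_lip T M L * (flow_lip T M L * (1 + flow_lip T M L) + 1) * dist1 p q.
Proof.
have s0 : 0 <= stretch_lip T M L.
  have M0 := amplitude_ge0 ha; have L0 := lipschitz_ge0 ha.
  by rewrite mulr_ge0 // addr_ge0 // mulr_ge0 // ?mulr_ge0.
apply: le_trans (stretch_dist T0 ha hb hX hj _ _ (cut_itv t T0)) _.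
rewrite -mulrA ler_wpM2l // mulrDl mul1r {1}/dist1 /= -addrA; apply: lerD.
  exact: (backflow_dist T0 ha hb hX hY).
by rewrite /dist1 -addrA lerDr.
Qed.

(** The density at the initial point, divided by the Jacobian of the flow. *)
Definition transported (r : G R -> R) (t : R) (P : G R) : R :=
  r (onG (Y t) P) * expR (- back_stretch t (coords P)).

Lemma transported_continuous (r : G R -> R) t : continuous r -> continuous (transported r t).
Proof.
move=> cr; apply: continuous_mul.
  by move=> P; apply: continuous_comp; [exact: backflowG_continuous|exact: cr].
apply: (continuous_after (f := fun P => - back_stretch t (coords P)) _ (@continuous_expR R)).
apply: continuous_opp.
apply: (lipG_continuous (k := 3 * (stretch_lip T M L * (flow_lip T M L * (1 + flow_lip T M L) + 1)))).
apply: lipschitz_descent.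
- have s0 : 0 <= stretch_lip T M L.
    have M0 := amplitude_ge0 ha; have L0 := lipschitz_ge0 ha.
    by rewrite mulr_ge0 // addr_ge0 // mulr_ge0 // ?mulr_ge0.
  by rewrite mulr_ge0 // addr_ge0.
- exact: back_stretch_periodic.
- exact: back_stretch_dist.
Qed.

Lemma transported0 r P : transported r 0 P = r P.
Proof.
rewrite /transported /back_stretch (backflow0 T0 hX hY) /onG (backflow0 T0 hX hY).
rewrite mkG_coordsE.
have -> : cut T 0 = 0 by rewrite cut_id // lexx.
by rewrite (hj _).1 oppr0 expR0 mulr1.
Qed.

(** For each frequency and site this is the substitution of the phase by its image
under the flow. *)
Lemma transported_test (r : G R -> R) (k c e : R -> R) t : 0 <= t <= T -> continuous r ->
  (forall P, 0 <= r P) -> phase_test k -> freq_test c -> site_test e ->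
  (\int[vol]_P (test_fun k c e P * transported r t P)%:E =
   \int[vol]_P (test_fun k c e (onG (X t) P) * r P)%:E)%E.
Proof.
move=> tT cr r0 hk hc he.
have mtr : measurable_fun setT (transported r t).
  by apply: continuous_measurableG; exact: transported_continuous.
have mt := measurable_test hk hc he.
have mX : measurable_fun setT (onG (X t)).
  by apply: continuous_measurableGG; exact: flowG_continuous.
rewrite !integral_vol; first last.
- move=> P; rewrite lee_fin; have /andP[h _] := test_fun_itv P hk hc he.
  by rewrite (mulr_ge0 h) // mulr_ge0 ?expR_ge0.
- by apply/measurable_EFinP; apply: measurable_funM.
- move=> P; rewrite lee_fin; have /andP[h _] := test_fun_itv (onG (X t) P) hk hc he.
  exact: (mulr_ge0 h).
- apply/measurable_EFinP; apply: measurable_funM.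
    exact: measurableT_comp mt mX.
  exact: continuous_measurableG.
apply: eq_integral => y; rewrite inE /= in_itv /= => y01.
apply: eq_integral => la _.
pose H phi := c la * e y * (k phi * (r (mkG (Y t (phi, la, y)) la y) *
   expR (- back_stretch t (phi, la, y)))).
have ck := phase_test_continuous hk; have [_ [_ _ pk _]] := hk.
transitivity (\int[lebesgue_measure]_(phi in `[0%R, (2 * pi)%R[) (H phi)%:E)%E.
  apply: eq_integral => phi _; congr EFin.
  rewrite /transported (phase_periodic_mkG (back_stretch_periodic t)).
  rewrite onG_mkG; last exact: backflow_shift.
  rewrite /test_fun freq_mkG site_mkG phase_mkG clamp_id // /H.
  rewrite (_ : k (Defs.wrap phi) = k phi); first by ring.
  by have := @phase_periodic_wrap R R (fun p => k p.1.1) _ phi 0 0; apply => th om x /=.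
have cY : continuous (fun phi => Y t (phi, la, y)).
  apply: (@lipschitz_continuous _ _ (flow_lip T M L * (1 + flow_lip T M L))) => u v.
  apply: le_trans (backflow_dist T0 ha hb hX hY _ _ _) _.
  by rewrite /dist1 /= !subrr normr0 !addr0.
have cB : continuous (fun phi => back_stretch t (phi, la, y)).
  apply: (@lipschitz_continuous _ _ (stretch_lip T M L * (flow_lip T M L * (1 + flow_lip T M L) + 1))) => u v.
  apply: le_trans (back_stretch_dist _ _ _) _.
  by rewrite /dist1 /= !subrr normr0 !addr0.
have cH : continuous H.
  rewrite /H; apply: continuous_mul; first exact: continuous_const.
  apply: continuous_mul => //; apply: continuous_mul.
    move=> phi; apply: (@continuous_comp _ _ _ (fun phi => mkG (Y t (phi, la, y)) la y : G R) r); last exact: cr.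
    apply: (@continuous_comp _ _ _ (fun phi => Y t (phi, la, y)) (fun th => mkG th la y : G R)).
      exact: cY.
    exact: mkG_continuous_phase.
  apply: (continuous_after (f := fun phi => - back_stretch t (phi, la, y)) _ (@continuous_expR R)).
  exact: continuous_opp.
have pH phi : H (phi + 2 * pi) = H phi.
  rewrite /H pk (backflow_shift t phi la y) mkG_periodic.
  by rewrite (back_stretch_periodic t phi la y).
have cJ : continuous (fun phi => expR (j t (phi, la, y))).
  apply: (continuous_after (f := fun phi => j t (phi, la, y)) _ (@continuous_expR R)).
  apply: (@lipschitz_continuous _ _ (stretch_lip T M L)) => u v.
  apply: le_trans (stretch_dist T0 ha hb hX hj _ _ tT) _.
  by rewrite /dist1 /= !subrr normr0 !addr0.
rewrite (circle_substitution cH pH (fun phi => flow_derive_phase T0 ha hb hX hj phi la y tT)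
  cJ (fun phi => flow_shift tT phi la y)).
apply: eq_integral => phi _; congr EFin.
rewrite (onG_mkG _ _ _ (flow_shift tT)) /test_fun freq_mkG site_mkG phase_mkG !clamp_id //.
have hYX : Y t (X t (phi, la, y), la, y) = phi.
  by have := backflowK T0 ha hb hX hY (phi, la, y) t; rewrite cut_id.
rewrite /H /back_stretch /= hYX cut_id //.
have -> : k (Defs.wrap (X t (phi, la, y))) = k (X t (phi, la, y)).
  by have := @phase_periodic_wrap R R (fun p => k p.1.1) _ (X t (phi, la, y)) 0 0; apply => th om x /=.
by rewrite expRN; field; rewrite gt_eqF // expR_gt0.
Qed.

(** Both measures have the same integrals against products of functions of the
coordinates, and these determine a measure. *)
Lemma transported_image (m0 : probability (G R) R) (r : G R -> R) t : 0 <= t <= T ->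
  continuous r -> (forall P, 0 <= r P) ->
  (forall A, measurable A -> m0 A = \int[vol]_(P in A) (r P)%:E)%E ->
  forall A, measurable A ->
    (\int[vol]_(P in A) (transported r t P)%:E = m0 (onG (X t) @^-1` A))%E.
Proof.
move=> tT cr r0 hm0 A mA.
have mtr : measurable_fun setT (transported r t).
  by apply: continuous_measurableG; exact: transported_continuous.
have tr0 P : 0 <= transported r t P by rewrite mulr_ge0 ?expR_ge0.
have mX : measurable_fun setT (onG (X t)).
  by apply: continuous_measurableGG; exact: flowG_continuous.
have mr := continuous_measurableG cr.
have [m hm] := density_measure mtr tr0.
rewrite -hm //; apply/esym.
pose Xm : {mfun G R >-> G R} := HB.pack (onG (X t)) (isMeasurableFun.Build _ _ _ _ _ mX).
pose m1 : {measure set (G R) -> \bar R} := distribution m0 Xm.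
apply: (@test_determines _ m1 m _ _ A mA).
  have -> : m1 setT = 1%E by exact: (@probability_setT _ _ _ (distribution m0 Xm)).
  exact: ltry.
move=> k c e hk hc he.
have mt := measurable_test hk hc he.
have met : measurable_fun setT (fun P => (test_fun k c e P)%:E) by exact/measurable_EFinP.
have t0 P : (0 <= (test_fun k c e P)%:E)%E.
  by rewrite lee_fin; have /andP[] := test_fun_itv P hk hc he.
rewrite (ge0_integral_density mtr tr0 hm met t0).
under [RHS]eq_integral do rewrite -EFinM.
rewrite (transported_test tT cr r0 hk hc he).
have := ge0_integral_pushforward mX m0 measurableT met (fun P _ => t0 P).
rewrite preimage_setT => h; rewrite [LHS]h.
rewrite (ge0_integral_density mr r0 hm0).
- by [].
- exact: measurableT_comp met mX.
- by move=> P; exact: t0.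
Qed.

End transport.

(** * Averages over a population *)

Section bounded_integrals.
Context {R : realType} d {S : measurableType d} (m : {measure set S -> \bar R}).
Hypothesis m1 : m setT = 1%E.
Implicit Types f g : S -> R.

Lemma bounded_integrable f (B : R) : measurable_fun setT f ->
  (forall x, `|f x| <= B) -> m.-integrable setT (EFin \o f).
Proof.
move=> mf fB; apply/integrableP; split; first exact/measurable_EFinP.
apply: (@le_lt_trans _ _ (\int[m]_x B%:E)%E); last first.
  by rewrite integral_cst // m1 mule1 ltry.
apply: ge0_le_integral => //.
- by apply/measurable_EFinP; apply: measurableT_comp => //.
- by move=> x _; rewrite lee_fin (le_trans _ (fB x)).
Qed.

Lemma Rint_bound f (B : R) : measurable_fun setT f ->
  (forall x, `|f x| <= B) -> `|\int[m]_x f x| <= B.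
Proof.
move=> mf fB; have fi := bounded_integrable mf fB.
apply: le_trans (le_normr_Rintegral measurableT fi) _.
apply: (@le_trans _ _ (\int[m]_x B)); last by rewrite Rintegral_cst // m1 mulr1.
apply: le_Rintegral => //.
- apply: (@bounded_integrable _ B); first exact: measurableT_comp.
  by move=> x; rewrite normr_id.
- apply: (@bounded_integrable _ `|B|) => //; exact: measurable_cst.
Qed.

Lemma Rint_sub f g (B C : R) : measurable_fun setT f -> measurable_fun setT g ->
  (forall x, `|f x| <= B) -> (forall x, `|g x| <= C) ->
  \int[m]_x f x - \int[m]_x g x = \int[m]_x (f x - g x).
Proof.
move=> mf mg fB gC; rewrite RintegralB //.
- exact: bounded_integrable mf fB.
- exact: bounded_integrable mg gC.
Qed.

Lemma Rint_dist f g (B C D : R) : measurable_fun setT f -> measurable_fun setT g ->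
  (forall x, `|f x| <= B) -> (forall x, `|g x| <= C) ->
  (forall x, `|f x - g x| <= D) -> `|\int[m]_x f x - \int[m]_x g x| <= D.
Proof.
move=> mf mg fB gC fgD; rewrite (Rint_sub mf mg fB gC); apply: Rint_bound => //.
exact: measurable_funB.
Qed.

Lemma continuous_Rint (f : R -> S -> R) (B : R) :
  (forall t, measurable_fun setT (f t)) -> (forall t x, `|f t x| <= B) ->
  (forall x, continuous (f ^~ x)) -> continuous (fun t => \int[m]_x f t x).
Proof.
move=> mf fB cf t.
apply: (@continuity_under_integral R _ S m f setT measurableT (t - 1) (t + 1) _ _ (fun=> B)).
- by move=> s _; exact: bounded_integrable (mf s) (fB s).
- by apply: aeW => x _ s _; exact: cf.
- by apply: (@bounded_integrable _ `|B|) => //; exact: measurable_cst.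
- by move=> s _; apply: aeW => x _; exact: fB.
- by rewrite inE /= in_itv /=; apply/andP; split; lra.
Qed.

End bounded_integrals.

Section uniform_limit.
Context {R : realType}.

Lemma continuous_uniform_limit (f : R -> R) :
  (forall e : R, 0 < e -> exists g : R -> R, continuous g /\
     forall t, `|g t - f t| <= e) -> continuous f.
Proof.
move=> hf t; apply/cvgrPdist_le => e e0.
have [g [cg hg]] := hf (e / 3) (divr_gt0 e0 (ltr0n _ 3)).
near=> s.
have h1 := hg s; have h2 := hg t.
have h3 : `|g t - g s| <= e / 3.
  by near: s; have /cvgrPdist_le := cg t; apply; rewrite divr_gt0.
by move: h1 h2 h3; rewrite !ler_norml => /andP[? ?] /andP[? ?] /andP[? ?]; apply/andP; split; lra.
Unshelve. all: by end_near. Qed.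

End uniform_limit.

Section coupling.
Context {R : realType}.
Notation R3 := (R * R * R)%type.

(** The bounds are stated on the whole plane, for W composed with the truncation of
the sites to the unit interval. *)
Definition is_coupling (M L : R) (w : R -> R -> R) : Prop :=
  [/\ 0 <= M, 0 <= L, forall x y, `|w x y| <= M,
     forall x x' y, `|w x y - w x' y| <= L * `|x - x'| &
     forall x y y', `|w x y - w x y'| <= L * `|y - y'|].

Lemma coupling_exists (W : R * R -> R) :
  [lipschitz W z | z in `[0, 1] `*` `[0, 1]] ->
  exists M L, is_coupling M L (fun x y => W (clamp x, clamp y)).
Proof.
move=> [L0 [_ hL]].
pose L := `|L0| + 1.
have {}hL u v : (`[0, 1] `*` `[0, 1])%classic u -> (`[0, 1] `*` `[0, 1])%classic v ->
    `|W u - W v| <= L * `|u - v|.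
  move=> hu hv; have L0L : L0 < L by rewrite /L (le_lt_trans (ler_norm _)) // ltrDl.
  by have := hL L L0L (u, v) (conj hu hv).
have L1 : 0 <= L by rewrite addr_ge0.
have box x y : (`[0, 1] `*` `[0, 1])%classic (clamp x : R, clamp y : R).
  by split; rewrite /= in_itv /= clamp_itv.
have norm2 (x y : R) : `|(x, y)| = Num.max `|x| `|y| by [].
have c01 (x : R) : `|clamp x| <= 1.
  by have /andP[h0 h1] := clamp_itv x; rewrite ger0_norm.
exists (`|W (0, 0)| + L), L; split => //.
- by rewrite addr_ge0.
- move=> x y; have := hL _ _ (box x y) (box 0 0).
  have -> : clamp 0 = 0 :> R by rewrite clamp_id // lexx ler01.
  move=> h; have := ler_normD (W (clamp x, clamp y) - W (0, 0)) (W (0, 0)).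
  rewrite subrK => /le_trans; apply; rewrite addrC lerD2l; apply: le_trans h _.
  rewrite -[leRHS]mulr1 ler_wpM2l //.
  have -> : (clamp x, clamp y) - (0, 0) = (clamp x - 0, clamp y - 0) :> R * R by [].
  by rewrite !subr0 norm2 ge_max !c01.
- move=> x x' y; apply: le_trans (hL _ _ (box x y) (box x' y)) _.
  have -> : (clamp x, clamp y) - (clamp x', clamp y) =
    (clamp x - clamp x', clamp y - clamp y) :> R * R by [].
  by rewrite ler_wpM2l // norm2 subrr normr0 ge_max clamp_le /=.
- move=> x y y'; apply: le_trans (hL _ _ (box x y) (box x y')) _.
  have -> : (clamp x, clamp y) - (clamp x, clamp y') =
    (clamp x - clamp x, clamp y - clamp y') :> R * R by [].
  by rewrite ler_wpM2l // norm2 subrr normr0 ge_max clamp_le andbT.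
Qed.

Variables (K Mw Lw : R) (w : R -> R -> R).
Hypothesis hw : is_coupling Mw Lw w.

Let Mw0 : 0 <= Mw. Proof. by case: hw. Qed.
Let Lw0 : 0 <= Lw. Proof. by case: hw. Qed.

Lemma coupling_measurable x : measurable_fun setT (fun Q : G R => w x (site Q)).
Proof.
apply: continuous_measurableG; apply: (@lipG_continuous _ _ Lw) => P Q.
have [_ _ _ _ h] := hw; apply: le_trans (h _ _ _) _.
by rewrite ler_wpM2l //; have [] := dG_bounds P Q.
Qed.

Section field.
Variables (m : {measure set (G R) -> \bar R}) (U : R -> G R -> R).
Hypotheses (m1 : m setT = 1%E).
Hypothesis mU : forall t, measurable_fun setT (U t).

(** The Kuramoto order parameters for h = cos and h = sin, weighted by the coupling
with the site x. *)
Definition order_param (h : R -> R) (t x : R) : R :=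
  K * \int[m]_Q (w x (site Q) * h (U t Q)).

Let mint (h : R -> R) t x : continuous h ->
  measurable_fun setT (fun Q : G R => w x (site Q) * h (U t Q) : R).
Proof.
move=> ch; apply: measurable_funM; first exact: coupling_measurable.
by apply: (measurableT_comp (f := h)); [exact: continuous_measurable_fun|exact: mU].
Qed.

Let bint (h : R -> R) t x Q : (forall s, `|h s| <= 1) -> `|w x (site Q) * h (U t Q)| <= Mw.
Proof.
move=> h1; have [_ _ b _ _] := hw.
by rewrite normrM -[leRHS]mulr1 ler_pM.
Qed.

Lemma order_param_bound (h : R -> R) t x : continuous h -> (forall s, `|h s| <= 1) ->
  `|order_param h t x| <= `|K| * Mw.
Proof.
move=> ch h1; rewrite normrM ler_wpM2l //; apply: Rint_bound => //.
  exact: mint.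
by move=> Q; exact: bint.
Qed.

Lemma order_param_lip (h : R -> R) t x y : continuous h -> (forall s, `|h s| <= 1) ->
  `|order_param h t x - order_param h t y| <= `|K| * Lw * `|x - y|.
Proof.
move=> ch h1; rewrite -mulrBr normrM -mulrA ler_wpM2l //.
apply: (Rint_dist m1 (mint t x ch) (mint t y ch) (fun Q => bint t x Q h1) (fun Q => bint t y Q h1)) => Q.
have [_ _ _ l _] := hw.
by rewrite -mulrBl normrM -[leRHS]mulr1 ler_pM.
Qed.

Lemma order_param_amplitude (h : R -> R) : continuous h -> (forall s, `|h s| <= 1) ->
  (forall Q, continuous (U ^~ Q)) ->
  amplitude (`|K| * Mw) (`|K| * Lw) (order_param h).
Proof.
move=> ch h1 cU; split.
- by move=> t x; exact: order_param_bound.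
- by move=> t x y; exact: order_param_lip.
- move=> x; apply: continuous_mul; first exact: continuous_const.
  apply: (continuous_Rint m1 (fun t => mint t x ch) (fun t Q => bint t x Q h1)) => Q.
  apply: continuous_mul; first exact: continuous_const.
  exact: (continuous_after (h := h) (cU Q)).
Qed.

(** The addition formula of the sine separates the own phase from those of the
population. *)
Lemma order_param_wave t th x :
  wave (order_param (@cos R)) (order_param (@sin R)) t th x =
  K * \int[m]_Q (w x (site Q) * sin (U t Q - th)).
Proof.
have c1 s : `|cos s| <= 1 :> R by rewrite ler_norml cos_geN1 cos_le1.
have s1 s : `|sin s| <= 1 :> R by rewrite ler_norml sin_geN1 sin_le1.
rewrite /wave /order_param -!mulrA -mulrBr; congr (K * _).
have ic := bounded_integrable m1 (mint t x (@continuous_cos R)) (fun Q => bint t x Q c1).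
have is_ := bounded_integrable m1 (mint t x (@continuous_sin R)) (fun Q => bint t x Q s1).
rewrite -!RintegralZr // -RintegralB //.
- by apply: eq_Rintegral => Q _; rewrite sinB; ring.
- have := integrableZr measurableT (cos th) is_; apply: eq_integrable => // Q _.
- have := integrableZr measurableT (sin th) ic; apply: eq_integrable => // Q _.
Qed.

End field.

End coupling.

(** * The mean-field equation *)

Section mean_field.
Context {R : realType}.
Notation R3 := (R * R * R)%type.
Implicit Types (p q : R3) (u v : R3 -> R).

(** The lift minus the phase is periodic and descends to a continuous function on
G, and the phase is measurable. *)
Lemma shift_measurable (y : R3 -> R) (k : R) : 0 <= k -> shift_periodic y ->
  (forall p q, `|y p - y q| <= k * dist1 p q) ->
  measurable_fun setT (fun Q : G R => y (coords Q)).
Proof.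
move=> k0 py hy; pose f p := y p - p.1.1.
have cf : continuous (fun Q : G R => f (coords Q)).
  apply: (@lipG_continuous _ _ (3 * (k + 1))) => P Q.
  apply: (@lipschitz_descent _ f).
  - by rewrite addr_ge0.
  - by move=> th om x; rewrite /f /= py; ring.
  - move=> p q; rewrite /f mulrDl mul1r.
    have -> : y p - p.1.1 - (y q - q.1.1) = (y p - y q) - (p.1.1 - q.1.1) by ring.
    apply: le_trans (ler_normB _ _) _; apply: lerD; first exact: hy.
    by rewrite /dist1 -addrA lerDl addr_ge0.
have -> : (fun Q : G R => y (coords Q)) = (fun Q => f (coords Q) + phase Q).
  by apply/funext => Q; rewrite /f subrK.
apply: measurable_funD; first exact: continuous_measurableG.
exact: measurable_phase.
Qed.

Variables (K Mw Lw : R) (w : R -> R -> R) (m : {measure set (G R) -> \bar R}).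
Hypotheses (hw : is_coupling Mw Lw w) (m1 : m setT = 1%E).

Let Mw0 : 0 <= Mw. Proof. by case: hw. Qed.
Let Lw0 : 0 <= Lw. Proof. by case: hw. Qed.

(** The force on the oscillator p, when the oscillators Q of the population have
moved to the phases u (coords Q). *)
Definition drift (u : R3 -> R) (p : R3) : R :=
  K * \int[m]_Q (w p.2 (site Q) * sin (u (coords Q) - u p)).

Let kernel_measurable u p : measurable_fun setT (fun Q : G R => u (coords Q)) ->
  measurable_fun setT (fun Q : G R => w p.2 (site Q) * sin (u (coords Q) - u p)).
Proof.
move=> mu; apply: measurable_funM; first exact: (coupling_measurable hw).
apply: (measurableT_comp (f := @sin R)).
  by apply: continuous_measurable_fun; exact: continuous_sin.
by apply: measurable_funB => //; exact: measurable_cst.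
Qed.

Let kernel_bound (x y s : R) : `|w x y * sin s| <= Mw.
Proof.
have [_ _ b _ _] := hw; rewrite normrM -[leRHS]mulr1 ler_pM //.
by rewrite ler_norml sin_geN1 sin_le1.
Qed.

Lemma drift_bound u p : measurable_fun setT (fun Q : G R => u (coords Q)) ->
  `|drift u p| <= `|K| * Mw.
Proof.
move=> mu; rewrite normrM ler_wpM2l //; apply: Rint_bound => //.
exact: kernel_measurable.
Qed.

(** The force depends on the own phase and on the phases of the population, in both
cases with the Lipschitz constant |K| Mw. *)
Lemma drift_dist u v p q (D : R) :
  measurable_fun setT (fun Q : G R => u (coords Q)) ->
  measurable_fun setT (fun Q : G R => v (coords Q)) ->
  (forall Q : G R, `|u (coords Q) - v (coords Q)| <= D) ->
  `|drift u p - drift v q| <=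
  `|K| * (Lw * `|p.2 - q.2| + Mw * (D + `|u p - v q|)).
Proof.
move=> mu mv uv; rewrite -mulrBr normrM ler_wpM2l //.
apply: (Rint_dist m1 (kernel_measurable p mu) (kernel_measurable q mv)
  (fun Q => kernel_bound _ _ _) (fun Q => kernel_bound _ _ _)) => Q.
set s := u _ - u p; set r := v _ - v q.
have [_ _ b l _] := hw.
have -> : w p.2 (site Q) * sin s - w q.2 (site Q) * sin r =
  (w p.2 (site Q) - w q.2 (site Q)) * sin s + w q.2 (site Q) * (sin s - sin r) by ring.
apply: le_trans (ler_normD _ _) _; rewrite !normrM; apply: lerD.
  rewrite -[leRHS]mulr1 ler_pM //.
  by rewrite ler_norml sin_geN1 sin_le1.
apply: ler_pM => //; apply: le_trans (sin_lip _ _) _.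
have -> : s - r = (u (coords Q) - v (coords Q)) - (u p - v q) by rewrite /s /r; ring.
by apply: le_trans (ler_normB _ _) _; rewrite lerD2r.
Qed.

Lemma drift_shift u th om x : shift_periodic u ->
  drift u (th + 2 * pi, om, x) = drift u (th, om, x).
Proof.
move=> pu; rewrite /drift /= pu; congr (_ * _); apply: eq_Rintegral => Q _.
by rewrite -(sin_periodic2pi (u (coords Q) - _)); congr (_ * sin _); ring.
Qed.

Lemma drift_continuous (u : R -> R3 -> R) p :
  (forall t, measurable_fun setT (fun Q : G R => u t (coords Q))) ->
  (forall q, continuous (u ^~ q)) -> continuous (fun t => drift (u t) p).
Proof.
move=> mu cu; apply: continuous_mul; first exact: continuous_const.
apply: (continuous_Rint m1 (f := fun t Q => w p.2 (site Q) * sin (u t (coords Q) - u t p))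
  (B := Mw)).
- by move=> t; exact: kernel_measurable.
- by move=> t Q; exact: kernel_bound.
- move=> Q; apply: continuous_mul; first exact: continuous_const.
  apply: (continuous_after (f := fun t => u t (coords Q) - u t p) _ (@continuous_sin R)).
  exact: continuous_sub.
Qed.

(** The population starts with the law m and each oscillator feels all of it, so
the equations for the points p are coupled through the integral in drift. *)
Definition is_mean_field (T : R) (u : R -> R3 -> R) : Prop :=
  [/\ forall p, u 0 p = p.1.1,
      forall (t : R) p, is_derive t 1 (u ^~ p) (p.1.2 + drift (u (cut T t)) p) &
      forall t, 0 <= t <= T -> measurable_fun setT (fun Q : G R => u t (coords Q))].

(** The rate at which distances of initial data may grow: a Lipschitz bound that
grows with this rate is reproduced by one integration of the equation. *)
Definition mean_field_rate : R := 1 + `|K| * (Mw + Lw).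

Let rate0 : 0 <= mean_field_rate.
Proof. by rewrite /mean_field_rate addr_ge0 // mulr_ge0 // addr_ge0. Qed.

Let regular (T : R) (u : R -> R3 -> R) :=
  [/\ forall p, continuous (fun t => u (cut T t) p),
    forall t, 0 <= t <= T -> forall p q,
      `|u t p - u t q| <= expR (mean_field_rate * t) * dist1 p q &
    forall t, 0 <= t <= T -> shift_periodic (u t)].

Let regular_measurable T (u : R -> R3 -> R) t : regular T u -> 0 <= t <= T ->
  measurable_fun setT (fun Q : G R => u t (coords Q)).
Proof.
move=> [_ lu pu] tT; apply: (@shift_measurable _ (expR (mean_field_rate * t))).
- exact: expR_ge0.
- exact: pu.
- exact: lu.
Qed.

(** The iteration takes place among shift periodic maps that are Lipschitz in the
initial data; this makes the integral over the population meaningful at every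
step. *)
Lemma mean_field_exists (T : R) : 0 <= T ->
  exists u : R -> R3 -> R, is_mean_field T u.
Proof.
move=> T0; set B := mean_field_rate.
have M20 : 0 <= 2 * `|K| * Mw by rewrite !mulr_ge0.
have KM0 : 0 <= `|K| * Mw by rewrite mulr_ge0.
have [||||||u [ru u0 du]] := @picard R R3 T (2 * `|K| * Mw) (`|K| * Mw)
    (fun p => p.1.1) (fun p => p.1.2) (fun _ u p => p.1.2 + drift u p) (regular T) T0 M20 KM0.
- split.
  + move=> p; apply: continuous_add; first exact: continuous_const.
    by apply: continuous_mul; [exact: continuous_const|exact: continuous_cut].
  + move=> t /andP[t0 tT] p q.
    have h1 : 1 + t <= expR (B * t).
      apply: le_trans (expR_ge1Dx _); rewrite lerD2l ler_peMl //.
      by rewrite /B /mean_field_rate lerDl mulr_ge0 // addr_ge0.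
    apply: (@le_trans _ _ ((1 + t) * dist1 p q)); last by rewrite ler_wpM2r // dist1_ge0.
    have -> : p.1.1 + p.1.2 * t - (q.1.1 + q.1.2 * t) =
      (p.1.1 - q.1.1) + (p.1.2 - q.1.2) * t by ring.
    apply: le_trans (ler_normD _ _) _; rewrite [leRHS]mulrDl mul1r (normrM _ t) (ger0_norm t0).
    apply: lerD; first by rewrite /dist1 -addrA lerDl addr_ge0.
    rewrite mulrC ler_wpM2l // /dist1.
    by rewrite addrAC lerDr addr_ge0.
  + by move=> t tT th om x /=; ring.
- move=> u v ru v0 dv; have [cu lu pu] := ru.
  have mu t : measurable_fun setT (fun Q : G R => u (cut T t) (coords Q)).
    by apply: (regular_measurable ru); exact: cut_itv.
  split.
  + move=> p t; apply: (continuous_comp (f := cut T) (g := v ^~ p)).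
      exact: continuous_cut.
    exact: is_derive_continuous (dv _ p).
  + move=> t /andP[t0 tT] p q.
    have d (s : R) : is_derive s 1 (fun s : R => v s p - v s q)
        (p.1.2 + drift (u (cut T s)) p - (q.1.2 + drift (u (cut T s)) q)).
      exact: is_derive_sub (dv s p) (dv s q).
    have e (s : R) : is_derive s 1 (fun s : R => expR (B * s) * dist1 p q)
        (B * expR (B * s) * dist1 p q).
      have := is_derive_scale (dist1 p q) (is_derive_expRM B s).
      rewrite mulrC.
      have -> // : (fun s : R => dist1 p q * expR (B * s)) = (fun s : R => expR (B * s) * dist1 p q).
      by apply/funext => r; rewrite mulrC.
    have := @ler_variation R (fun s => v s p - v s q) (fun s => expR (B * s) * dist1 p q) _ _ 0 t t0.
    move=> /(_ _ _ _ _ (fun s _ => d s) (fun s _ => e s)) h.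
    have {}h : `|v t p - v t q - (v 0 p - v 0 q)| <=
       expR (B * t) * dist1 p q - expR (B * 0) * dist1 p q.
      apply: h.
      * by apply: within_itv_continuous => s; exact: is_derive_continuous (d s).
      * by apply: within_itv_continuous => s; exact: is_derive_continuous (e s).
      * move=> s /andP[s0 st]; have sT : 0 <= s <= T.
          by rewrite (ltW s0) (le_trans (ltW st)).
        rewrite cut_id //.
        have ms := regular_measurable ru sT.
        have -> : p.1.2 + drift (u s) p - (q.1.2 + drift (u s) q) =
          (p.1.2 - q.1.2) + (drift (u s) p - drift (u s) q) by ring.
        apply: le_trans (ler_normD _ _) _.
        have := @drift_dist (u s) (u s) p q 0 ms ms.
        have E1 : 1 <= expR (B * s) by rewrite -expR0 ler_expR mulr_ge0 // ltW.
        have d0 := dist1_ge0 p q.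
        have p2 : `|p.1.2 - q.1.2| <= dist1 p q by rewrite /dist1 addrAC lerDr addr_ge0.
        have p3 : `|p.2 - q.2| <= dist1 p q by rewrite /dist1 lerDr addr_ge0.
        have dE : dist1 p q <= expR (B * s) * dist1 p q by rewrite ler_peMl.
        move=> /(_ _) h3.
        have {h3} h3 : `|drift (u s) p - drift (u s) q| <=
            `|K| * (Lw * (expR (B * s) * dist1 p q) + Mw * (expR (B * s) * dist1 p q)).
          apply: le_trans (h3 _) _; first by move=> Q; rewrite subrr normr0.
          rewrite ler_wpM2l // add0r; apply: lerD; rewrite ler_wpM2l //.
            exact: le_trans dE.
          by apply: lu.
        rewrite /B /mean_field_rate -/B; apply: le_trans (lerD (le_trans p2 dE) h3) _.
        by rewrite le_eqVlt; apply/orP; left; apply/eqP; ring.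
    move: h; rewrite !v0 mulr0 expR0 mul1r => h.
    have e1 : v t p - v t q = (v t p - v t q - (p.1.1 - q.1.1)) + (p.1.1 - q.1.1) by ring.
    rewrite e1; apply: le_trans (ler_normD _ _) _.
    have : `|p.1.1 - q.1.1| <= dist1 p q by rewrite /dist1 -addrA lerDl addr_ge0.
    by move: h; set z := `| _ - (_ - _) |; move=> *; lra.
  + move=> t tT th om x.
    have := @is_derive_unique R (v ^~ (th + 2 * pi, om, x)) (fun t => v t (th, om, x) + 2 * pi)
       (fun t => om + drift (u (cut T t)) (th, om, x)) 0.
    move=> /(_ _ _ _) h; have := f_equal (fun f => f t) (h _ _ _) => /=; apply.
    * by rewrite !v0.
    * move=> s; have := dv s (th + 2 * pi, om, x); rewrite drift_shift //.
      by apply: pu; exact: cut_itv.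
    * move=> s; have := is_derive_add (dv s (th, om, x)) (is_derive_const (2 * pi) s).
      by rewrite addr0.
- move=> z u hz hzu.
  have cl t p : 0 <= t <= T -> forall e : R, 0 < e -> exists n, forall s q, 0 <= s <= T -> `|z n s q - u s q| <= e.
    by move=> _ e e0; exact: hzu.
  split.
  + move=> p; apply: continuous_uniform_limit => e e0; have [n hn] := hzu e e0.
    exists (fun t => z n (cut T t) p); split; first by have [] := hz n.
    by move=> t; apply: hn; exact: cut_itv.
  + move=> t tT p q; apply/ler_addgt0Pr => e e0.
    have [n hn] := hzu (e / 2) (divr_gt0 e0 (ltr0n _ 2)).
    have [_ /(_ t tT p q) l _] := hz n.
    have h1 := hn t p tT; have h2 := hn t q tT.
    move: l h1 h2; rewrite !ler_norml => /andP[? ?] /andP[? ?] /andP[? ?]; apply/andP; split; lra.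
  + move=> t tT th om x; apply/eqP; rewrite -subr_eq0 -normr_le0.
    apply/ler_addgt0Pr => e e0; rewrite add0r.
    have [n hn] := hzu (e / 2) (divr_gt0 e0 (ltr0n _ 2)).
    have [_ _ /(_ t tT th om x) l] := hz n.
    have h1 := hn t (th + 2 * pi, om, x) tT; have h2 := hn t (th, om, x) tT.
    move: h1 h2; rewrite l !ler_norml => /andP[? ?] /andP[? ?]; apply/andP; split; lra.
- move=> u ru p; apply: continuous_add; first exact: continuous_const.
  apply: drift_continuous; first by move=> t; apply: (regular_measurable ru); exact: cut_itv.
  by have [] := ru.
- move=> u t p ru tT; rewrite addrC addKr; apply: drift_bound.
  exact: regular_measurable ru tT.
- move=> u v t D ru rv tT huv p.
  have -> : p.1.2 + drift (u t) p - (p.1.2 + drift (v t) p) = drift (u t) p - drift (v t) p by ring.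
  apply: le_trans (drift_dist p p (regular_measurable ru tT) (regular_measurable rv tT) (D := D) _) _.
    by move=> Q; exact: huv.
  rewrite subrr normr0 mulr0 add0r -!mulrA (mulrCA 2) ler_wpM2l // mulrCA ler_wpM2l //.
  by rewrite mulr_natl mulr2n lerD2l.
- exists u; split => // t; exact: regular_measurable ru.
Qed.

(** Gronwall for the family of all initial points, whose deviations are bounded
because the force is. *)
Lemma mean_field_unique (T : R) (u v : R -> R3 -> R) :
  0 <= T -> is_mean_field T u -> is_mean_field T v ->
  forall t p, 0 <= t <= T -> u t p = v t p.
Proof.
move=> T0 [u0 du mu] [v0 dv mv] t p tT.
have M20 : 0 <= 2 * `|K| * Mw by rewrite !mulr_ge0.
have B (z : R -> R3 -> R) : is_mean_field T z -> forall q s, 0 <= s <= T ->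
    `|z s q - (q.1.1 + q.1.2 * s)| <= `|K| * Mw * T.
  move=> [z0 dz mz] q s /andP[s0 sT].
  have d (r : R) : is_derive r 1 (fun r : R => z r q - (q.1.1 + q.1.2 * r))
      (drift (z (cut T r)) q).
    have := is_derive_sub (dz r q) (is_derive_affine q.1.1 q.1.2 r).
    by rewrite addrAC subrr add0r.
  have := @derive_lipschitz R _ _ (`|K| * Mw) d _ s 0.
  rewrite z0 mulr0 addr0 subrr !subr0 (ger0_norm s0) => h.
  apply: le_trans (h _) _.
    by move=> r; apply: drift_bound; apply: mz; exact: cut_itv.
  by rewrite ler_wpM2l // mulr_ge0.
have := @gronwall R R3 (fun q s => u s q - v s q)
  (fun q s => drift (u s) q - drift (v s) q) T (2 * `|K| * Mw) 0 0 (2 * (`|K| * Mw * T)) M20 (lexx 0).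
move=> /(_ _ _ _ _ _ p t tT); rewrite mul0r addr0 mulr0 mul0r => h.
apply/eqP; rewrite -subr_eq0 -normr_le0; apply: h.
- move=> q; apply: within_itv_continuous => s.
  exact: is_derive_continuous (is_derive_sub (du s q) (dv s q)).
- move=> q s /andP[s0 sT]; have := is_derive_sub (du s q) (dv s q).
  by rewrite cut_id ?(ltW s0) ?(ltW sT) // opprD addrACA subrr add0r.
- by move=> q; rewrite u0 v0 subrr normr0.
- move=> q s sT.
  have hu := B u (And3 u0 du mu) q s sT; have hv := B v (And3 v0 dv mv) q s sT.
  have -> : u s q - v s q = (u s q - (q.1.1 + q.1.2 * s)) - (v s q - (q.1.1 + q.1.2 * s)) by ring.
  by apply: le_trans (ler_normB _ _) _; rewrite mulr_natl mulr2n lerD.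
- move=> s E /andP[s0 sT] hE q.
  have {}sT : 0 <= s <= T by rewrite (ltW s0) (ltW sT).
  apply: le_trans (drift_dist q q (mu s sT) (mv s sT) (D := E) _) _ => //.
  rewrite subrr normr0 mulr0 add0r addr0 -!mulrA (mulrCA 2) ler_wpM2l // mulrCA ler_wpM2l //.
  by rewrite mulr_natl mulr2n lerD2l.
Qed.

(** The coupling term is a single harmonic in the phase, whose amplitudes are
the order parameters of the population. *)
Lemma mean_field_flow (T : R) (u : R -> R3 -> R) : 0 <= T -> is_mean_field T u ->
  let A := order_param K w m (fun t Q => u (cut T t) (coords Q)) in
  [/\ amplitude (`|K| * Mw) (`|K| * Lw) (A (@cos R)),
      amplitude (`|K| * Mw) (`|K| * Lw) (A (@sin R)),
      is_flow T (A (@cos R)) (A (@sin R)) u &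
      forall t th x, 0 <= t <= T -> wave (A (@cos R)) (A (@sin R)) t th x =
        K * \int[m]_Q (w x (site Q) * sin (u t (coords Q) - th))].
Proof.
move=> T0 [u0 du mu] A.
have c1 s : `|cos s| <= 1 :> R by rewrite ler_norml cos_geN1 cos_le1.
have s1 s : `|sin s| <= 1 :> R by rewrite ler_norml sin_geN1 sin_le1.
have mU t : measurable_fun setT (fun Q : G R => u (cut T t) (coords Q)).
  by apply: mu; exact: cut_itv.
have cU (Q : G R) : continuous (fun t => u (cut T t) (coords Q)).
  move=> t; apply: (continuous_comp (f := cut T) (g := u ^~ (coords Q))).
    exact: continuous_cut.
  exact: is_derive_continuous (du _ _).
have wv t th x : 0 <= t <= T -> wave (A (@cos R)) (A (@sin R)) t th x =
    K * \int[m]_Q (w x (site Q) * sin (u t (coords Q) - th)).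
  by move=> tT; rewrite (order_param_wave K hw m1 mU) cut_id.
split => //.
- exact: (order_param_amplitude K hw m1 mU (@continuous_cos R) c1 cU).
- exact: (order_param_amplitude K hw m1 mU (@continuous_sin R) s1 cU).
- move=> p; split => // t; have := du t p.
  by rewrite wv //; exact: cut_itv.
Qed.

End mean_field.

(** * Test functions along curves of phases *)

Section strip.
Context {R : realType}.
Implicit Types (f : R * G R -> R) (P Q : G R).

Definition strip (T : R) : set (R * G R) := `[0, T[%classic `*` setT.

Lemma stripE (T t : R) P : strip T (t, P) = (0 <= t < T) :> Prop.
Proof.
apply/propext; rewrite /strip /setX /= in_itv /=; split=> [[]|] //.
Qed.

(** Test functions are continuous relative to [0, T) x G only; the distances in this
form refer to the full space. *)
Lemma strip_continuousP (T : R) f : {within strip T, continuous f} <->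
  forall (t : R) P, 0 <= t < T -> forall e : R, 0 < e ->
    exists2 d : R, 0 < d & forall (s : R) Q, 0 <= s < T -> `|s - t| < d -> dG P Q < d ->
      `|f (s, Q) - f (t, P)| <= e.
Proof.
split=> [/subspace_continuousP h t P tT e e0|h].
  have := h (t, P); rewrite stripE => /(_ tT) /cvgrPdist_le /(_ e e0).
  move=> -[[A B] /= [nA nB] AB].
  have /nbhs_ballP[d1 /= d10 hd1] := nA; have /nbhs_ballP[d2 /= d20 hd2] := nB.
  exists (Num.min d1 d2); first by rewrite lt_min d10.
  move=> s Q sT; rewrite lt_min => /andP[st _]; rewrite lt_min => /andP[_ PQ].
  rewrite distrC; apply: (AB (s, Q)); last by rewrite stripE.
  split => /=; first by apply: hd1; rewrite /ball /= distrC.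
  by apply: hd2; rewrite ballEmdist.
apply/subspace_continuousP => -[t P]; rewrite stripE => tT.
apply/cvgrPdist_le => e e0; have [d d0 hd] := h t P tT e e0.
exists (ball t d, ball P d) => /=.
  by split; exact: nbhsx_ballx.
move=> [s Q] [/= h1 h2]; rewrite stripE => sT; rewrite distrC.
apply: hd => //; by move: h1; rewrite /ball /= distrC.
Qed.

Lemma strip_after (X : topologicalType) (T : R) f (tau : X -> R) (c : X -> G R) :
  {within strip T, continuous f} -> continuous tau -> (forall s, 0 <= tau s < T) ->
  continuous c -> continuous (fun s => f (tau s, c s)).
Proof.
move=> /strip_continuousP cf ct tT cc s; apply/cvgrPdist_le => e e0.
have [d d0 hd] := cf (tau s) (c s) (tT s) e e0.
have n1 : \forall z \near s, `|tau s - tau z| < d.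
  by have /cvgrPdist_lt := ct s; apply.
have n2 : \forall z \near s, ball (c s) d (c z).
  exact: (cc s _ (nbhsx_ballx (c s) d d0)).
near=> z; rewrite distrC; apply: hd => //.
  by rewrite distrC; near: z.
have : ball (c s) d (c z) by near: z.
by rewrite ballEmdist.
Unshelve. all: by end_near. Qed.

Lemma strip_slice (T : R) f t : {within strip T, continuous f} -> 0 <= t < T ->
  continuous (fun P => f (t, P)).
Proof.
move=> cf tT; apply: (strip_after (tau := fun=> t) (c := id) cf).
- exact: continuous_const.
- by [].
- by move=> P; exact: cvg_id.
Qed.

Lemma strip_hausdorff : hausdorff_space (R * G R)%type.
Proof.
rewrite ball_hausdorff => -[s P] [t Q] neq.
have [st|st] := eqVneq s t.
  have PQ : 0 < dG P Q.
    rewrite lt_neqAle eq_sym; apply/andP; split; last by rewrite /dG sqrtr_ge0.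
    by apply: contraNneq neq => /dG_eq0 ->; rewrite st.
  exists (PosNum (divr_gt0 PQ (ltr0n R 2)), PosNum (divr_gt0 PQ (ltr0n R 2))) => /=.
  apply/eqP/seteqP; split => // -[u S] [[_ /=]]; rewrite ballEmdist /= => h1 [_ /=].
  rewrite ballEmdist /= => h2; have := dG_triangle S P Q.
  by rewrite (dGC S); rewrite /mdist /= in h1 h2; lra.
have d0 : 0 < `|s - t| by rewrite normr_gt0 subr_eq0.
exists (PosNum (divr_gt0 d0 (ltr0n R 2)), PosNum (divr_gt0 d0 (ltr0n R 2))) => /=.
apply/eqP/seteqP; split => // -[u S] [[/= h1 _] [/= h2 _]].
move: h1 h2; rewrite /ball /= => h1 h2; have := ler_distD u s t.
by rewrite (distrC u); lra.
Qed.

End strip.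

Section test_functions.
Context {R : realType}.
Variables (T : R) (w wt wth : R * G R -> R).
Hypothesis hw : is_test_function T w wt wth.
Implicit Types (P Q : G R).

Let cw : {within strip T, continuous w}. Proof. exact: test_continuous hw. Qed.
Let cwt : {within strip T, continuous wt}. Proof. exact: test_dt_continuous hw. Qed.
Let cwth : {within strip T, continuous wth}. Proof. exact: test_dth_continuous hw. Qed.

Lemma mkG_unwrap (s r om x : R) : mkG (r - (s - Defs.wrap s)) om (clamp x) = mkG r om x.
Proof.
have hp : phase_periodic (fun p : R * R * R => mkG p.1.1 p.1.2 p.2).
  by move=> *; exact: mkG_periodic.
have -> : s - Defs.wrap s = 2 * pi * (Num.Def.floor (s / (2 * pi)))%:~R.
  by rewrite /Defs.wrap opprB addrC subrK.
have hc : mkG r om (clamp x) = mkG r om x.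
  by apply: val_inj; rewrite /= [in LHS]clamp_id ?clamp_itv.
case: (Num.Def.floor _) => n.
  by rewrite -[RHS]hc; exact: (phase_periodicN hp n r om (clamp x)).
rewrite NegzE mulrNz mulrN opprK -[RHS]hc.
exact: (phase_periodicP hp n.+1 r om (clamp x)).
Qed.

(** The derivative is given at the representatives in [0, 2 pi) and is carried to
all lifts by periodicity. *)
Lemma test_dth_lift (t s om x : R) : 0 <= t < T ->
  is_derive s 1 (fun s : R => w (t, mkG s om x)) (wth (t, mkG s om x)).
Proof.
move=> tT; have := test_dth hw (mkG s om x) tT.
rewrite phase_mkG freq_mkG site_mkG.
set c := s - Defs.wrap s; have -> : Defs.wrap s = s - c by rewrite /c opprB addrC subrK.
move=> h; have := @is_derive_compose R (fun r : R => w (t, mkG r om (clamp x)))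
  (fun r : R => r - c) s _ _ h (is_derive_sub (is_derive_ident s) (is_derive_const c s)).
rewrite subr0 mulr1.
have -> // : (fun s : R => w (t, mkG (s - c) om (clamp x))) = (fun s : R => w (t, mkG s om x)).
by apply/funext => r; rewrite /c mkG_unwrap.
Qed.

Lemma locally0_derive (f : R -> R) (t l d : R) : 0 < d ->
  (forall h, 0 <= h < d -> f (t + h) = 0) -> is_derive t 1 f l -> l = 0.
Proof.
move=> d0 f0 /is_deriveP hl; apply/eqP; rewrite -normr_le0.
apply/ler_addgt0Pr => e e0; rewrite add0r; have [d1 d10 h1] := hl e e0.
pose h := Num.min d d1 / 2.
have m0 : 0 < Num.min d d1 by rewrite lt_min d0.
have h0 : 0 < h by rewrite divr_gt0.
have hm : h < Num.min d d1 by rewrite /h; lra.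
move: (hm); rewrite lt_min => /andP[hd hd1].
have := h1 h; rewrite gtr0_norm // => /(_ hd1).
rewrite f0 ?(ltW h0) // -[X in f X]addr0 f0 ?lexx //.
by rewrite subrr add0r normrN normrM (gtr0_norm h0) ler_pM2r.
Qed.

Lemma compact_strip_bound (f : R * G R -> R) (C : set (R * G R)) :
  compact C -> C `<=` strip T -> {within strip T, continuous f} ->
  exists2 B : R, 0 <= B & forall z, C z -> `|f z| <= B.
Proof.
move=> cC CD /strip_continuousP cf.
have cn : {within strip T, continuous (fun z => `|f z|)}.
  apply/strip_continuousP => t P tT e e0; have [d d0 hd] := cf t P tT e e0.
  by exists d => // s Q sT h1 h2; apply: le_trans (ler_dist_dist _ _) _; exact: hd.
have [C0|/set0P C0] := eqVneq C set0.
  by exists 0 => // z; rewrite C0.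
have [z zC hz] := compact_EVT_max C0 cC (continuous_subspaceW CD cn).
by exists `|f z| => // y Cy; apply: hz; rewrite inE.
Qed.

(** Off the support all derivatives vanish, as the complement of a compact set
is open; on the support everything is bounded. *)
Lemma test_bounds : 0 < T -> exists T' B : R,
  [/\ 0 < T' < T,
     forall t P, T' <= t < T -> [/\ w (t, P) = 0, wt (t, P) = 0 & wth (t, P) = 0] &
     forall t P, 0 <= t < T -> [/\ `|w (t, P)| <= B, `|wt (t, P)| <= B,
        `|wth (t, P)| <= B & `|freq P * wth (t, P)| <= B]].
Proof.
move=> T0; have [C [cC CD C0]] := test_compact_support hw.
have oC : open (~` C) by apply: closed_openC; apply: (compact_closed (@strip_hausdorff R) cC).
have near_off t P : ~ C (t, P) -> exists2 d : R, 0 < d &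
    forall (s : R) Q, `|s - t| < d -> dG P Q < d -> ~ C (s, Q).
  move=> nC; have : nbhs (t, P) (~` C) by exact: open_nbhs_nbhs.
  move=> [[A B] /= [nA nB] AB].
  have /nbhs_ballP[d1 /= d10 hd1] := nA; have /nbhs_ballP[d2 /= d20 hd2] := nB.
  exists (Num.min d1 d2); first by rewrite lt_min d10.
  move=> s Q; rewrite lt_min => /andP[st _]; rewrite lt_min => /andP[_ PQ].
  apply: (AB (s, Q)); split => /=; first by apply: hd1; rewrite /ball /= distrC.
  by apply: hd2; rewrite ballEmdist.
have wth0 t P : 0 <= t < T -> ~ C (t, P) -> wth (t, P) = 0.
  move=> tT nC; have [d d0 hd] := near_off t P nC.
  apply: (locally0_derive d0 _ (test_dth hw P tT)) => h /andP[h0 h1].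
  apply: C0 => //; apply: hd; first by rewrite subrr normr0.
  rewrite -{1}(mkG_coords P); apply: le_lt_trans (dG_mkG_le _ _ _ _ _ _) _.
  by rewrite !subrr normr0 !addr0 opprD addNKr normrN ger0_norm.
have wt0_pos t P : 0 < t < T -> ~ C (t, P) -> wt (t, P) = 0.
  move=> /andP[t0 tT] nC; have [d d0 hd] := near_off t P nC.
  have m0 : 0 < Num.min d (T - t) by rewrite lt_min d0 subr_gt0.
  have tT' : 0 < t < T by rewrite t0.
  apply: (locally0_derive m0 _ (test_dt hw P tT')) => h /andP[h0].
  rewrite lt_min => /andP[h1 h2].
  apply: C0; first by rewrite addr_ge0 // ?(ltW t0) //=; lra.
  apply: hd; first by rewrite addrC addKr ger0_norm.
  by rewrite dGxx.
have wt0 t P : 0 <= t < T -> ~ C (t, P) -> wt (t, P) = 0.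
  move=> /andP[]; rewrite le_eqVlt => /predU1P[<-|t0] tT nC; last first.
    by apply: wt0_pos => //; rewrite t0.
  have [d d0 hd] := near_off 0 P nC.
  apply/eqP; rewrite -normr_le0; apply/ler_addgt0Pr => e e0; rewrite add0r.
  have T0' : 0 <= (0 : R) < T by rewrite lexx.
  have [d1 d10 hd1] := (strip_continuousP T wt).1 cwt 0 P T0' e e0.
  pose s := Num.min d (Num.min d1 T) / 2.
  have m0 : 0 < Num.min d (Num.min d1 T) by rewrite !lt_min d0 d10.
  have s0 : 0 < s by rewrite divr_gt0.
  have : s < Num.min d (Num.min d1 T) by rewrite /s; lra.
  rewrite !lt_min => /and3P[sd sd1 sT].
  have := hd1 s P; rewrite (ltW s0) sT subr0 (gtr0_norm s0) => /(_ isT sd1).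
  rewrite dGxx => /(_ d10).
  rewrite (wt0_pos s) ?s0 ?sub0r ?normrN // => hC.
  by apply: (hd s P) hC; rewrite ?subr0 ?gtr0_norm ?dGxx.
have [T1 [T10 T1T hT1]] : exists T1, [/\ 0 <= T1, T1 < T & forall z, C z -> z.1 <= T1].
  have [Ce|/set0P Cn] := eqVneq C set0; first by exists 0; split => // z; rewrite Ce.
  have [] := @compact_EVT_max _ R fst C Cn cC.
    by apply: continuous_subspaceT => z; exact: cvg_fst.
  move=> [t P]; rewrite inE => CtP h; have := CD _ CtP; rewrite -/(strip T) stripE => /andP[t0 tT].
  by exists t; split => // z Cz; apply: h; rewrite inE.
have cfw : {within strip T, continuous (fun z => freq z.2 * wth z)}.
  apply/strip_continuousP => t P tT e e0.
  pose f1 := `|freq P| + 1.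
  have f10 : 0 < f1 by rewrite ltr_wpDl.
  pose b1 := `|wth (t, P)| + 1.
  have b10 : 0 < b1 by rewrite ltr_wpDl.
  have [d d0 hd] := (strip_continuousP T wth).1 cwth t P tT (e / (2 * f1)) (divr_gt0 e0 (mulr_gt0 (ltr0n _ 2) f10)).
  exists (Num.min d (Num.min 1 (e / (2 * b1)))).
    by rewrite !lt_min d0 ltr01 divr_gt0 // mulr_gt0.
  move=> s Q sT; rewrite !lt_min => /and3P[st _ _] /and3P[PQ PQ1 PQ2] /=.
  have h := hd s Q sT st PQ.
  have [_ hf _] := dG_bounds Q P; rewrite dGC in hf.
  have -> : freq Q * wth (s, Q) - freq P * wth (t, P) =
    freq Q * (wth (s, Q) - wth (t, P)) + (freq Q - freq P) * wth (t, P) by ring.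
  apply: le_trans (ler_normD _ _) _; rewrite !normrM.
  have fQ : `|freq Q| <= f1.
    rewrite /f1 -[freq Q](subrK (freq P)); apply: le_trans (ler_normD _ _) _.
    by rewrite addrC lerD2l; apply: le_trans hf _; exact: ltW.
  have e1 : e = f1 * (e / (2 * f1)) + e / (2 * b1) * b1 by field; lra.
  rewrite [leRHS]e1; apply: lerD; apply: ler_pM => //.
    by apply: le_trans hf _; exact: ltW.
  by rewrite /b1 lerDl.
have [B1 B10 hB1] := compact_strip_bound cC CD cw.
have [B2 B20 hB2] := compact_strip_bound cC CD cwt.
have [B3 B30 hB3] := compact_strip_bound cC CD cwth.
have [B4 B40 hB4] := compact_strip_bound cC CD cfw.
exists ((T1 + T) / 2), (B1 + B2 + B3 + B4); split.
- by apply/andP; split; lra.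
- move=> t P /andP[tT1 tT].
  have tT' : 0 <= t < T by apply/andP; split => //; lra.
  have nC : ~ C (t, P) by move=> /hT1 /=; lra.
  by split; [exact: C0|exact: wt0|exact: wth0].
- move=> t P tT; have [Cz|nC] := pselect (C (t, P)).
    have := hB1 _ Cz; have := hB2 _ Cz; have := hB3 _ Cz; have := hB4 _ Cz => /= *.
    by split; lra.
  rewrite C0 // wt0 // wth0 // mulr0 normr0.
  by rewrite !addr_ge0.
Qed.

(** The derivative along a curve of phases; only separate derivatives are
given, so the increment is taken first in time, then in phase. *)
Lemma test_chain (c : R -> R) (t dc om x : R) : 0 < t < T -> is_derive t 1 c dc ->
  is_derive t 1 (fun s : R => w (s, mkG (c s) om x))
    (wt (t, mkG (c t) om x) + dc * wth (t, mkG (c t) om x)).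
Proof.
move=> /andP[t0 tT] hc; pose P s := mkG (c s) om x; rewrite -/(P t).
have tT' : 0 <= t < T by rewrite (ltW t0).
have hB : is_derive t 1 (fun s : R => w (t, P s)) (wth (t, P t) * dc).
  exact: (@is_derive_compose R (fun r : R => w (t, mkG r om x)) c t _ _
    (test_dth_lift (c t) om x tT') hc).
apply/is_deriveP => e e0.
have e2 : 0 < e / 2 by rewrite divr_gt0.
have [d1 d10 h1] := (is_deriveP _ _ _).1 hB _ e2.
have [d2 d20 h2] := (strip_continuousP T wt).1 cwt t (P t) tT' _ e2.
have /cvgrPdist_lt /(_ d2 d20) := is_derive_continuous hc.
move=> /nbhs_ballP[d3 /= d30 h3].
pose d := Num.min (Num.min d1 d2) (Num.min d3 (Num.min t (T - t))).
exists d; first by rewrite /d !lt_min d10 d20 d30 t0 subr_gt0.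
move=> h; rewrite /d !lt_min => /andP[/andP[hd1 hd2] /and3P[hd3 ht hTt]].
have PQ : dG (P t) (P (t + h)) < d2.
  apply: le_lt_trans (dG_mkG_le _ _ _ _ _ _) _; rewrite !subrr normr0 !addr0.
  by apply: h3; rewrite /ball /= opprD addNKr normrN.
have lin (a b : R) : a <= b -> `|a - t| < d2 -> `|b - t| < d2 -> 0 < a -> b < T ->
    `|w (b, P (t + h)) - wt (t, P t) * b - (w (a, P (t + h)) - wt (t, P t) * a)| <=
    e / 2 * b - e / 2 * a.
  move=> ab ha hb a0 bT.
  have dw s : a <= s <= b -> is_derive s 1 (fun s : R => w (s, P (t + h)) - wt (t, P t) * s)
      (wt (s, P (t + h)) - wt (t, P t)).
    move=> /andP[as_ sb]; have sT : 0 < s < T by rewrite (lt_le_trans a0) // (le_lt_trans sb).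
    have := is_derive_sub (test_dt hw (P (t + h)) sT) (is_derive_scale (wt (t, P t)) (is_derive_ident s)).
    by rewrite mulr1.
  have dl (s : R) : is_derive s 1 (fun s : R => e / 2 * s) (e / 2).
    by have := is_derive_scale (e / 2) (is_derive_ident s); rewrite mulr1.
  apply: (ler_variation ab _ _ (fun s hs => dw s _) (fun s _ => dl s)).
  - by apply: derivable_within_continuous => s; rewrite in_itv /= => /dw[].
  - by apply: within_itv_continuous => s; exact: is_derive_continuous (dl s).
  - by move=> s /andP[/ltW -> /ltW ->].
  - move=> s /andP[as_ sb]; apply: h2 => //.
      by rewrite (le_trans (ltW a0) (ltW as_)) (lt_trans sb).
    by move: ha hb; rewrite !ltr_norml => /andP[? ?] /andP[? ?]; apply/andP; split; lra.
have A : `|w (t + h, P (t + h)) - w (t, P (t + h)) - wt (t, P t) * h| <= e / 2 * `|h|.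
  have th0 : 0 < t + h by move: ht; rewrite ltr_norml => /andP[? ?]; lra.
  have thT : t + h < T by move: hTt; rewrite ltr_norml => /andP[? ?]; lra.
  have thd : `|t + h - t| < d2 by rewrite addrC addKr.
  have ttd : `|t - t| < d2 by rewrite subrr normr0.
  have [h0|h0] := leP 0 h.
    have := lin t (t + h) _ ttd thd t0 thT; rewrite lerDl (ger0_norm h0) => /(_ h0).
    by congr (`|_| <= _); ring.
  have := lin (t + h) t _ thd ttd th0 tT; rewrite gerDl (ltr0_norm h0) => /(_ (ltW h0)).
  by rewrite distrC; congr (`|_| <= _); ring.
have B := h1 h hd1.
have -> : w (t + h, P (t + h)) - w (t, P t) - (wt (t, P t) + dc * wth (t, P t)) * h =
  (w (t + h, P (t + h)) - w (t, P (t + h)) - wt (t, P t) * h) +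
  (w (t, P (t + h)) - w (t, P t) - wth (t, P t) * dc * h) by ring.
apply: le_trans (ler_normD _ _) _; apply: le_trans (lerD A B) _.
by rewrite -mulrDl -splitr.
Qed.

End test_functions.

(** * The weak equation along the flow *)

Section image.
Context {R : realType}.

Lemma image_probability (m : probability (G R) R) (f : G R -> G R) :
  measurable_fun setT f -> exists m' : probability (G R) R,
  (forall A, measurable A -> m' A = m (f @^-1` A)) /\
  forall (h : G R -> R) (B : R), measurable_fun setT h -> (forall P, `|h P| <= B) ->
    \int[m']_P h P = \int[m]_P h (f P).
Proof.
move=> mf.
pose X : {mfun G R >-> G R} := HB.pack f (isMeasurableFun.Build _ _ _ _ _ mf).
exists (distribution m X); split => // h B mh hB.
rewrite /Rintegral; congr fine.
apply: (@integral_distribution _ _ _ _ _ m X (EFin \o h)).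
  exact/measurable_EFinP.
apply: (@bounded_integrable _ _ _ m (@probability_setT _ _ _ m) (fun P => h (f P)) B) => //.
exact: measurableT_comp.
Qed.

Lemma is_derive_Rint d (S : measurableType d) (m : {measure set S -> \bar R})
    (f df : R -> S -> R) (a b t B : R) : m setT = 1%E -> a < t < b ->
  (forall s, a < s < b -> measurable_fun setT (f s)) ->
  (forall s x, a < s < b -> `|f s x| <= B) ->
  (forall s x, a < s < b -> is_derive s 1 (f ^~ x) (df s x)) ->
  (forall s x, a < s < b -> `|df s x| <= B) ->
  is_derive t 1 (fun s => \int[m]_x f s x) (\int[m]_x df t x).
Proof.
move=> m1 tab mf fB hf dB.
have It : `]a, b[%classic t by rewrite /= in_itv.
have hfi x : `]a, b[%classic x -> m.-integrable setT (EFin \o f x).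
  rewrite /= in_itv /= => xab; exact: (bounded_integrable m1 (mf x xab) (fun y => fB x y xab)).
have hfd x y : `]a, b[%classic x -> setT y -> derivable (f ^~ y) x 1.
  by rewrite /= in_itv /= => xab _; have [] := hf x y xab.
have B0 (y : S) : 0 <= B by apply: le_trans (fB t y tab).
have iB : m.-integrable setT (EFin \o (fun=> B : R)).
  by apply: (@bounded_integrable _ _ _ m m1 (fun=> B) `|B|) => //; exact: measurable_cst.
have ub x y : `]a, b[%classic x -> setT y -> `|partial1of2 f x y| <= B.
  rewrite /= in_itv /= => xab _; rewrite partial1of2E.
  by have [_ ->] := hf x y xab; exact: dB.
have B0' (y : S) : 0 <= (fun=> B) y by exact: B0.
have D := derivable_under_integral measurableT It hfi hfd B0' iB ub.
have E := differentiation_under_integral measurableT It hfi hfd B0' iB ub.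
split => //; rewrite -derive1E E; apply: eq_Rintegral => x _.
by rewrite partial1of2E; have [_ ->] := hf t x tab.
Qed.

End image.

Section velocity.
Context {R : realType}.
Variables (K Mw Lw : R) (W : R * R -> R).
Let w (x y : R) := W (clamp x, clamp y).
Hypothesis hw : is_coupling Mw Lw w.

Lemma kernel_measurableG (x th : R) :
  measurable_fun setT (fun Q : G R => w x (site Q) * sin (phase Q - th)).
Proof.
apply: measurable_funM; first exact: (coupling_measurable hw).
apply: (measurableT_comp (f := @sin R)).
  by apply: continuous_measurable_fun; exact: continuous_sin.
by apply: measurable_funB; [exact: measurable_phase|exact: measurable_cst].
Qed.

Lemma kernel_boundG (x y s : R) : `|w x y * sin s| <= Mw.
Proof.
have [_ _ b _ _] := hw; rewrite normrM -[leRHS]mulr1 ler_pM //.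
by rewrite ler_norml sin_geN1 sin_le1.
Qed.

(** The iterated integrals in the velocity are a single integral over G, against the
law with density rho t. *)
Lemma velocityE (rho : R -> G R -> R) (t : R) (m : probability (G R) R) P :
  measurable_fun setT (rho t) -> (forall P, 0 <= rho t P) ->
  (forall A, measurable A -> m A = \int[vol]_(P in A) (rho t P)%:E)%E ->
  velocity K W rho t P = freq P + K * \int[m]_Q (w (site P) (site Q) * sin (phase Q - phase P)).
Proof.
move=> mr r0 hm; rewrite /velocity; congr (_ + _ * _).
have [_ iv ->] := Rint_density mr r0 hm (kernel_measurableG (site P) (phase P))
   (fun Q => kernel_boundG _ _ _) (@probability_setT _ _ _ m).
rewrite -(Rint_vol (f := fun Q => w (site P) (site Q) * sin (phase Q - phase P) * rho t Q) iv).
apply: eq_Rintegral => y; rewrite inE /= in_itv /= => y01.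
apply: eq_Rintegral => la _; apply: eq_Rintegral => phi; rewrite inE /= in_itv /= => h.
rewrite phase_mkG site_mkG wrap_id // /w !clamp_id ?site_itv //.
Qed.

End velocity.

Section wave_on_G.
Context {R : realType}.
Variables (M L : R) (a b : R -> R -> R).
Hypotheses (ha : amplitude M L a) (hb : amplitude M L b).

Lemma wave_wrap t th x : wave a b t (Defs.wrap th) x = wave a b t th x.
Proof.
have hp : phase_periodic (fun p : R * R * R => wave a b t p.1.1 p.2).
  by move=> th' om x' /=; rewrite wave_periodic.
exact: (phase_periodic_wrap hp th 0 x).
Qed.

Lemma measurable_wave (t : R) :
  measurable_fun setT (fun P : G R => wave a b t (phase P) (site P)).
Proof.
have amp (c : R -> R -> R) : amplitude M L c -> measurable_fun setT (fun P : G R => c t (site P)).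
  move=> [_ l _]; apply: (measurableT_comp (f := c t)).
    by apply: continuous_measurable_fun; apply: (@lipschitz_continuous _ _ L); exact: l.
  by apply: continuous_measurableG; exact: site_continuous.
apply: measurable_funB; apply: measurable_funM; try exact: amp.
  apply: (measurableT_comp (f := @cos R)); last exact: measurable_phase.
  by apply: continuous_measurable_fun; exact: continuous_cos.
apply: (measurableT_comp (f := @sin R)); last exact: measurable_phase.
by apply: continuous_measurable_fun; exact: continuous_sin.
Qed.

End wave_on_G.

Section transported_weak.
Context {R : realType}.
Notation R3 := (R * R * R)%type.
Variables (T M L : R) (a b : R -> R -> R) (X : R -> R3 -> R).
Variables (m0 : probability (G R) R).
Hypotheses (T0 : 0 < T) (ha : amplitude M L a) (hb : amplitude M L b).
Hypotheses (hX : is_flow T a b X).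
Variables (w wt wth : R * G R -> R).
Hypothesis hw : is_test_function T w wt wth.

Let m1 : m0 setT = 1%E. Proof. exact: probability_setT. Qed.
Let T0' : 0 <= T. Proof. exact: ltW. Qed.
Let M0 : 0 <= M. Proof. exact: amplitude_ge0 ha. Qed.

(** The derivative of the test function along the trajectory through P. *)
Definition transport_rate (t : R) (P : G R) : R :=
  wt (t, P) + (freq P + wave a b t (phase P) (site P)) * wth (t, P).

Let F := transport_rate.
Let cw : {within strip T, continuous w}. Proof. exact: test_continuous hw. Qed.
Let cwt : {within strip T, continuous wt}. Proof. exact: test_dt_continuous hw. Qed.
Let cwth : {within strip T, continuous wth}. Proof. exact: test_dth_continuous hw. Qed.

Lemma measurable_transport_rate t : 0 <= t < T -> measurable_fun setT (F t).
Proof.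
move=> tT; apply: measurable_funD.
  by apply: continuous_measurableG; exact: strip_slice cwt tT.
apply: measurable_funM; last by apply: continuous_measurableG; exact: strip_slice cwth tT.
apply: measurable_funD; last exact: measurable_wave ha hb _.
by apply: continuous_measurableG; exact: freq_continuous.
Qed.

Lemma transport_rate_bound : exists B : R, forall t P, 0 <= t < T -> `|F t P| <= B.
Proof.
have [T' [B [_ _ hB]]] := test_bounds hw T0.
exists (B + (B + 2 * M * B)) => t P tT; have [_ h1 h2 h3] := hB t P tT.
apply: le_trans (ler_normD _ _) _; apply: lerD => //.
rewrite mulrDl; apply: le_trans (ler_normD _ _) _; apply: lerD => //.
by rewrite normrM ler_pM // (wave_bound ha hb).
Qed.

Let measurable_onX t : 0 <= t <= T -> measurable_fun setT (onG (X t)).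
Proof.
by move=> tT; apply: continuous_measurableGG; exact: (flowG_continuous T0' ha hb hX).
Qed.

Let onX_continuous (tau : R -> R) P : continuous tau ->
  continuous (fun s => onG (X (tau s)) P).
Proof.
move=> ct s.
apply: (continuous_comp (f := fun s => X (tau s) (coords P)) (g := fun th => mkG th (freq P) (site P))).
  by apply: (continuous_comp (f := tau) (g := X ^~ (coords P))); [exact: ct|exact: (flow_continuous hX)].
exact: mkG_continuous_phase.
Qed.

(** Along the flow the test function is differentiated at the transport rate,
and it vanishes before the final time. *)
Lemma transport_weak_equation :
  \int[lebesgue_measure]_(t in `[0, T[) (\int[m0]_P F t (onG (X t) P))
  + \int[m0]_P w (0, P) = 0.
Proof.
have [T' [B0 [/andP[T'0 T'T] hoff hB0]]] := test_bounds hw T0.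
have [B1 hB1] := transport_rate_bound.
pose B := Num.max B0 B1.
have wB t P : 0 <= t < T -> `|w (t, P)| <= B.
  by move=> tT; have [h _ _ _] := hB0 t P tT; rewrite le_max h.
have FB t P : 0 <= t < T -> `|F t P| <= B.
  by move=> tT; rewrite le_max hB1 ?orbT.
pose phi (s : R) := \int[m0]_P w (s, onG (X s) P).
pose dphi (s : R) := \int[m0]_P F s (onG (X s) P).
have mw s : 0 <= s < T -> measurable_fun setT (fun P => w (s, onG (X s) P)).
  move=> sT; apply: (measurableT_comp (f := fun P => w (s, P))).
    by apply: continuous_measurableG; exact: strip_slice cw sT.
  by apply: measurable_onX; case/andP: sT => -> /ltW ->.
have mF s : 0 <= s < T -> measurable_fun setT (fun P => F s (onG (X s) P)).
  move=> sT; apply: (measurableT_comp (f := F s)); first exact: measurable_transport_rate.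
  by apply: measurable_onX; case/andP: sT => -> /ltW ->.
have hphi (s : R) : 0 < s < T -> is_derive s 1 phi (dphi s).
  move=> sT.
  apply: (is_derive_Rint (f := fun s P => w (s, onG (X s) P))
    (df := fun s P => F s (onG (X s) P)) (a := 0) (b := T) (B := B) m1 sT).
  - by move=> r /andP[/ltW r0 rT]; apply: mw; rewrite r0.
  - by move=> r P /andP[/ltW r0 rT]; apply: wB; rewrite r0.
  - move=> r P rT; have rT' : 0 <= r <= T by case/andP: rT => /ltW -> /ltW.
    have := test_chain hw (freq P) (site P) rT (flow_derive hX (coords P) rT').
    rewrite /F /transport_rate /onG phase_mkG freq_mkG site_mkG wave_wrap clamp_id ?site_itv //.
  - by move=> r P /andP[/ltW r0 rT]; apply: FB; rewrite r0.
have cutT s : 0 <= cut T' s < T.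
  by have /andP[-> h] := cut_itv s (ltW T'0); rewrite (le_lt_trans h).
have cX P : continuous (fun s => onG (X (cut T' s)) P).
  by apply: onX_continuous; exact: continuous_cut.
(* Frozen after T' < T, phi and dphi are continuous on the whole line; they agree
   with the originals because both vanish from T' on. *)
have cphi : continuous (fun s => phi (cut T' s)).
  apply: (continuous_Rint m1 (f := fun s P => w (cut T' s, onG (X (cut T' s)) P)) (B := B)).
  - by move=> s; exact: mw.
  - by move=> s P; exact: wB.
  - by move=> P; apply: (strip_after cw) => //; exact: continuous_cut.
have cdphi : continuous (fun s => dphi (cut T' s)).
  apply: (continuous_Rint m1 (f := fun s P => F (cut T' s) (onG (X (cut T' s)) P)) (B := B)).
  - by move=> s; exact: mF.
  - by move=> s P; exact: FB.
  - move=> P; apply: continuous_add.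
      by apply: (strip_after cwt) => //; exact: continuous_cut.
    apply: continuous_mul; last by apply: (strip_after cwth) => //; exact: continuous_cut.
    have -> : (fun s => freq (onG (X (cut T' s)) P) + wave a b (cut T' s) (phase (onG (X (cut T' s)) P))
        (site (onG (X (cut T' s)) P))) =
       (fun s => freq P + wave a b (cut T' s) (X (cut T' s) (coords P)) (site P)).
      by apply/funext => s; rewrite freq_onG site_onG /onG phase_mkG wave_wrap.
    apply: continuous_add; first exact: continuous_const.
    apply: (wave_continuous ha hb (f := cut T') (g := fun s => X (cut T' s) (coords P)) (h := fun=> site P)).
    + exact: continuous_cut.
    + move=> s; apply: (continuous_comp (f := cut T') (g := X ^~ (coords P))).
        exact: continuous_cut.
      exact: (flow_continuous hX).
    + exact: continuous_const.
have [Phi [Phi0 dPhi]] := exists_primitive cdphi.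
have PhiC : continuous Phi by move=> s; exact: is_derive_continuous (dPhi s).
have zero (r : R) : T' <= r < T -> dphi r = 0.
  move=> rT; transitivity (\int[m0]_P (0 : R)); last by rewrite Rintegral_cst // mul0r.
  apply: eq_Rintegral.
  move=> P _; have [_ h1 h2] := hoff r (onG (X r) P) rT.
  by rewrite /F /transport_rate h1 h2 mulr0 addr0.
have phiT : phi T' = 0.
  transitivity (\int[m0]_P (0 : R)); last by rewrite Rintegral_cst // mul0r.
  apply: eq_Rintegral.
  by move=> P _; have [] := hoff T' (onG (X T') P) _; rewrite // lexx.
have const0 (s : R) (c : R) : is_derive s 1 (fun=> c : R) 0 by exact: is_derive_const.
have e1 : phi T' - phi 0 = Phi T'.
  have d (s : R) : 0 < s < T' -> is_derive s 1 (fun s : R => phi s - Phi s) 0.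
    move=> /andP[s0 sT]; have sT' : 0 < s < T by rewrite s0 (lt_trans sT).
    have := is_derive_sub (hphi s sT') (dPhi s).
    by rewrite cut_id ?(ltW s0) ?(ltW sT) // subrr.
  have := ler_variation (ltW T'0) _ _ d (fun s _ => const0 s 0).
  rewrite Phi0 subr0 => h; apply/eqP; rewrite -subr_eq0 -normr_le0.
  have -> : phi T' - phi 0 - Phi T' = phi T' - Phi T' - phi 0 by ring.
  apply: le_trans (h _ _ _) _; last by rewrite subrr.
  - apply: (subspace_eq_continuous (f := fun s => phi (cut T' s) - Phi s)).
      by move=> s; rewrite inE /= in_itv /= => sT; rewrite cut_id.
    by apply: within_itv_continuous; apply: continuous_sub.
  - by apply: within_itv_continuous; exact: continuous_const.
  - by move=> s _; rewrite normr0.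
have e2 : Phi T = Phi T'.
  have := ler_variation (f := Phi) (g := fun=> 0) (ltW T'T) _ _ (fun s _ => dPhi s) (fun s _ => const0 s 0).
  move=> h; apply/eqP; rewrite -subr_eq0 -normr_le0; apply: le_trans (h _ _ _) _; last by rewrite subrr.
  - exact: within_itv_continuous.
  - by apply: within_itv_continuous; exact: continuous_const.
  - move=> s /andP[sT' _]; rewrite zero ?normr0 //.
    by rewrite /cut (min_idPr (ltW sT')) (max_idPr (ltW T'0)) lexx.
have -> : \int[lebesgue_measure]_(t in `[0, T[) dphi t = Phi T.
  have -> : \int[lebesgue_measure]_(t in `[0, T[) dphi t =
      \int[lebesgue_measure]_(t in `[0, T[) dphi (cut T' t).
    apply: eq_Rintegral => s; rewrite inE /= in_itv /= => /andP[s0 sT].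
    have [sT'|/ltW sT'] := leP s T'; first by rewrite cut_id // s0.
    rewrite !zero ?sT' //.
    by rewrite /cut (min_idPr sT') (max_idPr (ltW T'0)) lexx.
  rewrite /Rintegral (integral_co 0 T cdphi) (FTC2 T0 cdphi dPhi) /=.
  by rewrite Phi0 subr0.
have -> : \int[m0]_P w (0, P) = phi 0.
  by apply: eq_Rintegral => P _; rewrite /onG (flow0 hX) mkG_coordsE.
by rewrite e2 -e1 phiT sub0r addNr.
Qed.

End transported_weak.

(** * Existence of the weak solution *)

Section initial_density.
Context {R : realType}.
Variables (g : R -> R) (rho0 : G R -> R).
Hypotheses (hg : is_continuous_pdf g) (hrho0 : is_conditional_density rho0).

Definition initial_density (P : G R) : R := rho0 P * g (freq P).

Lemma initial_density_continuous : continuous initial_density.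
Proof.
have [cg _ _] := hg; apply: continuous_mul; first exact: cond_continuous hrho0.
exact: (continuous_after (f := @freq R) (@freq_continuous R) cg).
Qed.

Lemma initial_density_ge0 P : 0 <= initial_density P.
Proof. by have [_ g0 _] := hg; rewrite mulr_ge0 // (cond_ge0 hrho0). Qed.

Lemma initial_density_mass : (\int[vol]_P (initial_density P)%:E = 1)%E.
Proof.
have [cg g0 g1] := hg.
have crho := cond_continuous hrho0.
rewrite integral_vol; last by move=> P; rewrite lee_fin initial_density_ge0.
  transitivity (\int[lebesgue_measure]_(y in `[0%R, 1%R]) (1%E : \bar R))%E; last first.
    rewrite integral_cst // mul1e; have h := @lebesgue_measure_itv R `[0%R, 1%R].
    by rewrite /= lte_fin ltr01 oppr0 adde0 in h; exact: h.
  apply: eq_integral => y; rewrite inE /= in_itv /= => y01.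
  rewrite -g1; apply: eq_integral => la _.
  rewrite /initial_density; under eq_integral do rewrite freq_mkG EFinM.
  rewrite ge0_integralZr //.
  - by rewrite (cond_integral hrho0) // mul1e.
  - apply/measurable_EFinP; apply: measurable_funTS; apply: continuous_measurable_fun => phi.
    apply: (continuous_comp (f := fun s : R => mkG s la y) (g := rho0)); [exact: mkG_continuous_phase|exact: crho].
  - by move=> phi _; rewrite lee_fin (cond_ge0 hrho0).
  - by rewrite lee_fin.
apply/measurable_EFinP; apply: continuous_measurableG; exact: initial_density_continuous.
Qed.

End initial_density.

Section existence.
Context {R : realType}.
Notation R3 := (R * R * R)%type.
Variables (K Mw Lw T : R) (W : R * R -> R) (g : R -> R) (rho0 : G R -> R).
Let w (x y : R) := W (clamp x, clamp y).
Hypotheses (hw : is_coupling Mw Lw w) (T0 : 0 < T).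
Hypotheses (hg : is_continuous_pdf g) (hrho0 : is_conditional_density rho0).
Variables (m0 : probability (G R) R) (u : R -> R3 -> R).
Hypothesis hm0 : forall A, measurable A ->
  (m0 A = \int[vol]_(P in A) (initial_density g rho0 P)%:E)%E.
Hypothesis hu : is_mean_field K w m0 T u.

Let T0' : 0 <= T. Proof. exact: ltW. Qed.
Let m1 : m0 setT = 1%E. Proof. exact: probability_setT. Qed.

(** The image of the initial law under the flow solves the continuity equation
along each path, and its velocity field is the mean field because an integral
against the image is an integral against the initial law. *)
Lemma mean_field_weak_solution : exists rho : R -> G R -> R,
  is_weak_solution K W g rho0 T rho /\
  forall (t : R) A, 0 <= t <= T -> measurable A ->
    (\int[vol]_(P in A) (rho t P)%:E = m0 (onG (u t) @^-1` A))%E.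
Proof.
have [ha hb hX hwave] := mean_field_flow hw m1 T0' hu.
set a := order_param _ _ _ _ _ in ha hX hwave; set b := order_param _ _ _ _ _ in hb hX hwave.
have [j hj] := log_stretch_exists ha hb hX.
have [Y hY] := backflow_exists T0' ha hb hX.
pose r := initial_density g rho0.
have cr : continuous r := initial_density_continuous hg hrho0.
have r0 P : 0 <= r P := initial_density_ge0 hg hrho0 P.
pose rho (t : R) P := transported T j Y r t P.
have himage (t : R) A : 0 <= t <= T -> measurable A ->
    (\int[vol]_(P in A) (rho t P)%:E = m0 (onG (u t) @^-1` A))%E.
  by move=> tT mA; exact: (transported_image T0' ha hb hX hj hY tT cr r0 hm0 mA).
have crho t : continuous (rho t) by exact: (transported_continuous T0' ha hb hX hj hY).
have rho_ge0 t P : 0 <= rho t P by rewrite mulr_ge0 // expR_ge0.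
have mrho t : measurable_fun setT (rho t) by exact: continuous_measurableG.
have monX t : 0 <= t <= T -> measurable_fun setT (onG (u t)).
  by move=> tT; apply: continuous_measurableGG; exact: (flowG_continuous T0' ha hb hX).
have law t : 0 <= t <= T -> exists m : probability (G R) R,
    (forall A, measurable A -> m A = \int[vol]_(P in A) (rho t P)%:E)%E /\
    forall (h : G R -> R) (B : R), measurable_fun setT h -> (forall P, `|h P| <= B) ->
    \int[m]_P h P = \int[m0]_P h (onG (u t) P).
  move=> tT; have [m [hm him]] := image_probability m0 (monX t tT).
  by exists m; split => // A mA; rewrite himage // hm.
have int_rho t (h : G R -> R) (B : R) : 0 <= t <= T -> measurable_fun setT h ->
    (forall P, `|h P| <= B) ->
    \int[vol]_P (h P * rho t P) = \int[m0]_P h (onG (u t) P).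
  move=> tT mh hB; have [m [hm him]] := law t tT.
  have [_ _ <-] := Rint_density (mrho t) (rho_ge0 t) hm mh hB (@probability_setT _ _ _ m).
  exact: him mh hB.
have vel t P : 0 <= t <= T ->
    velocity K W rho t P = freq P + wave a b t (phase P) (site P).
  move=> tT; have [m [hm him]] := law t tT.
  rewrite (velocityE K hw P (mrho t) (rho_ge0 t) hm) hwave //; congr (_ + _ * _).
  rewrite (him _ Mw (kernel_measurableG hw _ _) (fun Q => kernel_boundG hw _ _ _)).
  apply: eq_Rintegral => Q _; rewrite site_onG /onG phase_mkG; congr (_ * _).
  have hp : phase_periodic (fun p : R3 => sin (p.1.1 - phase P)).
    by move=> th om x /=; rewrite addrAC sin_periodic2pi.
  exact: (phase_periodic_wrap hp _ 0 0).
exists rho; split => //; split.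
- by move=> t _.
- by move=> t P _.
- move=> t tT; rewrite himage // preimage_setT; exact: probability_setT.
- move=> f cf [B fB].
  have mf : measurable_fun setT f := continuous_measurableG cf.
  apply: (subspace_eq_continuous (f := fun t : R => \int[m0]_P f (onG (u (cut T t)) P))).
    move=> t; rewrite inE /= in_itv /= => tT.
    by have := int_rho t f B tT mf fB; rewrite cut_id // => ->.
  apply: within_itv_continuous.
  apply: (continuous_Rint m1 (f := fun t P => f (onG (u (cut T t)) P)) (B := B)).
  + by move=> t; apply: measurableT_comp => //; apply: monX; exact: cut_itv.
  + by move=> t P; exact: fB.
  + move=> P t; apply: (continuous_comp (f := fun t => onG (u (cut T t)) P) (g := f)); last exact: cf.
    apply: (continuous_comp (f := fun s => u (cut T s) (coords P)) (g := fun th => mkG th (freq P) (site P))).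
      by apply: (continuous_comp (f := cut T) (g := u ^~ (coords P)));
        [exact: continuous_cut|exact: (flow_continuous hX)].
    exact: mkG_continuous_phase.
- move=> P; exact: (transported0 T0' hX hj hY).
- move=> f ft fth hf.
  have := transport_weak_equation m0 T0 ha hb hX hf.
  have -> : \int[m0]_P f (0, P) = \int[vol]_P (rho 0 P * f (0, P)).
    have [T' [B [_ _ hB]]] := test_bounds hf T0.
    have z0 : 0 <= (0 : R) < T by rewrite lexx.
    have z0' : 0 <= (0 : R) <= T by rewrite lexx.
    have := int_rho 0 (fun P => f (0, P)) B z0' _ _.
    rewrite (@eq_Rintegral _ _ _ m0 setT (fun P => f (0, P)) (fun P => f (0, onG (u 0) P))); last first.
      by move=> P _; rewrite /onG (flow0 hX) mkG_coordsE.
    move=> <-.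
    + by apply: eq_Rintegral => P _; rewrite mulrC.
    + by apply: continuous_measurableG; exact: (strip_slice (test_continuous hf) z0).
    + by move=> P; have [] := hB 0 P z0.
  move=> e; rewrite -[RHS]e; congr (_ + _).
  apply: eq_Rintegral => t; rewrite inE /= in_itv /= => tT.
  have tT' : 0 <= t <= T by case/andP: tT => -> /ltW.
  have [B hB] := transport_rate_bound T0 ha hb hf.
  rewrite -(int_rho t (transport_rate a b ft fth t) B tT').
  + by apply: eq_Rintegral => P _; rewrite /transport_rate vel // mulrC.
  + exact: (measurable_transport_rate ha hb hf tT).
  + by move=> P; exact: hB.
Qed.

End existence.

(** * Test functions carried by the backward flow *)

Section joint_continuity.
Context {R : realType}.
Notation R3 := (R * R * R)%type.
Implicit Types (p q : R3) (P Q : G R).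

Lemma continuous_at_of_bound (S : topologicalType) (f B : S -> R) (z0 : S) :
  (forall z, `|f z - f z0| <= B z) -> {for z0, continuous B} -> B z0 = 0 ->
  {for z0, continuous f}.
Proof.
move=> fB cB B0; apply/cvgrPdist_le => e e0; near=> z.
rewrite distrC; apply: le_trans (fB z) _.
have : `|B z0 - B z| <= e by near: z; move/cvgrPdist_le: cB; apply.
by rewrite B0 sub0r normrN => /ler_normlW.
Unshelve. all: by end_near. Qed.

Lemma time_continuous : continuous (fun z : R * R3 => z.1).
Proof. by move=> z; exact: cvg_fst. Qed.

Lemma coord_phase_continuous : continuous (fun z : R * R3 => z.2.1.1).
Proof.
move=> z; apply: (continuous_comp (f := fun z : R * R3 => z.2.1) (g := fst)); last exact: cvg_fst.
apply: (continuous_comp (f := snd) (g := fst)); [exact: cvg_snd|exact: cvg_fst].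
Qed.

Lemma coord_freq_continuous : continuous (fun z : R * R3 => z.2.1.2).
Proof.
move=> z; apply: (continuous_comp (f := fun z : R * R3 => z.2.1) (g := snd)); last exact: cvg_snd.
apply: (continuous_comp (f := snd) (g := fst)); [exact: cvg_snd|exact: cvg_fst].
Qed.

Lemma coord_site_continuous : continuous (fun z : R * R3 => z.2.2).
Proof.
by move=> z; apply: (continuous_comp (f := snd) (g := snd)); exact: cvg_snd.
Qed.

Lemma dist1_continuous (z0 : R * R3) (c d : R) :
  continuous (fun z : R * R3 => c * dist1 z.2 z0.2 + d * `|z.1 - z0.1|).
Proof.
have cn (f : R * R3 -> R) (r : R) : continuous f -> continuous (fun z => `|f z - r|).
  move=> cf; apply: (continuous_after (f := fun z => f z - r) _ (h := fun x : R => `|x|)).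
    by apply: continuous_sub => //; exact: continuous_const.
  by move=> x; exact: norm_continuous.
apply: continuous_add; apply: continuous_mul; try exact: continuous_const.
  apply: continuous_add; last by apply: cn; exact: coord_site_continuous.
  apply: continuous_add; apply: cn; [exact: coord_phase_continuous|exact: coord_freq_continuous].
by apply: cn; exact: time_continuous.
Qed.

Lemma continuous_of_dist (f : R -> R3 -> R) (c : R) (d : R3 -> R) :
  (forall t p q, `|f t p - f t q| <= c * dist1 p q) ->
  (forall p s t, `|f t p - f s p| <= d p * `|t - s|) ->
  continuous (fun z : R * R3 => f z.1 z.2).
Proof.
move=> fc fd [t p].
apply: (@continuous_at_of_bound _ _ (fun z : R * R3 => c * dist1 z.2 p + d p * `|z.1 - t|)).
- move=> [s q] /=; have -> : f s q - f t p = (f s q - f s p) + (f s p - f t p) by ring.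
  by apply: le_trans (ler_normD _ _) _; apply: lerD.
- exact: (@dist1_continuous (t, p) c (d p) (t, p)).
- by rewrite /= /dist1 !subrr normr0 !addr0 !mulr0 addr0.
Qed.

(** Close points of G have close coordinates after a shift of the phase by a
period. *)
Lemma strip_descent (T : R) (f : R -> R3 -> R) :
  continuous (fun z : R * R3 => f z.1 z.2) -> (forall t, phase_periodic (f t)) ->
  {within strip T, continuous (fun z : R * G R => f z.1 (coords z.2))}.
Proof.
move=> cf pf; apply/strip_continuousP => t P _ e e0.
have /cvgrPdist_le /(_ e e0) := cf (t, coords P).
move=> [[A B] /= [nA nB] AB].
have /nbhs_ballP[d1 /= d10 hd1] := nA; have /nbhs_ballP[d2 /= d20 hd2] := nB.
have d30 : 0 < d2 / 3 by rewrite divr_gt0.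
exists (Num.min d1 (d2 / 3)); first by rewrite lt_min d10.
move=> s Q _; rewrite lt_min => /andP[st _]; rewrite lt_min dGC => /andP[_ QP] /=.
have [q [hq hqf]] := lift_near Q P; rewrite -(hqf _ _ (pf s)) distrC.
apply: (AB (s, q)); split => /=; first by apply: hd1; rewrite /ball /= distrC.
apply: hd2; have {}hq : dist1 q (coords P) < d2.
  by apply: le_lt_trans hq _; rewrite mulrC -ltr_pdivlMr.
move: hq; rewrite /dist1 => hq.
have n1 := normr_ge0 (q.1.1 - (coords P).1.1).
have n2 := normr_ge0 (q.1.2 - (coords P).1.2).
have n3 := normr_ge0 (q.2 - (coords P).2).
split; last by rewrite /ball /= distrC; lra.
by split; rewrite /ball /= distrC; lra.
Qed.

Variables (T M L : R) (a b : R -> R -> R) (X j Y : R -> R3 -> R).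
Hypotheses (T0 : 0 <= T) (ha : amplitude M L a) (hb : amplitude M L b).
Hypotheses (hX : is_flow T a b X) (hj : is_log_stretch T a b X j).
Hypothesis (hY : is_backflow T X Y).

Lemma backflow_joint : continuous (fun z : R * R3 => Y z.1 z.2).
Proof.
apply: (continuous_of_dist (c := flow_lip T M L * (1 + flow_lip T M L))
  (d := fun p => flow_lip T M L * (`|p.1.2| + 2 * M))).
- by move=> t p q; exact: (backflow_dist T0 ha hb hX hY p q t).
- by move=> p s t; exact: (backflow_dist_t T0 ha hb hX hY p s t).
Qed.

Lemma back_stretch_joint : continuous (fun z : R * R3 => back_stretch T j Y z.1 z.2).
Proof.
pose s0 := stretch_lip T M L.
have M0 := amplitude_ge0 ha; have L0 := lipschitz_ge0 ha.
have l0 := flow_lip_ge0 T0 ha.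
have s00 : 0 <= s0.
  by apply: mulr_ge0 => //; apply: addr_ge0; [apply: mulr_ge0 => //; apply: mulr_ge0|apply: mulr_ge0].
apply: (continuous_of_dist (c := s0 * (flow_lip T M L * (1 + flow_lip T M L) + 1))
  (d := fun p => s0 * (flow_lip T M L * (`|p.1.2| + 2 * M)) + 2 * M)).
- by move=> t p q; exact: (back_stretch_dist T0 ha hb hX hj hY).
- move=> p s t; rewrite /back_stretch.
  set y := Y t p; set x := Y s p.
  have -> : j (cut T t) (y, p.1.2, p.2) - j (cut T s) (x, p.1.2, p.2) =
    (j (cut T t) (y, p.1.2, p.2) - j (cut T t) (x, p.1.2, p.2)) +
    (j (cut T t) (x, p.1.2, p.2) - j (cut T s) (x, p.1.2, p.2)) by ring.
  apply: le_trans (ler_normD _ _) _; rewrite mulrDl; apply: lerD.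
    apply: le_trans (stretch_dist T0 ha hb hX hj _ _ (cut_itv t T0)) _.
    rewrite /dist1 /= !subrr normr0 !addr0 -mulrA ler_wpM2l //.
    exact: (backflow_dist_t T0 ha hb hX hY p s t).
  apply: le_trans (stretch_dist_t ha hb hj _ _ _) _.
  by rewrite ler_wpM2l ?mulr_ge0 // cut_dist.
Qed.

End joint_continuity.

Section backward_test.
Context {R : realType}.
Notation R3 := (R * R * R)%type.
Variables (T M L : R) (a b : R -> R -> R) (X j Y : R -> R3 -> R).
Hypotheses (T0 : 0 < T) (ha : amplitude M L a) (hb : amplitude M L b).
Hypotheses (hX : is_flow T a b X) (hj : is_log_stretch T a b X j).
Hypothesis (hY : is_backflow T X Y).
Variables (k k' c e : R -> R).
Hypotheses (ck' : continuous k') (dk : forall t : R, is_derive t 1 k (k' t)).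
Hypotheses (kp : forall t, k (t + 2 * pi) = k t) (hc : freq_test c) (he : site_test e).
Variables (T' : R) (eta deta : R -> R).
Hypotheses (T'0 : 0 <= T' < T) (ddeta : forall t : R, is_derive t 1 eta (deta t)).
Hypotheses (cdeta : continuous deta) (eta0 : forall t, T' <= t -> eta t = 0).

Let T0' : 0 <= T. Proof. exact: ltW. Qed.

(** A function of the initial point of the trajectory through p, hence constant
along trajectories. *)
Definition back_test (t : R) (p : R3) : R := k (Y t p) * c p.1.2 * e p.2.

Definition back_test_dth (t : R) (p : R3) : R :=
  k' (Y t p) * expR (- back_stretch T j Y t p) * c p.1.2 * e p.2.

Lemma derivative_periodic (t : R) : k' (t + 2 * pi) = k' t.
Proof.
have h := @is_derive_compose R k (fun s => s + 2 * pi) t _ _ (dk (t + 2 * pi))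
  (is_derive_add (is_derive_ident t) (is_derive_const (2 * pi) t)).
rewrite addr0 mulr1 in h.
have e1 : (fun s : R => k (s + 2 * pi)) = k by apply/funext => s; rewrite kp.
by rewrite e1 in h; case: h => _ <-; case: (dk t) => _ <-.
Qed.

Lemma back_test_periodic t : phase_periodic (back_test t).
Proof.
move=> th om x; rewrite /back_test /=.
by rewrite (backflow_shift T0' ha hb hX hY t th om x) kp.
Qed.

Lemma back_test_dth_periodic t : phase_periodic (back_test_dth t).
Proof.
move=> th om x; rewrite /back_test_dth /=.
rewrite (backflow_shift T0' ha hb hX hY t th om x) derivative_periodic.
by rewrite (back_stretch_periodic T0' ha hb hX hj hY).
Qed.

Let cjoint (h : R -> R) (f : R * R3 -> R) : continuous f -> continuous h ->
  continuous (fun z => h (f z)).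
Proof. by move=> cf ch; exact: (continuous_after cf ch). Qed.

Let ceta : continuous eta.
Proof. by move=> t; exact: is_derive_continuous (ddeta t). Qed.

Lemma back_test_joint : continuous (fun z : R * R3 => back_test z.1 z.2).
Proof.
have [cc _ _] := hc; have [ce _] := he.
have cY := backflow_joint T0' ha hb hX hY.
apply: continuous_mul; last by apply: cjoint ce; exact: coord_site_continuous.
apply: continuous_mul; last by apply: cjoint cc; exact: coord_freq_continuous.
by apply: cjoint cY _ => t; exact: is_derive_continuous (dk t).
Qed.

Lemma back_test_dth_joint : continuous (fun z : R * R3 => back_test_dth z.1 z.2).
Proof.
have [cc _ _] := hc; have [ce _] := he.
have cY := backflow_joint T0' ha hb hX hY.
have cS := back_stretch_joint T0' ha hb hX hj hY.
apply: continuous_mul; last by apply: cjoint ce; exact: coord_site_continuous.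
apply: continuous_mul; last by apply: cjoint cc; exact: coord_freq_continuous.
apply: continuous_mul; first exact: cjoint cY ck'.
by apply: cjoint (@continuous_expR R); apply: continuous_opp.
Qed.

Definition back_speed (t : R) (p : R3) : R := p.1.2 + wave a b t p.1.1 p.2.

Definition back_w (z : R * G R) : R := eta z.1 * back_test z.1 (coords z.2).
Definition back_wth (z : R * G R) : R := eta z.1 * back_test_dth z.1 (coords z.2).
(** The time derivative of the backward flow is minus the velocity times its phase
derivative. *)
Definition back_wt (z : R * G R) : R :=
  deta z.1 * back_test z.1 (coords z.2) -
  eta z.1 * (back_speed z.1 (coords z.2) * back_test_dth z.1 (coords z.2)).

(** The support is compact: eta bounds the time away from T, c bounds the frequency,
and the remaining coordinates are bounded on G. *)
Lemma back_test_function : is_test_function T back_w back_wt back_wth.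
Proof.
have [cc _ [N hN]] := hc; have [ce _] := he.
have cw := back_test_joint; have cwth := back_test_dth_joint.
have ct : continuous (fun z : R * R3 => eta z.1).
  by apply: cjoint ceta; exact: time_continuous.
have cs : continuous (fun z : R * R3 => back_speed z.1 z.2).
  apply: continuous_add; first exact: coord_freq_continuous.
  apply: (wave_continuous ha hb); [exact: time_continuous|exact: coord_phase_continuous|exact: coord_site_continuous].
have ps t : phase_periodic (back_speed t).
  by move=> th om x; rewrite /back_speed /= wave_periodic.
split.
- apply: (strip_descent (f := fun t p => eta t * back_test t p)); first exact: continuous_mul.
  by move=> t th om x; rewrite back_test_periodic.
- apply: (strip_descent (f := fun t p => deta t * back_test t p -
    eta t * (back_speed t p * back_test_dth t p))).
    apply: continuous_sub; apply: continuous_mul => //; last exact: continuous_mul.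
    by apply: cjoint cdeta; exact: time_continuous.
  by move=> t th om x; rewrite back_test_periodic ps back_test_dth_periodic.
- apply: (strip_descent (f := fun t p => eta t * back_test_dth t p)); first exact: continuous_mul.
  by move=> t th om x; rewrite back_test_dth_periodic.
- move=> t P tT; rewrite /back_w /back_wt /=.
  have hY' := backflow_derive_t T0' ha hb hX hj hY (phase P) (freq P) (site P) tT.
  have h1 := @is_derive_compose R k (Y ^~ (phase P, freq P, site P)) t _ _ (dk _) hY'.
  have h2 := is_derive_mul (ddeta t) (is_derive_scale (c (freq P) * e (site P)) h1).
  rewrite coordsE /back_test /back_test_dth /back_speed /back_stretch /=.
  rewrite cut_id; last by case/andP: tT => /ltW -> /ltW ->.
  have E f1 f2 l1 l2 : f1 = f2 -> l1 = l2 -> is_derive t 1 f1 l1 -> is_derive t 1 f2 l2.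
    by move=> -> ->.
  apply: E h2; last by ring.
  by apply/funext => s; ring.
- move=> t P tT; rewrite /back_w /back_wth /=.
  have hY' := backflow_derive_phase T0' ha hb hX hj hY (phase P) (freq P) (site P) t.
  have h1 := @is_derive_compose R k (fun s => Y t (s, freq P, site P)) (phase P) _ _ (dk _) hY'.
  have h2 := is_derive_scale (eta t * (c (freq P) * e (site P))) h1.
  have E f1 f2 l1 l2 : f1 = f2 -> l1 = l2 -> is_derive (phase P) 1 f1 l1 -> is_derive (phase P) 1 f2 l2.
    by move=> -> ->.
  apply: E h2.
    apply/funext => s; rewrite (phase_periodic_mkG (@back_test_periodic t)) clamp_id ?site_itv //.
    by rewrite /back_test /=; ring.
  by rewrite /back_test_dth coordsE /back_stretch /=; ring.
- pose f (z : R * R3) : R * G R := (z.1, mkG z.2.1.1 z.2.1.2 z.2.2).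
  pose D : set (R * R3) := `[0, T'] `*` ((`[0, 2 * pi] `*` `[- N, N]) `*` `[0, 1]).
  exists (f @` D); split.
  + apply: continuous_compact.
      apply: continuous_subspaceT => z.
      have c1 : (fun z : R * R3 => z.1) @ z --> z.1 by exact: cvg_fst.
      have c2 : (fun z : R * R3 => mkG z.2.1.1 z.2.1.2 z.2.2) @ z --> mkG z.2.1.1 z.2.1.2 z.2.2; last first.
        exact: cvg_pair c1 c2.
      move=> A /nbhs_ballP[d /= d0 hd].
      have := @dist1_continuous R z 1 0 z.
      move/cvgrPdist_lt => /(_ d d0); apply: filterS => y /= hy.
      apply: hd; rewrite ballEmdist /=.
      apply: le_lt_trans (dG_mkG_dist1 _ _) _.
      move: hy; rewrite !mul0r !addr0 !mul1r.
      rewrite {1}/dist1 !subrr normr0 !addr0 sub0r normrN ger0_norm ?dist1_ge0 //.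
      by congr (_ < _); rewrite /dist1 (distrC z.2.1.1) (distrC z.2.1.2) (distrC z.2.2).
    apply: compact_setX; first exact: segment_compact.
    apply: compact_setX; last exact: segment_compact.
    by apply: compact_setX; exact: segment_compact.
  + move=> _ [[t p] [/= h _] <-]; split => //=; move: h.
    rewrite /= !in_itv /= => /andP[-> h]; apply: le_lt_trans h _; by case/andP: T'0.
  + move=> t P /andP[t0 tT] nC; rewrite /back_w /=.
    have [tT'|/ltW tT'] := leP t T'; last by rewrite eta0 // mul0r.
    have [hN'|/ltW hN'] := leP `|freq P| N; last first.
      by rewrite /back_test coordsE /= hN // mulr0 mul0r mulr0.
    exfalso; apply: nC; exists (t, coords P) => /=; last by rewrite /f /= mkG_coordsE.
    have /andP[P0 P1] := phase_itv P.
    split => /=; first by rewrite in_itv /= t0.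
    split => /=; last by rewrite in_itv /= site_itv.
    split => /=; first by rewrite in_itv /= P0 ltW.
    by rewrite in_itv /=; move: hN'; rewrite ler_norml.
Qed.

(** The backward test function is constant along the flow, up to the factor
that depends on time only. *)
Lemma back_rate t P : back_wt (t, P) + (freq P + wave a b t (phase P) (site P)) * back_wth (t, P) =
  deta t * back_test t (coords P).
Proof.
rewrite /back_wt /back_wth /back_speed /=.
rewrite -/(phase P) -/(freq P) -/(site P); ring.
Qed.

End backward_test.

(** * Uniqueness of the weak solution *)

Section weak_law.
Context {R : realType}.
Notation R3 := (R * R * R)%type.

Lemma integral_Rint d (S : measurableType d) (m : {measure set S -> \bar R})
    (f : S -> R) (B : R) : m setT = 1%E -> measurable_fun setT f ->
  (forall x, `|f x| <= B) -> (\int[m]_x (f x)%:E = (\int[m]_x f x)%:E)%E.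
Proof.
move=> m1 mf fB; rewrite /Rintegral fineK //.
exact: (integrable_fin_num measurableT (bounded_integrable m1 mf fB)).
Qed.

Lemma phase_test_lipschitz (k : R -> R) : phase_test k ->
  exists2 kl : R, 0 <= kl & forall s t, `|k s - k t| <= kl * `|s - t|.
Proof.
move=> [k' [ck' dk kp _]].
have cn : {within `[0, 2 * pi], continuous (fun t : R => `|k' t|)}.
  apply: within_itv_continuous; apply: (continuous_after ck' (h := fun x : R => `|x|)).
  by move=> x; exact: norm_continuous.
have [z _ hz] := EVT_max (ltW (@twopi_gt0 R)) cn.
exists `|k' z| => // s t; apply: (derive_lipschitz dk) => r.
have hp : phase_periodic (fun p : R3 => k' p.1.1).
  by move=> th om x /=; exact: derivative_periodic dk kp _.
rewrite -(phase_periodic_wrap hp r 0 0) /=; apply: hz.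
by rewrite in_itv /=; have /andP[-> /ltW ->] := wrap_itv r.
Qed.

Variables (K Mw Lw T : R) (W : R * R -> R) (g : R -> R) (rho0 : G R -> R).
Let w (x y : R) := W (clamp x, clamp y).
Hypotheses (hw : is_coupling Mw Lw w) (T0 : 0 < T).
Variable rho : R -> G R -> R.
Hypothesis hrho : is_weak_solution K W g rho0 T rho.
Variable law : R -> probability (G R) R.
Hypothesis hlaw : forall t A, measurable A ->
  (law t A = \int[vol]_(P in A) (rho (cut T t) P)%:E)%E.

Let T0' : 0 <= T. Proof. exact: ltW. Qed.
Let law1 t : law t setT = 1%E. Proof. exact: probability_setT. Qed.
Let mrho t : measurable_fun setT (rho (cut T t)).
Proof. by apply: (weak_measurable hrho); exact: cut_itv. Qed.
Let rho_ge0 t P : 0 <= rho (cut T t) P.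
Proof. by apply: (weak_ge0 hrho); exact: cut_itv. Qed.

Lemma Rint_law t (h : G R -> R) (B : R) : measurable_fun setT h ->
  (forall P, `|h P| <= B) -> \int[law t]_P h P = \int[vol]_P (h P * rho (cut T t) P).
Proof.
by move=> mh hB; have [_ _] := Rint_density (mrho t) (rho_ge0 t) (hlaw t) mh hB (law1 t).
Qed.

Lemma law_continuous (h : G R -> R) (B : R) : continuous h ->
  (forall P, `|h P| <= B) -> continuous (fun t => \int[law t]_P h P).
Proof.
move=> ch hB.
have mh : measurable_fun setT h := continuous_measurableG ch.
have := weak_continuous hrho ch (ex_intro _ B hB) => /subspace_continuousP cf.
have -> : (fun t => \int[law t]_P h P) = (fun t => \int[vol]_P (h P * rho (cut T t) P)).
  by apply/funext => t; exact: Rint_law mh hB.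
move=> t; have cT := cut_itv t T0'.
have := cf (cut T t); rewrite /= in_itv /= => /(_ cT) h1.
apply: cvg_trans h1; apply: (@cvg_comp _ _ _ (cut T) (fun s => \int[vol]_P (h P * rho s P))); last first.
  exact: cvg_id.
move=> A; rewrite /= => nA.
have : \forall s \near t, `[0, T]%classic (cut T s) -> A (cut T s) by exact: (continuous_cut nA).
by apply: filterS => s; apply; rewrite /= in_itv /= cut_itv.
Qed.

Definition law_field (h : R -> R) (t x : R) : R :=
  order_param K w (law t) (fun _ : R => @phase R) h t x.

Let site_kernel_continuous x : continuous (fun Q : G R => w x (site Q)).
Proof.
apply: (@lipG_continuous _ _ Lw) => P Q.
have [_ L0 _ _ h] := hw; apply: le_trans (h _ _ _) _.
by rewrite ler_wpM2l //; have [] := dG_bounds P Q.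
Qed.

Lemma law_field_amplitude (h : R -> R) : (forall s t, `|h s - h t| <= `|s - t|) ->
  (forall s, h (s + 2 * pi) = h s) -> (forall s, `|h s| <= 1) ->
  amplitude (`|K| * Mw) (`|K| * Lw) (law_field h).
Proof.
move=> hl hp h1.
have ch : continuous h by apply: (@lipschitz_continuous _ _ 1) => s t; rewrite mul1r.
have mU (t : R) : measurable_fun setT (@phase R) by exact: measurable_phase.
split.
- by move=> t x; exact: (order_param_bound K hw (law1 t) mU).
- by move=> t x y; exact: (order_param_lip K hw (law1 t) mU).
- move=> x; apply: continuous_mul; first exact: continuous_const.
  apply: (law_continuous (B := Mw)).
    apply: continuous_mul; first exact: site_kernel_continuous.
    apply: (@lipG_continuous _ _ (3 * 1)) => P Q.
    apply: (lipschitz_descent (f := fun p => h p.1.1)) => //.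
      by move=> th om x' /=; exact: hp.
    by move=> p q; rewrite mul1r; apply: le_trans (hl _ _) _; rewrite /dist1 -addrA lerDl addr_ge0.
  move=> Q; have [_ _ b _ _] := hw; rewrite normrM -[leRHS]mulr1 ler_pM //.
Qed.

Let a := law_field (@cos R).
Let b := law_field (@sin R).

Lemma law_cos_amplitude : amplitude (`|K| * Mw) (`|K| * Lw) a.
Proof.
apply: law_field_amplitude.
- exact: cos_lip.
- exact: cos_periodic2pi.
- by move=> s; rewrite ler_norml cos_geN1 cos_le1.
Qed.

Lemma law_sin_amplitude : amplitude (`|K| * Mw) (`|K| * Lw) b.
Proof.
apply: law_field_amplitude.
- exact: sin_lip.
- exact: sin_periodic2pi.
- by move=> s; rewrite ler_norml sin_geN1 sin_le1.
Qed.

Lemma law_wave t th x : wave a b t th x =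
  K * \int[law t]_Q (w x (site Q) * sin (phase Q - th)).
Proof.
have mU (s : R) : measurable_fun setT (@phase R) by exact: measurable_phase.
exact: (order_param_wave K hw (law1 t) mU t th x).
Qed.

Lemma law_velocity t P : 0 <= t <= T ->
  velocity K W rho t P = freq P + wave a b t (phase P) (site P).
Proof.
move=> tT; rewrite law_wave; apply: (velocityE K hw).
- exact: (weak_measurable hrho).
- by move=> Q; exact: (weak_ge0 hrho).
- by move=> A mA; rewrite hlaw // cut_id.
Qed.

Variables (X j Y : R -> R3 -> R).
Hypotheses (hX : is_flow T a b X) (hj : is_log_stretch T a b X j) (hY : is_backflow T X Y).
Let ha := law_cos_amplitude.
Let hb := law_sin_amplitude.

(** What the solution carries back along its own flow does not depend on time:
its pairing with the backward test function solves a trivial equation, tested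
against the deviation itself. *)
Lemma law_back_constant (k c e : R -> R) : phase_test k -> freq_test c -> site_test e ->
  forall t, 0 <= t <= T ->
    \int[law t]_P test_fun k c e (onG (Y t) P) = \int[law 0]_P test_fun k c e P.
Proof.
move=> hk hc he.
have [kl kl0 hkl] := phase_test_lipschitz hk.
have [k' [ck' dk kp k01]] := hk.
have [cc c01 [N hN]] := hc; have [ce e01] := he.
have M0 : 0 <= `|K| * Mw := amplitude_ge0 ha.
pose h (t : R) (P : G R) := back_test Y k c e t (coords P).
have hE t P : h t P = test_fun k c e (onG (Y t) P).
  rewrite /h /back_test /test_fun /onG phase_mkG freq_mkG site_mkG clamp_id ?site_itv //.
  have hpk : phase_periodic (fun p : R3 => k p.1.1) by move=> *; exact: kp.
  by rewrite (phase_periodic_wrap hpk (Y t (coords P)) 0 0).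
have h1 t P : `|h t P| <= 1.
  by rewrite hE; have /andP[h0 h1] := test_fun_itv (onG (Y t) P) hk hc he; rewrite ger0_norm.
have ch t : 0 <= t <= T -> continuous (h t).
  move=> /andP[t0 tT]; have tT1 : 0 <= t < T + 1 by rewrite t0 /=; lra.
  have := strip_descent (T := T + 1) (back_test_joint T0 ha hb hX hY dk hc he)
    (fun s => @back_test_periodic R T _ _ a b X Y T0 ha hb hX hY k c e kp s).
  by move=> /strip_slice /(_ tT1).
have mh t : 0 <= t <= T -> measurable_fun setT (h t).
  by move=> tT; apply: continuous_measurableG; exact: ch.
pose mm t := \int[law t]_P h (cut T t) P.
pose C := kl * (flow_lip T (`|K| * Mw) (`|K| * Lw) * (`|N| + 2 * (`|K| * Mw))).
have C0 : 0 <= C.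
  by rewrite mulr_ge0 // mulr_ge0 ?(flow_lip_ge0 T0' ha) // addr_ge0 // mulr_ge0.
have hd s t P : `|h s P - h t P| <= C * `|s - t|.
  rewrite /h /back_test -!mulrBl coordsE /=.
  have [/hN ->|hNf] := leP N `|freq P|.
    by rewrite mulr0 mul0r normr0 mulr_ge0.
  have [/andP[c0 c1] /andP[e0 e1]] := (c01 (freq P), e01 (site P)).
  rewrite !normrM (ger0_norm c0) (ger0_norm e0) -mulrA -[leRHS]mulr1.
  apply: ler_pM => //; first exact: mulr_ge0.
    apply: le_trans (hkl _ _) _; rewrite -mulrA ler_wpM2l //.
    apply: le_trans (backflow_dist_t T0' ha hb hX hY _ _ _) _ => /=.
    rewrite ler_wpM2r // ler_wpM2l ?(flow_lip_ge0 T0' ha) // lerD2r.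
    by rewrite (le_trans (ltW hNf)) // ler_norm.
  by rewrite -[leRHS]mulr1 ler_pM.
have cmm : continuous mm.
  move=> t; have ct := cut_itv t T0'.
  apply: (@continuous_at_of_bound _ _ _ (fun s => C * `|s - t| +
    `|\int[law s]_P h (cut T t) P - \int[law t]_P h (cut T t) P|)).
  - move=> s; have cs := cut_itv s T0'.
    have -> : mm s - mm t = (mm s - \int[law s]_P h (cut T t) P) +
      (\int[law s]_P h (cut T t) P - mm t) by ring.
    apply: le_trans (ler_normD _ _) _; rewrite lerD2r.
    apply: (Rint_dist (law1 s) (mh _ cs) (mh _ ct) (h1 _) (h1 _)) => P.
    by apply: le_trans (hd _ _ _) _; rewrite ler_wpM2l // cut_dist.
  - have cn (f : R -> R) (r : R) : continuous f -> continuous (fun z => `|f z - r|).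
      move=> cf; apply: (continuous_after (f := fun z => f z - r) _ (h := fun x : R => `|x|)).
        by apply: continuous_sub => //; exact: continuous_const.
      by move=> x; exact: norm_continuous.
    have : continuous (fun s => C * `|s - t| +
      `|\int[law s]_P h (cut T t) P - \int[law t]_P h (cut T t) P|).
      apply: continuous_add.
        by apply: continuous_mul; [exact: continuous_const|apply: cn; exact: continuous_ident].
      by apply: cn; exact: law_continuous (ch _ ct) (h1 _).
    exact.
  - by rewrite !subrr normr0 mulr0 addr0.
have cut0 : cut T 0 = 0 by rewrite cut_id // lexx.
suff main t : 0 <= t < T -> mm t = mm 0.
  have at_T : mm T = mm 0.
    apply/eqP; rewrite -subr_eq0 -normr_le0; apply/ler_addgt0Pr => r r0; rewrite add0r.
    have /cvgrPdist_le /(_ r r0) /nbhs_ballP[d /= d0 hd'] := cmm T.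
    pose s := T - Num.min d T / 2.
    have m0 : 0 < Num.min d T by rewrite lt_min d0.
    have mT : Num.min d T <= T by rewrite ge_min lexx orbT.
    have md : Num.min d T <= d by rewrite ge_min lexx.
    rewrite -(main s); last by rewrite /s; apply/andP; split; lra.
    apply: hd'; rewrite /ball /= /s opprB addrC subrK ger0_norm; lra.
  move=> t tT; have -> : \int[law t]_P test_fun k c e (onG (Y t) P) = mm t.
    by rewrite /mm cut_id //; apply: eq_Rintegral => P _; rewrite hE.
  have -> : \int[law 0]_P test_fun k c e P = mm 0.
    rewrite /mm cut0; apply: eq_Rintegral => P _; rewrite hE.
    by rewrite /onG (backflow0 T0' hX hY) mkG_coordsE.
  have /andP[t0] := tT; rewrite le_eqVlt => /predU1P[->|tT']; first exact: at_T.
  by apply: main; rewrite t0.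
move=> tT; pose T' := (t + T) / 2.
have [T'0 T'T] : 0 < T' /\ T' < T by case/andP: tT => *; rewrite /T'; split; lra.
pose D s := mm s - mm 0.
pose lam (s : R) := Num.max 0 (T' - s).
pose zeta s := D s * lam s.
have czeta : continuous zeta.
  apply: continuous_mul.
    by apply: continuous_sub => //; exact: continuous_const.
  move=> s; apply: (@continuous_max _ R (fun=> 0) (fun s : R => T' - s)); first exact: cvg_cst.
  by apply: cvgB; [exact: cvg_cst|exact: cvg_id].
(* With eta = Z T - Z the equation says that the integral of zeta (mm - mm 0)
   vanishes.  As zeta is this deviation times a weight, the integrand is
   nonnegative, so the deviation is zero wherever the weight is positive. *)
have [Z [Z0 dZ]] := exists_primitive czeta.
have Zconst s : T' <= s -> Z s = Z T'.
  move=> T's; apply/eqP; rewrite -subr_eq0 -normr_le0.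
  have := ler_variation (g := fun=> 0) (dg := fun=> 0) T's _ _ (fun r _ => dZ r) _ _.
  rewrite subrr; apply.
  - by apply: within_itv_continuous => r; exact: is_derive_continuous (dZ r).
  - by apply: within_itv_continuous; exact: continuous_const.
  - move=> r /andP[T'r _]; rewrite /zeta /lam (max_idPl _) ?mulr0 ?normr0 //.
    by rewrite subr_le0 ltW.
pose eta s := Z T - Z s.
pose deta s := - zeta s.
have dDeta (s : R) : is_derive s 1 eta (deta s).
  by have := is_derive_sub (is_derive_const (Z T) s) (dZ s); rewrite sub0r.
have cdeta : continuous deta by exact: continuous_opp.
have eta0 s : T' <= s -> eta s = 0.
  by move=> T's; rewrite /eta (Zconst s) // (Zconst T) ?subrr // ltW.
have T'I : 0 <= T' < T by rewrite (ltW T'0).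
have htest := back_test_function T0 ha hb hX hj hY ck' dk kp hc he T'I dDeta cdeta eta0.
have := weak_equation hrho htest.
have scal s (r : R) : 0 <= s <= T -> \int[vol]_P (rho s P * (r * h s P)) = r * mm s.
  move=> sT; transitivity (\int[law s]_P (r * h s P)).
    rewrite (@Rint_law s (fun P => r * h s P) `|r|).
    - by apply: eq_Rintegral => P _; rewrite cut_id // mulrC.
    - by apply: measurable_funM; [exact: measurable_cst|exact: mh].
    - by move=> P; rewrite normrM -[leRHS]mulr1 ler_pM.
  rewrite /mm cut_id // RintegralZl //.
  exact: (bounded_integrable (law1 s) (mh s sT) (h1 s)).
have -> : \int[vol]_P (rho 0 P * back_w Y k c e eta (0, P)) = Z T * mm 0.
  by rewrite -scal ?lexx //; apply: eq_Rintegral => P _; rewrite /back_w /eta Z0 subr0.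
have cf : continuous (fun s => deta s * mm s) by exact: continuous_mul.
have [Nn [Nn0 dNn]] := exists_primitive cf.
have -> : \int[lebesgue_measure]_(s in `[0, T[) (\int[vol]_P (rho s P *
    (back_wt T a b j Y k k' c e eta deta (s, P) +
     velocity K W rho s P * back_wth T j Y k' c e eta (s, P)))) = Nn T.
  transitivity (\int[lebesgue_measure]_(s in `[0, T[) (deta s * mm s)); last first.
    by rewrite /Rintegral (integral_co 0 T cf) (FTC2 T0 cf dNn) /= Nn0 subr0.
  apply: eq_Rintegral => s; rewrite inE /= in_itv /= => /andP[s0 sT].
  have sT' : 0 <= s <= T by rewrite s0 ltW.
  rewrite -(scal s (deta s) sT'); apply: eq_Rintegral => P _.
  by rewrite law_velocity //; congr (_ * _); exact: back_rate.
move=> hsum.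
pose S s := - Nn s - mm 0 * Z s.
have dS (s : R) : is_derive s 1 S (D s ^+ 2 * lam s).
  have := is_derive_sub (is_derive_scale (-1) (dNn s)) (is_derive_scale (mm 0) (dZ s)).
  have -> : (fun r : R => -1 * Nn r - mm 0 * Z r) = S by apply/funext => r; rewrite mulN1r.
  by congr (is_derive _ _ _ _); rewrite /deta /zeta /D; ring.
have cS : continuous S by move=> s; exact: is_derive_continuous (dS s).
have S0 : S 0 = 0 by rewrite /S Nn0 Z0 mulr0 subr0 oppr0.
have ST : S T = 0 by rewrite /S -opprD (mulrC (mm 0)) hsum oppr0.
have Smono (x y : R) : x <= y -> S x <= S y.
  move=> xy; rewrite -subr_ge0.
  have := ler_variation (f := fun=> 0) (df := fun=> 0) xy _ _ _ (fun r _ => dS r) _.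
  rewrite subrr normr0; apply.
  - by apply: within_itv_continuous; exact: continuous_const.
  - exact: within_itv_continuous.
  - by move=> r _; rewrite ?normr0 mulr_ge0 ?sqr_ge0 // /lam le_max lexx.
have Szero s : 0 <= s <= T -> S s = 0.
  move=> /andP[s0 sT]; apply/eqP; rewrite eq_le.
  by rewrite -{1}ST Smono //= -S0 Smono.
have /andP[t0 tT0] := tT.
have := @locally0_derive R S t _ (T - t) _ _ (dS t); rewrite subr_gt0 => /(_ tT0) hl.
have {hl} /eqP : D t ^+ 2 * lam t = 0.
  apply: hl => r /andP[r0 rT]; apply: Szero; apply/andP; split; lra.
rewrite mulf_eq0 sqrf_eq0 subr_eq0 => /orP[/eqP //|/eqP].
have lt0 : 0 < lam t by rewrite /lam lt_max subr_gt0 /T'; apply/orP; right; lra.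
by move=> l0; move: lt0; rewrite l0 ltxx.
Qed.

(** By test_determines and law_back_constant, the image of the solution under its
own backward flow is its initial law. *)
Lemma law_image t A : 0 <= t <= T -> measurable A -> law t A = law 0 (onG (X t) @^-1` A).
Proof.
move=> tT mA.
have mX : measurable_fun setT (onG (X t)).
  by apply: continuous_measurableGG; exact: (flowG_continuous T0' ha hb hX).
have mY : measurable_fun setT (onG (Y t)).
  by apply: continuous_measurableGG; exact: (backflowG_continuous T0' ha hb hX hY).
have [m [hm him]] := image_probability (law t) mY.
have mXA : measurable (onG (X t) @^-1` A) by rewrite -[X in measurable X]setTI; exact: mX.
have eqm B : measurable B -> law 0 B = m B.
  have fin : (law 0 setT < +oo)%E by rewrite -ge0_fin_numE // law1.
  move=> mB; apply: (@test_determines _ (law 0) m fin _ _ mB) => k c e hk hc he.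
  have mt : measurable_fun setT (test_fun k c e) := measurable_test hk hc he.
  have t1 P : `|test_fun k c e P| <= 1.
    by have /andP[h0 h1] := test_fun_itv P hk hc he; rewrite ger0_norm.
  rewrite (integral_Rint (law1 0) mt t1) (integral_Rint (@probability_setT _ _ _ m) mt t1).
  by congr EFin; rewrite (him _ 1 mt t1) (law_back_constant hk hc he tT).
rewrite eqm // hm //; congr (law t _).
by apply/seteqP; split => P /=; rewrite (flowGK T0' ha hb hX hY _ tT).
Qed.

(** The average that defines the velocity, taken against an image under the flow,
is an average over the initial law. *)
Lemma law_mean_field : is_mean_field K w (law 0) T X.
Proof.
have M0 := amplitude_ge0 ha.
split; first by move=> p; exact: (flow0 hX).
  move=> t p; have := (hX p).2 t.
  set s := cut T t; have sT : 0 <= s <= T by exact: cut_itv.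
  have -> // : wave a b s (X s p) p.2 = drift K w (law 0) (X s) p.
  rewrite law_wave /drift; congr (_ * _).
  have mX : measurable_fun setT (onG (X s)).
    by apply: continuous_measurableGG; exact: (flowG_continuous T0' ha hb hX).
  have [m [hm him]] := image_probability (law 0) mX.
  transitivity (\int[m]_Q (w p.2 (site Q) * sin (phase Q - X s p))).
    rewrite /Rintegral; congr fine; apply: eq_measure_integral => A mA _.
    by rewrite [RHS]hm //; exact: law_image sT mA.
  rewrite (him _ Mw (kernel_measurableG hw _ _) (fun Q => kernel_boundG hw _ _ _)).
  apply: eq_Rintegral => Q _; rewrite site_onG /onG phase_mkG; congr (_ * _).
  have hp : phase_periodic (fun q : R3 => sin (q.1.1 - X s p)).
    by move=> th om x /=; rewrite addrAC sin_periodic2pi.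
  exact: (phase_periodic_wrap hp _ 0 0).
move=> t tT; apply: (@shift_measurable _ _ (flow_lip T (`|K| * Mw) (`|K| * Lw))).
- exact: (flow_lip_ge0 T0' ha).
- exact: (flow_shift T0' ha hb hX tT).
- by move=> p q; exact: (flow_dist T0' ha hb hX p q tT).
Qed.

End weak_law.

Section uniqueness.
Context {R : realType}.
Notation R3 := (R * R * R)%type.
Variables (K Mw Lw T : R) (W : R * R -> R) (g : R -> R) (rho0 : G R -> R).
Let w (x y : R) := W (clamp x, clamp y).
Hypotheses (hw : is_coupling Mw Lw w) (T0 : 0 < T).
Variable m0 : probability (G R) R.
Hypothesis hm0 : forall A, measurable A ->
  (m0 A = \int[vol]_(P in A) (initial_density g rho0 P)%:E)%E.

(** Every weak solution is carried by a mean-field motion; uniqueness of the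
solution is thereby reduced to uniqueness of the motion. *)
Lemma weak_solution_mean_field (rho : R -> G R -> R) : is_weak_solution K W g rho0 T rho ->
  exists u : R -> R3 -> R, is_mean_field K w m0 T u /\
  forall (t : R) A, 0 <= t <= T -> measurable A ->
    (\int[vol]_(P in A) (rho t P)%:E = m0 (onG (u t) @^-1` A))%E.
Proof.
move=> hrho; have T0' : 0 <= T by exact: ltW.
have /choice[law hlaw] : forall t, exists m : probability (G R) R, forall A, measurable A ->
    (m A = \int[vol]_(P in A) (rho (cut T t) P)%:E)%E.
  move=> t; have tT := cut_itv t T0'; apply: density_probability.
  - exact: (weak_measurable hrho).
  - by move=> P; exact: (weak_ge0 hrho).
  - exact: (weak_mass hrho).
have ha := law_cos_amplitude hw T0 hrho hlaw.
have hb := law_sin_amplitude hw T0 hrho hlaw.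
have [X hX] := flow_exists T0' ha hb.
have [j hj] := log_stretch_exists ha hb hX.
have [Y hY] := backflow_exists T0' ha hb hX.
have law0 A : measurable A -> law 0 A = m0 A.
  move=> mA; rewrite hlaw // hm0 // cut_id ?lexx //.
  by apply: eq_integral => P _; rewrite (weak_init hrho).
have [X0 dX mX] := law_mean_field hw T0 hrho hlaw hX hj hY.
exists X; split.
  split => // t p; have := dX t p.
  have -> // : drift K w (law 0) (X (cut T t)) p = drift K w m0 (X (cut T t)) p.
  rewrite /drift /Rintegral; congr (_ * fine _).
  by apply: eq_measure_integral => A mA _; exact: law0.
move=> t A tT mA; rewrite -[in LHS](cut_id tT) -hlaw //.
rewrite (law_image hw T0 hrho hlaw hX hj hY tT mA) law0 //.
rewrite -[X in measurable X]setTI.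
apply: (continuous_measurableGG (flowG_continuous T0' ha hb hX tT)) => //.
Qed.

Lemma weak_solution_unique (rho rho' : R -> G R -> R) :
  is_weak_solution K W g rho0 T rho -> is_weak_solution K W g rho0 T rho' ->
  forall t : R, 0 <= t <= T -> {ae vol, forall P, rho' t P = rho t P}.
Proof.
move=> hr hr' t tT.
have [u [hu iu]] := weak_solution_mean_field hr.
have [v [hv iv]] := weak_solution_mean_field hr'.
have m1 : m0 setT = 1%E by exact: probability_setT.
have uv : u t = v t.
  by apply/funext => p; exact: (mean_field_unique hw m1 (ltW T0) hu hv).
have mr := weak_measurable hr tT; have mr' := weak_measurable hr' tT.
have ir' : vol.-integrable setT (EFin \o rho' t).
  apply/integrableP; split; first exact/measurable_EFinP.
  rewrite (eq_integral (fun P => (rho' t P)%:E)); last first.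
    by move=> P _; rewrite /= ger0_norm // (weak_ge0 hr').
  by rewrite (weak_mass hr') // ltry.
have mer : measurable_fun setT (EFin \o rho t) by exact/measurable_EFinP.
have h := integral_ae_eq measurableT ir' mer _.
have {h} : ae_eq vol setT (EFin \o rho' t) (EFin \o rho t).
  by apply: h => A _ mA; rewrite [LHS](iv t A tT mA) [RHS](iu t A tT mA) uv.
by apply: filterS => P /(_ I) [].
Qed.

End uniqueness.

(** * Convergence of the empirical measures *)

Section bounded_lipschitz.
Context {R : realType}.
Implicit Types (f : G R -> R) (m : {measure set (G R) -> \bar R}).

Lemma BL_continuous f : BL f -> continuous f.
Proof. by move=> [_ hf]; apply: (@lipG_continuous _ _ 1) => P Q; rewrite mul1r. Qed.

Lemma BL_bound f P : BL f -> `|f P| <= 1.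
Proof. by move=> [/(_ P)/andP[f0 f1] _]; rewrite ger0_norm. Qed.

Lemma bl_dist_ge m1 m2 f : m1 setT = 1%E -> m2 setT = 1%E -> BL f ->
  `|\int[m1]_P f P - \int[m2]_P f P| <= bl_dist m1 m2.
Proof.
move=> h1 h2 hf; apply: ub_le_sup; last by exists f.
exists (1 + 1) => _ [h hh <-].
have mh : measurable_fun setT h by apply: continuous_measurableG; exact: BL_continuous.
apply: le_trans (ler_normB _ _) _.
by apply: lerD; apply: Rint_bound => // P; exact: BL_bound.
Qed.

Lemma bl_dist_le m1 m2 (D : R) :
  (forall f, BL f -> `|\int[m1]_P f P - \int[m2]_P f P| <= D) -> bl_dist m1 m2 <= D.
Proof.
move=> h; apply: ge_sup; last by move=> _ [f hf <-]; exact: h.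
exists `|\int[m1]_P (fun=> 0) P - \int[m2]_P (fun=> 0) P|, (fun=> 0) => //.
split=> [P|P Q]; first by rewrite lexx ler01.
by rewrite subrr normr0 /dG sqrtr_ge0.
Qed.

Section empirical.
Variables (n : nat) (q : nat -> G R).
Hypothesis n0 : (0 < n)%N.

Lemma empirical_mass : empirical n q setT = 1%E.
Proof.
transitivity ((n%:R^-1)%:E * \sum_(i < n) (dirac (q i) setT : \bar R))%E; first by [].
under eq_bigr do rewrite diracT.
rewrite sumEFin sumr_const card_ord /= -EFinM mulVf //.
by rewrite pnatr_eq0 -lt0n.
Qed.

Lemma empirical_Rint f : measurable_fun setT f -> (forall P, 0 <= f P) ->
  \int[empirical n q]_P f P = n%:R^-1 * \sum_(i < n) f (q i).
Proof.
move=> mf f0; have mef : measurable_fun setT (fun P => (f P)%:E) by exact/measurable_EFinP.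
rewrite /Rintegral /empirical ge0_integral_mscale //.
  rewrite ge0_integral_measure_sum //; last by move=> P _; rewrite lee_fin.
  under eq_bigr do rewrite integral_dirac // diracT mul1e.
  by rewrite sumEFin.
by move=> P _; rewrite lee_fin.
Qed.

(** A bounded Lipschitz observable becomes an element of BL after an affine
change, so its averages are controlled by the distance. *)
Lemma empirical_dist m f (B L : R) : m setT = 1%E -> 0 <= L ->
  (forall P, `|f P| <= B) -> (forall P Q, `|f P - f Q| <= L * dG P Q) ->
  `|n%:R^-1 * \sum_(i < n) f (q i) - \int[m]_P f P| <=
  (2 * B + L + 1) * bl_dist (empirical n q) m.
Proof.
move=> m1 L0 fB fL; set C := 2 * B + L + 1.
have B0 : 0 <= B by apply: le_trans (fB (q 0)).
have C0 : 0 < C by rewrite /C ltr_wpDl // addr_ge0 // mulr_ge0.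
have cf : continuous f by exact: lipG_continuous fL.
have mf : measurable_fun setT f := continuous_measurableG cf.
pose h P := (f P + B) / C.
have hh : BL h.
  split=> [P|P Q].
    have := fB P; rewrite ler_norml => /andP[f0 f1].
    rewrite /h divr_ge0 ?(ltW C0) ?ler_pdivrMr //; last by lra.
    by rewrite /C mul1r; lra.
  have -> : h P - h Q = (f P - f Q) / C by rewrite /h -mulrBl; congr (_ / _); ring.
  rewrite normrM (gtr0_norm (_ : 0 < C^-1)) ?invr_gt0 // ler_pdivrMr //.
  apply: le_trans (fL P Q) _; rewrite mulrC ler_wpM2l ?sqrtr_ge0 // /C.
  by rewrite -addrA addrCA lerDl; lra.
have mh : measurable_fun setT h by apply: continuous_measurableG; exact: BL_continuous.
have := bl_dist_ge empirical_mass m1 hh.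
rewrite (empirical_Rint mh); last by move=> P; case: hh => /(_ P)/andP[].
have -> : \int[m]_P h P = (\int[m]_P f P + B) / C.
  have if_ := bounded_integrable m1 mf fB.
  have ic : m.-integrable setT (EFin \o (fun=> B : R)).
    by apply: (@bounded_integrable _ _ _ m m1 (fun=> B) `|B|) => //; exact: measurable_cst.
  rewrite /h RintegralZr //.
    by rewrite RintegralD // Rintegral_cst // m1 mulr1.
  have := integrableD measurableT if_ ic.
  by apply: eq_integrable => // P _.
have -> : n%:R^-1 * (\sum_(i < n) h (q i)) = (n%:R^-1 * (\sum_(i < n) f (q i)) + B) / C.
  rewrite /h -mulr_suml big_split /= sumr_const card_ord mulrA mulrDr.
  by rewrite -[B *+ n]mulr_natl mulKf // pnatr_eq0 -lt0n.
rewrite -mulrBl opprD addrACA subrr addr0 normrM (gtr0_norm (_ : 0 < C^-1)) ?invr_gt0 //.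
by rewrite ler_pdivrMr // => bound; rewrite [leRHS]mulrC.
Qed.

End empirical.

End bounded_lipschitz.

Section convergence.
Context {R : realType}.
Notation R3 := (R * R * R)%type.
Variables (K Mw Lw T : R) (W : R * R -> R).
Let w (x y : R) := W (clamp x, clamp y).
Hypotheses (hw : is_coupling Mw Lw w) (T0 : 0 < T).
Variables (m0 : probability (G R) R) (u : R -> R3 -> R).
Hypothesis hu : is_mean_field K w m0 T u.

Let T0' : 0 <= T. Proof. exact: ltW. Qed.
Let m1 : m0 setT = 1%E. Proof. exact: probability_setT. Qed.
Let Mw0 : 0 <= Mw. Proof. by case: hw. Qed.
Let Lw0 : 0 <= Lw. Proof. by case: hw. Qed.

Definition mean_field_lip : R := flow_lip T (`|K| * Mw) (`|K| * Lw).
Let ell := mean_field_lip.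

Lemma mean_field_lip_ge0 : 0 <= ell.
Proof.
have [ha _ _ _] := mean_field_flow hw m1 T0' hu.
exact: (flow_lip_ge0 T0' ha).
Qed.

Lemma mean_field_dist t p q : 0 <= t <= T -> `|u t p - u t q| <= ell * dist1 p q.
Proof.
by move=> tT; have [ha hb hX _] := mean_field_flow hw m1 T0' hu; exact: (flow_dist T0' ha hb hX p q tT).
Qed.

Lemma mean_field_shift t : 0 <= t <= T -> shift_periodic (u t).
Proof.
by move=> tT; have [ha hb hX _] := mean_field_flow hw m1 T0' hu; exact: (flow_shift T0' ha hb hX tT).
Qed.

Lemma mean_field_onG_dist t P Q : 0 <= t <= T ->
  dG (onG (u t) P) (onG (u t) Q) <= 3 * (ell + 1) * dG P Q.
Proof.
move=> tT; have [ha hb hX _] := mean_field_flow hw m1 T0' hu.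
exact: (flowG_lipschitz T0' ha hb hX P Q tT).
Qed.

Definition kernel_lip : R := 3 * (Lw + Mw * ell).

(** The interaction kernel seen from a fixed phase c is a Lipschitz observable of
the initial point, uniformly in time. *)
Lemma kernel_lipschitz t (x c : R) P Q : 0 <= t <= T ->
  `|w x (site P) * sin (u t (coords P) - c) - w x (site Q) * sin (u t (coords Q) - c)|
  <= kernel_lip * dG P Q.
Proof.
move=> tT; have l0 := mean_field_lip_ge0.
apply: (lipschitz_descent (f := fun p => w x p.2 * sin (u t p - c))).
- by rewrite addr_ge0 // mulr_ge0.
- move=> th om y /=; rewrite (mean_field_shift tT) -(sin_periodic2pi (u t (th, om, y) - c)).
  by congr (_ * sin _); ring.
move=> p q; set s := u t p - c; set r := u t q - c.
have [_ _ b _ l] := hw.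
have -> : w x p.2 * sin s - w x q.2 * sin r =
  (w x p.2 - w x q.2) * sin s + w x q.2 * (sin s - sin r) by ring.
apply: le_trans (ler_normD _ _) _; rewrite !normrM mulrDl; apply: lerD.
  rewrite -[leRHS]mulr1 ler_pM //.
    by apply: le_trans (l _ _ _) _; rewrite ler_wpM2l // /dist1 lerDr addr_ge0.
  by rewrite ler_norml sin_geN1 sin_le1.
rewrite -mulrA; apply: ler_pM => //; apply: le_trans (sin_lip _ _) _.
have -> : s - r = u t p - u t q by rewrite /s /r; ring.
exact: mean_field_dist.
Qed.

Section particles.
Variables (n : nat) (xi om th0 : nat -> R) (th : nat -> R -> R).
Hypotheses (n0 : (0 < n)%N) (hxi : forall i, (i < n)%N -> 0 <= xi i <= 1).
Hypothesis hth : kuramoto_solution K W n xi om th0 th.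

Let point i : R3 := (th0 i, om i, xi i).
Let start i : G R := mkG (th0 i) (om i) (xi i).
Let delta := bl_dist (empirical n start) m0.

Definition particle_rate : R := `|K| * (2 * Mw + kernel_lip + 1).

Let avg_bound (f : nat -> R) (D : R) : (forall i, (i < n)%N -> `|f i| <= D) ->
  `|n%:R^-1 * \sum_(i < n) f i| <= D.
Proof.
move=> h; have n00 : 0 < n%:R :> R by rewrite ltr0n.
rewrite normrM gtr0_norm ?invr_gt0 // mulrC ler_pdivrMr //.
apply: le_trans (ler_norm_sum _ _ _) _.
apply: (@le_trans _ _ (\sum_(i < n) D)); first by apply: ler_sum => i _; exact: h.
by rewrite sumr_const card_ord mulr_natr.
Qed.

Let avg_dist (f g : nat -> R) (D : R) : (forall i, (i < n)%N -> `|f i - g i| <= D) ->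
  `|n%:R^-1 * \sum_(i < n) f i - n%:R^-1 * \sum_(i < n) g i| <= D.
Proof. by move=> h; rewrite -mulrBr -sumrB; exact: (avg_bound (f := fun i => f i - g i)). Qed.

Lemma delta_ge0 : 0 <= delta.
Proof.
have h0 : BL (fun=> 0 : R).
  split=> [P|P Q]; first by rewrite lexx ler01.
  by rewrite subrr normr0 /dG sqrtr_ge0.
exact: le_trans (bl_dist_ge (empirical_mass start n0) m1 h0).
Qed.

Let kur_rate i t := K * n%:R^-1 * \sum_(j < n) W (xi i, xi j) * sin (th j t - th i t).

(** Each oscillator follows the characteristic that starts at its initial
point: the interaction differs from the mean field by the mutual deviations
and by the distance of the initial laws. *)
Lemma particle_close i t : (i < n)%N -> 0 <= t <= T ->
  `|th i t - u t (point i)| <=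
  2 * (particle_rate * delta * T) * expR ((2 * (2 * `|K| * Mw) + 1) * T).
Proof.
move=> im tT; have [u0 du mu] := hu.
have d0 := delta_ge0.
have l0 := mean_field_lip_ge0.
have kl0 : 0 <= kernel_lip by rewrite mulr_ge0 // addr_ge0 // mulr_ge0.
have M20 : 0 <= 2 * `|K| * Mw by rewrite !mulr_ge0.
have e0 : 0 <= particle_rate * delta.
  by rewrite mulr_ge0 // mulr_ge0 // !addr_ge0 // mulr_ge0.
have wE i' j' : (i' < n)%N -> (j' < n)%N -> W (xi i', xi j') = w (xi i') (xi j').
  by move=> hi hj; rewrite /w !clamp_id ?hxi.
have s1 s : `|sin s| <= 1 :> R by rewrite ler_norml sin_geN1 sin_le1.
have kur_bound i' s : (i' < n)%N -> `|kur_rate i' s| <= `|K| * Mw.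
  move=> hi; rewrite /kur_rate -mulrA normrM ler_wpM2l //.
  apply: (@avg_bound (fun j => W (xi i', xi j) * sin (th j s - th i' s)) Mw) => j hj.
  rewrite (wE _ _ hi hj) normrM.
  by have [_ _ b _ _] := hw; rewrite -[leRHS]mulr1 ler_pM.
have cth i' : (i' < n)%N -> {within `[0, T], continuous (th i')}.
  move=> hi; have [_ c _] := hth hi; apply: continuous_subspaceW c => s /=.
  by rewrite !in_itv /= andbT => /andP[].
have cu p : {within `[0, T], continuous (u ^~ p)}.
  by apply: within_itv_continuous => s; exact: is_derive_continuous (du s p).
pose I := {i : nat | (i < n)%N}.
pose y (z : I) s := th (sval z) s - u s (point (sval z)).
pose dy (z : I) s := kur_rate (sval z) s - drift K w m0 (u s) (point (sval z)).
have cy z : {within `[0, T], continuous (y z)}.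
  move=> s; apply: continuousB; [exact: cth (svalP z) s|exact: cu].
have hy z (s : R) : 0 < s < T -> is_derive s 1 (y z) (dy z s).
  move=> /andP[s0' sT]; have [_ _ d] := hth (svalP z).
  have := is_derive_sub (d s s0') (du s (point (sval z))).
  rewrite cut_id ?(ltW s0') ?(ltW sT) //= -/(kur_rate (sval z) s).
  by rewrite opprD addrACA subrr add0r.
have y0 z : `|y z 0| <= 0.
  have [h _ _] := hth (svalP z).
  by rewrite /y h u0 subrr normr0.
have yB z s : 0 <= s <= T -> `|y z s| <= 2 * `|K| * Mw * T.
  move=> /andP[s0' sT].
  have := ler_variation (f := y z) (df := dy z) (g := fun s => 2 * `|K| * Mw * s)
     (dg := fun=> 2 * `|K| * Mw) s0' _ _ _ _ _.
  have := y0 z; rewrite normr_le0 => /eqP ->; rewrite subr0 mulr0 subr0 => h.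
  apply: le_trans (h _ _ _ _ _) _.
  - by apply: continuous_subspaceW (cy z) => r /=; rewrite !in_itv /= => /andP[-> h']; exact: le_trans sT.
  - by apply: within_itv_continuous; apply: continuous_mul; [exact: continuous_const|exact: continuous_ident].
  - by move=> r /andP[r0 rs]; apply: hy; rewrite r0 (lt_le_trans rs).
  - by move=> r _; have := is_derive_scale (2 * `|K| * Mw) (is_derive_ident r); rewrite mulr1.
  - move=> r /andP[r0 rs]; apply: le_trans (ler_normB _ _) _.
    have rT : 0 <= r <= T by rewrite (ltW r0) (le_trans (ltW rs)).
    rewrite -mulrA mulr_natl mulr2n; apply: lerD; first exact: kur_bound (svalP z).
    exact: (drift_bound K hw m1 _ (mu r rT)).
  - by rewrite ler_wpM2l.
have hdy s (E : R) : 0 < s < T -> (forall z, `|y z s| <= E) ->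
    forall z, `|dy z s| <= 2 * `|K| * Mw * E + particle_rate * delta.
  move=> /andP[s0' sT] hE [i' hi]; rewrite /dy /=.
  have {s0' sT} sT : 0 <= s <= T by rewrite (ltW s0') ltW.
  have E0 : 0 <= E by apply: le_trans (hE (exist _ i' hi)).
  pose c := u s (point i').
  pose f Q := w (xi i') (site Q) * sin (u s (coords Q) - c).
  have fstart j : (j < n)%N -> f (start j) = w (xi i') (xi j) * sin (u s (point j) - c).
    move=> hj; rewrite /f /start site_mkG.
    have wc : w (xi i') (clamp (xi j)) = w (xi i') (xi j).
      by rewrite /w [in LHS](clamp_id (clamp_itv (xi j))).
    rewrite wc; congr (_ * _).
    have hp : phase_periodic (fun p : R3 => sin (u s p - c)).
      move=> th' om' y'; rewrite (mean_field_shift sT) -(sin_periodic2pi (u s (th', om', y') - c)).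
      by congr (sin _); ring.
    by rewrite (phase_periodic_mkG hp) clamp_id // hxi.
  have hf := empirical_dist start n0 m1 kl0 (fun Q => kernel_boundG hw (xi i') (site Q) (u s (coords Q) - c))
     (fun P Q => kernel_lipschitz (xi i') c P Q sT).
  have -> : kur_rate i' s - drift K w m0 (u s) (point i') =
    K * (n%:R^-1 * (\sum_(j < n) W (xi i', xi j) * sin (th j s - th i' s)) -
         n%:R^-1 * \sum_(j < n) f (start j)) +
    K * (n%:R^-1 * (\sum_(j < n) f (start j)) - \int[m0]_Q f Q).
    by rewrite -mulrDr addrA subrK /kur_rate -mulrA -mulrBr.
  apply: le_trans (ler_normD _ _) _; rewrite !normrM; apply: lerD; last first.
    by rewrite /particle_rate -mulrA ler_wpM2l.
  rewrite [2 * _]mulrC -!mulrA ler_wpM2l //.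
  apply: (@avg_dist (fun j => W (xi i', xi j) * sin (th j s - th i' s)) (fun j => f (start j))) => j hj.
  rewrite (fstart j hj) (wE _ _ hi hj) -mulrBr normrM.
  have [_ _ b _ _] := hw; rewrite mulrCA; apply: ler_pM => //.
  apply: le_trans (sin_lip _ _) _.
  have -> : th j s - th i' s - (u s (point j) - c) =
    y (exist _ j hj) s - y (exist _ i' hi) s by rewrite /y /c /=; ring.
  by apply: le_trans (ler_normB _ _) _; rewrite mulr_natl mulr2n lerD.
have := @gronwall R I y dy T (2 * `|K| * Mw) (particle_rate * delta) 0 (2 * `|K| * Mw * T)
  M20 e0 cy hy y0 yB hdy (exist _ i im) t tT.
by rewrite add0r.
Qed.

Definition particle_growth : R :=
  2 * (particle_rate * T) * expR ((2 * (2 * `|K| * Mw) + 1) * T) + (2 + 3 * (ell + 1) + 1).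

(** The observable is moved from the particles to the trajectories that start at
the same points, and its average over these is an average of a Lipschitz
function over the initial empirical measure. *)
Lemma empirical_close (m : probability (G R) R) t : 0 <= t <= T ->
  (forall A, measurable A -> m A = m0 (onG (u t) @^-1` A)) ->
  bl_dist (empirical n (fun i => mkG (th i t) (om i) (xi i))) m <= particle_growth * delta.
Proof.
move=> tT hm; have l0 := mean_field_lip_ge0.
have [ha hb hX _] := mean_field_flow hw m1 T0' hu.
have mX : measurable_fun setT (onG (u t)).
  by apply: continuous_measurableGG; exact: (flowG_continuous T0' ha hb hX).
have [m' [hm' him]] := image_probability m0 mX.
apply: bl_dist_le => f hf.
have mf : measurable_fun setT f by apply: continuous_measurableG; exact: BL_continuous.
have f1 P : `|f P| <= 1 by exact: BL_bound.
have [f01 fl] := hf.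
rewrite empirical_Rint //; last by move=> P; have /andP[] := f01 P.
have -> : \int[m]_P f P = \int[m0]_P f (onG (u t) P).
  rewrite -(him f 1 mf f1) /Rintegral; congr fine; apply: eq_measure_integral => A mA _.
  by rewrite [LHS]hm // [RHS]hm'.
pose h P := f (onG (u t) P).
have L0 : 0 <= 3 * (ell + 1) by rewrite mulr_ge0 // addr_ge0.
have hl P Q : `|h P - h Q| <= 3 * (ell + 1) * dG P Q.
  by apply: le_trans (fl _ _) _; exact: mean_field_onG_dist.
have h2 := empirical_dist start n0 m1 L0 (fun P => f1 (onG (u t) P)) hl.
set Eg := 2 * (particle_rate * delta * T) * expR ((2 * (2 * `|K| * Mw) + 1) * T).
have h3 : `|n%:R^-1 * (\sum_(i < n) f (mkG (th i t) (om i) (xi i))) -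
   n%:R^-1 * (\sum_(i < n) h (start i))| <= Eg.
  apply: (@avg_dist (fun i => f (mkG (th i t) (om i) (xi i))) (fun i => h (start i))) => i hi.
  apply: le_trans (fl _ _) _; rewrite /start onG_mkG; last exact: mean_field_shift.
  rewrite clamp_id ?hxi //; apply: le_trans (dG_mkG_le _ _ _ _ _ _) _.
  by rewrite !subrr normr0 !addr0; exact: particle_close.
have -> : n%:R^-1 * (\sum_(i < n) f (mkG (th i t) (om i) (xi i))) - \int[m0]_P h P =
  (n%:R^-1 * (\sum_(i < n) f (mkG (th i t) (om i) (xi i))) - n%:R^-1 * (\sum_(i < n) h (start i))) +
  (n%:R^-1 * (\sum_(i < n) h (start i)) - \int[m0]_P h P) by ring.
apply: le_trans (ler_normD _ _) _; apply: le_trans (lerD h3 h2) _.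
by rewrite /Eg /particle_growth mulr1 le_eqVlt; apply/orP; left; apply/eqP; rewrite -/delta; ring.
Qed.

End particles.

End convergence.

(** * Well-posedness and the mean-field limit *)

Theorem theorem2p2 (R : realType) (K : R) (W : R * R -> R)
    (g : R -> R) (rho0 : G R -> R) (xi : nat -> nat -> R)
    (d : measure_display) (Omega : measurableType d) (Pr : probability Omega R)
    (om : nat -> {RV Pr >-> R}) (th0 : nat -> nat -> {RV Pr >-> R})
    (hxi : equidistributed xi)
    (hg : is_continuous_pdf g)
    (hrho0 : is_conditional_density rho0)
    (hom : iid_with_density om g)
    (hth0 : conditionally_sampled om th0 xi rho0)
    (Wsym : forall x y : R, 0 <= x <= 1 -> 0 <= y <= 1 -> W (x, y) = W (y, x))
    (Wlip : [lipschitz W z | z in `[0, 1] `*` `[0, 1]])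
    (T : R) (T_gt0 : 0 < T) :
  exists rho : R -> G R -> R,
    [/\ is_weak_solution K W g rho0 T rho,
        (forall rho', is_weak_solution K W g rho0 T rho' ->
           forall t : R, 0 <= t <= T -> {ae vol, forall P, rho' t P = rho t P}) &
        exists mu : R -> probability (G R) R,
          (forall (t : R) (A : set (G R)), 0 <= t <= T -> measurable A ->
             (mu t A = \int[vol]_(P in A) (rho t P)%:E)%E) /\
          (forall (o : Omega) (th : nat -> nat -> R -> R),
             (forall n, kuramoto_solution K W n (xi n) (fun i => om i o)
                          (fun i => th0 n i o) (th n)) ->
             let mun n t : {measure set G R -> \bar R} :=
               empirical n (fun i => mkG (th n i t) (om i o) (xi n i)) in
             bl_dist (mun n 0) (mu 0) @[n --> \oo] --> 0 ->
             forall e : R, 0 < e -> \forall n \near \oo,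
               forall t : R, 0 <= t <= T -> bl_dist (mun n t) (mu t) < e)].
Proof.
have T0' : 0 <= T by exact: ltW.
have [Mw [Lw hw]] := coupling_exists Wlip.
have [m0 hm0] := density_probability
  (continuous_measurableG (initial_density_continuous hg hrho0))
  (initial_density_ge0 hg hrho0) (initial_density_mass hg hrho0).
have m1 : m0 setT = 1%E by exact: probability_setT.
have [u hu] := mean_field_exists K hw m1 T0'.
have [rho [hrho himage]] := mean_field_weak_solution hw T_gt0 hg hrho0 hm0 hu.
exists rho; split => //.
  by move=> rho' hrho'; exact: (weak_solution_unique hw T_gt0 hm0 hrho hrho').
have [ha hb hX _] := mean_field_flow hw m1 T0' hu.
have /choice[mu hmu] : forall t, exists m : probability (G R) R,
    forall A, measurable A -> m A = m0 (onG (u (cut T t)) @^-1` A).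
  move=> t; have [m [hm _]] : exists m : probability (G R) R,
      (forall A, measurable A -> m A = m0 (onG (u (cut T t)) @^-1` A)) /\ _ :=
    image_probability m0 (continuous_measurableGG
      (flowG_continuous T0' ha hb hX (cut_itv t T0'))).
  by exists m.
have hmuT t A : 0 <= t <= T -> measurable A -> mu t A = m0 (onG (u t) @^-1` A).
  by move=> tT mA; rewrite hmu // cut_id.
exists mu; split; first by move=> t A tT mA; rewrite himage // hmuT.
move=> o th hth mun hmun e e0.
have mu0 A : measurable A -> m0 A = mu 0 A.
  move=> mA; rewrite hmuT ?lexx //; congr (m0 _).
  by apply/seteqP; split => P /=; rewrite /onG (flow0 hX) mkG_coordsE.
pose start n i := mkG (th0 n i o) (om i o) (xi n i).
pose C := `|particle_growth K Mw Lw T| + 1.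
have C0 : 0 < C by rewrite ltr_wpDl.
have start_le n : (0 < n)%N -> bl_dist (empirical n (start n)) m0 <= bl_dist (mun n 0) (mu 0).
  move=> n0; apply: bl_dist_le => f hf.
  have := bl_dist_ge (empirical_mass (fun i => mkG (th n i 0) (om i o) (xi n i)) n0)
    (@probability_setT _ _ _ (mu 0)) hf.
  have mf : measurable_fun setT f by apply: continuous_measurableG; exact: BL_continuous.
  have f0 P : 0 <= f P by case: hf => /(_ P)/andP[].
  rewrite !empirical_Rint //.
  have -> : \int[mu 0]_P f P = \int[m0]_P f P.
    by rewrite /Rintegral; congr fine; apply: eq_measure_integral => A mA _; rewrite [RHS]mu0.
  suff -> : \sum_(i < n) f (mkG (th n i 0) (om i o) (xi n i)) = \sum_(i < n) f (start n i) by [].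
  by apply: eq_bigr => i _; have [-> _ _] := hth n i (ltn_ord i).
have small : \forall n \near \oo, bl_dist (mun n 0) (mu 0) < e / C.
  have /cvgrPdist_lt /(_ (e / C)) := hmun.
  rewrite divr_gt0 // => /(_ isT); apply: filterS => n; rewrite sub0r normrN.
  exact: le_lt_trans (ler_norm _).
near=> n => t tT.
have n0 : (0 < n)%N by near: n; exact: nbhs_infty_gt.
have hxin i : (i < n)%N -> 0 <= xi n i <= 1 by exact: hxi.1.
have h := empirical_close hw T_gt0 hu n0 hxin (hth n) tT (fun A mA => hmuT t A tT mA).
apply: le_lt_trans h _.
set del := bl_dist _ _; have del0 : 0 <= del by exact: (delta_ge0 m0 (xi n) (fun i => om i o) (fun i => th0 n i o) n0).
apply: (@le_lt_trans _ _ (C * del)).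
  by rewrite ler_wpM2r // /C (le_trans (ler_norm _)) // lerDl.
rewrite mulrC -ltr_pdivlMr //; apply: le_lt_trans (start_le n n0) _.
by near: n.
Unshelve. all: by end_near. Qed.
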